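(* Let $\vec\nu=(\nu_1,\ldots,\nu_m)$ be a fixed multiple weight on $\mathbb{R}^n$ (a vector of positive functions), $\vec p=(p_1,\ldots,p_m)$ with $1<p_j<\infty$, $1/p=1/p_1+\cdots+1/p_m$, $1\le p<\infty$, and let $\widetilde T$ be an $m$-linear operator satisfying $$\|\widetilde T\|_{L^{p_1}(\mu_1)\times\cdots\times L^{p_m}(\mu_m)\to L^p(\nu_{\vec\lambda})}\le C_{n,m,\vec p,\widetilde T}\big([\vec\mu]_{A_{\vec p}},[\vec\lambda]_{A_{\vec p}}\big)$$ for all $\vec\mu,\vec\lambda\in A_{\vec p}$ with $\mu_j/\lambda_j=\nu_j^{p_j}$ for all $j$, where $C_{n,m,\vec p,\widetilde T}(\cdot,\cdot)$ is an increasing function of both components. For $\vec k=(k_1,\ldots,k_m)$ with integers $k_j\ge0$, let $b_j^i\in\mathrm{BMO}(\mathbb{R}^n)$ for $1\le i\le k_j$, $1\le j\le m$. Then for all such $\vec\mu,\vec\lambda$, $$\big\|C^{\vec k,m}_{\{\vec b\}}(\widetilde T)\big\|_{L^{p_1}(\mu_1)\times\cdots\times L^{p_m}(\mu_m)\to L^p(\nu_{\vec\lambda})}\le C_{n,m,\vec p,\vec k,\widetilde T}\big([\vec\mu]_{A_{\vec p}},[\vec\lambda]_{A_{\vec p}}\big)\prod_{j=1}^m\prod_{i=1}^{k_j}\|b_j^i\|_{\mathrm{BMO}(\mathbb{R}^n)},$$ where $C_{n,m,\vec p,\vec k,\widetilde T}(\cdot,\cdot)$ is a finite function depending only on the indicated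 parameters, and if $k_j=0$ for some $j$ then the corresponding BMO norms do not appear on the right-hand side.
   Context: Weights. For $\vec p=(p_1,\ldots,p_m)$, $1<p_j<\infty$, $1/p=\sum_j1/p_j$, a vector $\vec w=(w_1,\ldots,w_m)$ of positive functions on $\mathbb{R}^n$ is a multilinear $A_{\vec p}$ weight if $$[\vec w]_{A_{\vec p}}^{1/p}:=\sup_Q\Big(\fint_Q\nu_{\vec w}\Big)^{1/p}\prod_{j=1}^m\Big(\fint_Q w_j^{1-p_j'}\Big)^{1/p_j'}<\infty,\qquad\nu_{\vec w}:=\prod_{j=1}^m w_j^{p/p_j},$$ with supremum over all cubes $Q\subset\mathbb{R}^n$; $\fint_Q$ is the Lebesgue average and $p_j'$ the conjugate exponent. In particular $\nu_{\vec\lambda}=\prod_j\lambda_j^{p/p_j}$. $L^p(w)$ has norm $(\int|f|^pw\,dx)^{1/p}$. $\mathrm{BMO}(\mathbb{R}^n)$ is the usual unweighted space, with seminorm $\sup_Q\fint_Q|b-\langle b\rangle_Q|\,dx$. Commutators. For an $m$-linear operator $T$ acting on functions on $\mathbb{R}^n$ and a function $b$, $[b,T]_\beta(f_1,\ldots,f_m):=bT(f_1,\ldots,f_m)-T(f_1,\ldots,bf_\beta,\ldots,f_m)$, $1\le\beta\le m$. Given $\vec b_j=(b_j^1,\ldots,b_j^{k_j})$, $1\le j\le m$, the higher order commutator $C^{\vec k,m}_{\{\vec b\}}(T)$ (also written $C^{\vec k,m}_{\{\vec b_j\}}(T)$) is obtained from $T$ by successively applying, for $j=1,2,\ldots,m$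 in this order and, for each $j$, for $i=1,2,\ldots,k_j$ in this order, the operation $S\mapsto[b_j^i,S]_j$; that is, $$C^{\vec k,m}_{\{\vec b\}}(T)=\big[b_m^{k_m},\cdots,[b_m^1,\cdots,[b_2^1,[b_1^{k_1},\cdots,[b_1^1,T]_1\cdots]_1]_2\cdots]_m\cdots\big]_m.$$ If $k_j=0$ there is no commutation in the $j$-th component. *)

(* Defs.v *)
From HB Require Import structures.
From mathcomp Require Import all_boot all_order all_algebra.
From mathcomp Require Import all_classical all_reals all_analysis.
From mathcomp Require Import complex.

Set Implicit Arguments.
Unset Strict Implicit.
Unset Printing Implicit Defensive.

Import Order.TTheory GRing.Theory Num.Theory.

Local Open Scope classical_set_scope.
Local Open Scope ring_scope.

Notation "''R' [ R ] ^ n" := (n.-tuple (measurableTypeR R))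
  (at level 2, R at level 200, n at level 1, format "''R' [ R ] ^ n").

Section lebesgue_cons.
Context {R : realType} (n : nat).
Variable mu : {sigma_finite_measure set 'R[R]^n -> \bar R}.

Definition cons_pair (xt : measurableTypeR R * 'R[R]^n) : 'R[R]^(n.+1) :=
  [tuple of xt.1 :: xt.2].

Lemma measurable_cons_pair : measurable_fun setT cons_pair.
Proof. exact: measurable_cons. Qed.

Definition lebesgue_cons : set 'R[R]^(n.+1) -> \bar R :=
  pushforward (lebesgue_measure \x mu)%E cons_pair.

Let lebesgue_cons0 : lebesgue_cons set0 = 0%E.
Proof. by rewrite /lebesgue_cons /pushforward preimage_set0 measure0. Qed.

Let lebesgue_cons_ge0 A : (0 <= lebesgue_cons A)%E.
Proof. by rewrite /lebesgue_cons /pushforward measure_ge0. Qed.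

Let lebesgue_cons_sigma_additive : semi_sigma_additive lebesgue_cons.
Proof.
move=> F mF tF mUF; rewrite /lebesgue_cons /pushforward preimage_bigcup.
apply: measure_semi_sigma_additive.
- by move=> k; rewrite -[X in measurable X]setTI; exact: measurable_cons_pair.
- apply/trivIsetP => /= i j _ _ ij; rewrite -preimage_setI.
  by move/trivIsetP : tF => /(_ _ _ _ _ ij) ->//; rewrite preimage_set0.
- rewrite -preimage_bigcup -[X in measurable X]setTI.
  exact: measurable_cons_pair.
Qed.

HB.instance Definition _ := isMeasure.Build _ _ _ lebesgue_cons
  lebesgue_cons0 lebesgue_cons_ge0 lebesgue_cons_sigma_additive.

Let lebesgue_cons_sigma_finite : sigma_finite setT lebesgue_cons.
Proof.
have /sigma_finiteP[F [TF ndF Foo]] := sigma_finiteT (@lebesgue_measure R).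
have /sigma_finiteP[G [TG ndG Goo]] := sigma_finiteT mu.
pose g (y : 'R[R]^(n.+1)) : (measurableTypeR R * 'R[R]^n)%type :=
  (tnth y ord0, [tuple of behead y]).
have gK x : g (cons_pair x) = x.
  by case: x => a b; rewrite /g /cons_pair /=; congr pair; apply/val_inj.
have mg : measurable_fun setT g.
  apply/measurable_fun_pairP; split; first exact: measurable_tnth.
  exact: measurable_behead.
exists (fun i => g @^-1` (F i `*` G i)).
  rewrite -preimage_bigcup -[LHS](@preimage_setT _ _ g); congr (_ @^-1` _).
  rewrite -setXTT TF TG; apply/seteqP; split => -[x y].
    move=> [/= [i _ Fix] [j _ Gjy]]; exists (maxn i j) => //; split.
    - by move: x Fix; exact/subsetPset/ndF/leq_maxl.
    - by move: y Gjy; exact/subsetPset/ndG/leq_maxr.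
  by move=> [i _ []/= ? ?]; split; exists i.
move=> i; have [mF Fi] := Foo i; have [mG Gi] := Goo i; split.
  by rewrite -[X in measurable X]setTI; apply: mg => //; exact: measurableX.
rewrite /lebesgue_cons /pushforward.
rewrite (_ : cons_pair @^-1` _ = F i `*` G i)//; last first.
  by rewrite -comp_preimage (_ : g \o cons_pair = id)//; apply/funext.
by rewrite product_measure1E// lte_mul_pinfty// ge0_fin_numE.
Qed.

HB.instance Definition _ := Measure_isSigmaFinite.Build _ _ _ lebesgue_cons
  lebesgue_cons_sigma_finite.

End lebesgue_cons.

Fixpoint lebesgue_tuple {R : realType} (n : nat) :
    {sigma_finite_measure set 'R[R]^n -> \bar R} :=
  if n is n'.+1 then lebesgue_cons (lebesgue_tuple n')
  else dirac ([tuple] : 'R[R]^0).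

(* Since boxes generate the sigma-algebra, this characterizes lebesgue_tuple
   as the n-dimensional Lebesgue measure on Borel sets. *)
Lemma lebesgue_tuple_box (R : realType) (n : nat) (A : 'I_n -> set R) :
  (forall i, measurable (A i : set (measurableTypeR R))) ->
  lebesgue_tuple n [set x : 'R[R]^n | forall i, A i (tnth x i)] =
  (\prod_(i < n) lebesgue_measure (A i))%E.
Proof.
elim: n A => [|n IHn] A mA.
  rewrite big_ord0 /= diracE mem_set//= => i; by case: i.
rewrite big_ord_recl /= /lebesgue_cons /pushforward.
rewrite (_ : _ @^-1` _ = A ord0 `*`
    [set x : 'R[R]^n | forall i, A (lift ord0 i) (tnth x i)]); last first.
  apply/seteqP; split => -[a x] /=.
    move=> H; split; first exact: (H ord0).
    by move=> i; have := H (lift ord0 i); rewrite /cons_pair /= tnthS.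
  move=> [a0 H] i; case: (unliftP ord0 i) => [j ->|->//].
  by rewrite /cons_pair /= tnthS; exact: H.
rewrite product_measure1E; [|exact: mA|].
  by congr (_ * _)%E; apply: (IHn (fun i => A (lift ord0 i))) => i; exact: mA.
rewrite (_ : mkset _ = \bigcap_(i in [set: 'I_n])
  ((fun x : 'R[R]^n => tnth x i) @^-1` A (lift ord0 i))); last first.
  by apply/seteqP; split => [x H i _|x H i]; [exact: H|exact: (H i I)].
apply: fin_bigcap_measurable => // i _.
by rewrite -[X in measurable X]setTI; exact: measurable_tnth.
Qed.

Section definitions.
Context {R : realType} {n : nat}.

Local Notation mu := (@lebesgue_tuple R n).
Local Notation point := ('R[R]^n).

Definition cube (a : point) (l : R) : set point :=
  [set x | forall i, tnth a i <= tnth x i <= tnth a i + l].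

Definition cubes : set (set point) :=
  [set Q | exists a l, 0 < l /\ Q = cube a l].

Definition avg (Q : set point) (f : point -> R) : \bar R :=
  ((mu Q)^-1 * \int[mu]_(x in Q) (f x)%:E)%E.

Definition cmeasurable (f : point -> R[i]) : Prop :=
  measurable_fun setT (fun x => complex.Re (f x)) /\
  measurable_fun setT (fun x => complex.Im (f x)).

Definition cavg (Q : set point) (f : point -> R[i]) : R[i] :=
  Complex (fine (avg Q (fun x => complex.Re (f x))))
          (fine (avg Q (fun x => complex.Im (f x)))).

Definition bmo_norm (b : point -> R[i]) : \bar R :=
  ereal_sup [set avg Q (fun x => Normc.normc (b x - cavg Q b)) | Q in cubes].

Definition BMO (b : point -> R[i]) : Prop :=
  [/\ cmeasurable b,
      forall Q, cubes Q -> (\int[mu]_(x in Q) (Normc.normc (b x))%:E < +oo)%E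
    & (bmo_norm b < +oo)%E].

Definition weight (w : point -> R) : Prop :=
  measurable_fun setT w /\ forall x, 0 < w x.

Definition wnorm (p : R) (w : point -> R) (f : point -> R[i]) : \bar R :=
  ((\int[mu]_x (Normc.normc (f x) `^ p * w x)%:E) `^ p^-1)%E.

Definition wLp (p : R) (w : point -> R) (f : point -> R[i]) : Prop :=
  cmeasurable f /\ (wnorm p w f < +oo)%E.

Section multilinear.
Context {m : nat}.
Implicit Types (w lam nu : 'I_m -> point -> R) (ps : 'I_m -> R)
  (f : 'I_m -> point -> R[i]).

Definition conj_exp (q : R) : R := q / (q - 1).

Definition nu_weight (p : R) ps w (x : point) : R :=
  \prod_(j < m) w j x `^ (p / ps j).

Definition Ap_sup (p : R) ps w : \bar R :=
  ereal_sup [set (avg Q (nu_weight p ps w) `^ p^-1 *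
    \prod_(j < m) avg Q (fun x => w j x `^ (1 - conj_exp (ps j)))%R
                    `^ (conj_exp (ps j))^-1)%E | Q in cubes].

(* The supremum Ap_sup is the 1/p-th power of the A_p constant. *)
Definition Ap_const (p : R) ps w : \bar R := (Ap_sup p ps w `^ p)%E.

Definition Ap (p : R) ps w : Prop :=
  (forall j, weight (w j)) /\ (Ap_sup p ps w < +oo)%E.

Definition Bloom_pair (p : R) ps nu w lam : Prop :=
  [/\ Ap p ps w, Ap p ps lam
    & forall j x, w j x / lam j x = nu j x `^ ps j].

(* An operator acts on representatives and is a total function; it carries
   content only on the product spaces where it is required to be multilinear
   (up to null sets) and bounded. *)

Definition operator := ('I_m -> point -> R[i]) -> point -> R[i].

Definition in_Lps ps w f : Prop := forall j, wLp (ps j) (w j) (f j).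

Definition multilinear_on ps w (T : operator) : Prop :=
  forall f (j : 'I_m) (c : R[i]) (g h : point -> R[i]),
    in_Lps ps w f -> wLp (ps j) (w j) g -> wLp (ps j) (w j) h ->
    {ae mu, forall x, T [eta f with j |-> fun y => c * g y + h y] x =
      c * T [eta f with j |-> g] x + T [eta f with j |-> h] x}.

Definition bound_on p ps w (v : point -> R) (T : operator) (K : R) : Prop :=
  0 <= K /\ forall f, in_Lps ps w f ->
    wLp p v (T f) /\
    (wnorm p v (T f) <= K%:E * \prod_(j < m) wnorm (ps j) (w j) (f j))%E.

(* +oo when T fails to map the product space into the target space. *)
Definition opnorm p ps w (v : point -> R) (T : operator) : \bar R :=
  ereal_inf [set K%:E | K in bound_on p ps w v T].

Definition commutator (b : point -> R[i]) (beta : 'I_m) (T : operator) :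
    operator :=
  fun f x => b x * T f x - T [eta f with beta |-> fun y => b y * f beta y] x.

(* Both folds run in increasing order of the index, so that b j 0 is applied
   before (inside) b j 1, and all of slot j before slot j + 1. *)
Definition higher_commutator (k : 'I_m -> nat)
    (b : forall j : 'I_m, 'I_(k j) -> point -> R[i]) (T : operator) : operator :=
  foldl (fun S j => foldl (fun S' i => commutator (b j i) j S') S
                          (enum 'I_(k j)))
        T (enum 'I_m).

End multilinear.
End definitions.
Arguments operator : clear implicits.

(* The arguments are A_p constants, hence only nonnegative values matter. *)
Definition increasing2 {R : realType} (C : R -> R -> R) : Prop :=
  forall x x' y y', 0 <= x <= x' -> 0 <= y <= y' -> C x y <= C x' y'.

(* Main.v *)
Require Import Defs.
From mathcomp Require Import all_boot all_order all_algebra.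
From mathcomp Require Import all_classical all_reals all_analysis.
From mathcomp Require Import complex measurable_realfun.
From mathcomp Require Import ring lra zify.
From mathcomp Require Import separable cyclotomic cyclic.

Set Implicit Arguments.
Unset Strict Implicit.
Unset Printing Implicit Defensive.

Import Order.TTheory GRing.Theory Num.Theory.
Import numFieldNormedType.Exports.

Local Open Scope classical_set_scope.
Local Open Scope ring_scope.

(** The proof turns the commutator into a derivative and conjugates the weights.

    Fix a slot [beta] and a symbol [b].  With [U_z := S(.., e^(-zb) f_beta, ..)]
    the commutator [[b,S]_beta f] is the derivative at [z = 0] of
    [e^(zb) U_z], so Cauchy's formula on the circle [|z| = r] bounds it by
    [1/r] times the largest norm of [e^(zb) U_z] on that circle.  Since
    [|e^(zb)| = e^(Re zb)], that norm is the norm of [S] between the spaces with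
    weights [w_beta e^(p_beta Re zb)] and [lam_beta e^(p_beta Re zb)].  Both
    weights are multiplied by the same factor, so their quotient is still
    [nu_beta^(p_beta)], and the hypothesis on [S] applies as soon as the two
    perturbed vectors are [A_p] weights with controlled constants.  A radius
    [r] comparable to [1 / |b|_BMO] achieves this, which is where the factor
    [|b|_BMO] in the conclusion comes from.  Repeating the step for each
    symbol, slot after slot, gives the higher order commutator: a bound
    depending on the constants alone is turned into another such bound.

    Stability of the [A_p] class ([Ap_perturb]).  Let [nu_w] and the dual
    weights [w_j^(1-p_j')] be listed as one family [W_i] with exponents [e_i].
    Then [prod_i W_i^(1/e_i) = 1] and the [A_p] condition bounds
    [prod_i <W_i>_Q^(1/e_i)], so that multiplying [w_beta] by [e^(p_beta g)]
    multiplies two members by [e^(e_i g)] and [e^(-e_i g)].  By the inequality of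
    arithmetic and geometric means, no [W_i] concentrates on half of a cube
    ([Aprod_halving]); this is the quantitative [A_infinity] property, and it is
    all that the John-Nirenberg stopping argument needs to bound
    [int_Q e^(|g - c_Q|) W_i] by a multiple of [int_Q W_i]
    ([weighted_john_nirenberg]).  Collecting the factors, the constants
    [e^(c_Q)] and [e^(-c_Q)] cancel.  The stopping argument itself ([stopping_cells]) is run on an
    abstract sequence of nested countable partitions, of which the dyadic
    subdivisions of a cube are an instance.

    Cauchy's formula ([contour_extraction]).  The integral over the circle is
    replaced by the average over the [(2L+1)]-th roots of unity, which extracts
    the first coefficient of a polynomial of degree at most [2L] exactly.  Here
    the polynomial is the product of the Taylor polynomials of [e^(zb)] and of
    [U_z].  The remainders tend to zero in the larger space with weight
    [w_beta e^(-p_beta rho |b|)], in which all [b^l f_beta] lie; by the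
    stability result the operator is multilinear and bounded there too, which
    gives a meaning to [S(.., b f_beta, ..)] in the first place.  The bound in
    the original space is recovered on the sets [|b| <= M], then by monotone
    convergence. *)

(** * Nested countable partitions and stopping cells *)

Lemma ge0_integral_setID d (T : measurableType d) (R : realType)
    (mu : {measure set T -> \bar R}) (E A : set T) (f : T -> \bar R) :
  measurable E -> measurable A -> measurable_fun setT f ->
  (forall x, 0 <= f x)%E ->
  (\int[mu]_(x in E) f x =
   \int[mu]_(x in E `&` A) f x + \int[mu]_(x in E `\` A) f x)%E.
Proof.
move=> mE mA mf f0; rewrite -[in LHS](setUIDK E A) ge0_integral_setU//.
- exact: measurableI.
- exact: measurableD.
- exact: measurable_funTS.
- by apply/disj_set2P; rewrite -setIA setDIK setI0.
Qed.

Section nested_partitions.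
Context d (T : measurableType d) (R : realType).
Context (mu : {measure set T -> \bar R}) (J : countType) (addr : nat -> T -> J).

Definition cell (k : nat) (x : T) : set T := [set y | addr k y = addr k x].
(** The sets measurable with respect to the [k]-th partition; unions of cells are
    handled through this invariance instead of through index sets. *)
Definition saturated (k : nat) (E : set T) : Prop :=
  forall x y, addr k y = addr k x -> E x -> E y.

Hypothesis mcell : forall k x, measurable (cell k x).
Hypothesis nested : forall k x y, addr k.+1 y = addr k.+1 x -> addr k y = addr k x.

Lemma cell_eq k x y : cell k x y -> cell k y = cell k x.
Proof. by rewrite /cell /= => ->. Qed.

Lemma saturated_cell k x : saturated k (cell k x).
Proof. by move=> y z; rewrite /cell /= => -> ->. Qed.

Lemma addr_le k l x y : (k <= l)%N -> addr l y = addr l x -> addr k y = addr k x.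
Proof.
move=> /subnK <-; elim: (l - k)%N => [//|j IH] /=.
by rewrite addSn => /nested; exact: IH.
Qed.

Lemma saturated_le (k l : nat) E : (k <= l)%N -> saturated k E -> saturated l E.
Proof. by move=> kl sE x y /(addr_le kl); exact: sE. Qed.

Lemma saturatedC k E : saturated k E -> saturated k (~` E).
Proof. by move=> sE x y xy nEx Ey; apply: nEx; apply: sE Ey. Qed.

Lemma saturatedU k E F : saturated k E -> saturated k F -> saturated k (E `|` F).
Proof. by move=> sE sF x y xy [/(sE _ _ xy)|/(sF _ _ xy)]; [left|right]. Qed.

(** A cell of a saturated set, indexed by a natural number instead of an address,
    so that countable additivity applies. *)
Let slice k (F : set T) (n : nat) : set T := [set y | F y /\ pickle (addr k y) = n].

Let slice_cell k F n : saturated k F -> slice k F n !=set0 ->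
  exists2 x, F x & slice k F n = cell k x.
Proof.
move=> sF [x [Fx xn]]; exists x => //; apply/seteqP; split => y.
  by move=> [Fy]; rewrite -xn => /(pcan_inj pickleK).
by move=> yx; split; [exact: sF Fx|rewrite yx].
Qed.

Let slice_measurable k F n : saturated k F -> measurable (slice k F n).
Proof.
move=> sF; have [->|/set0P/(slice_cell sF)[x _ ->]] := eqVneq (slice k F n) set0.
  exact: measurable0.
exact: mcell.
Qed.

Let bigcup_slice k F : F = \bigcup_n slice k F n.
Proof.
by apply/seteqP; split => [x Fx|x [n _ []//]]; exists (pickle (addr k x)).
Qed.

Lemma saturated_measurable k F : saturated k F -> measurable F.
Proof.
move=> sF; rewrite (bigcup_slice k F); apply: bigcup_measurable => n _.
exact: slice_measurable.
Qed.

(** Additivity over the countably many cells of a saturated set: an estimate on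
    each cell gives the same estimate on the whole set. *)
Lemma cellwise_le_integral k F (u v : T -> \bar R) : saturated k F ->
  measurable_fun setT u -> measurable_fun setT v ->
  (forall x, 0 <= u x)%E -> (forall x, 0 <= v x)%E ->
  (forall x, F x ->
    \int[mu]_(y in cell k x) u y <= \int[mu]_(y in cell k x) v y)%E ->
  (\int[mu]_(y in F) u y <= \int[mu]_(y in F) v y)%E.
Proof.
move=> sF mu_ mv u0 v0 uv; rewrite (bigcup_slice k F).
have tF : trivIset setT (slice k F).
  by move=> i j _ _ [x [[_ <-] [_ <-]]].
rewrite !ge0_integral_bigcup//; last 4 first.
- by move=> n; exact: slice_measurable.
- exact: measurable_funTS.
- by move=> n; exact: slice_measurable.
- exact: measurable_funTS.
apply: lee_nneseries => [n _ _|n _]; first exact: integral_ge0.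
have [->|/set0P/(slice_cell sF)[x Fx ->]] := eqVneq (slice k F n) set0.
  by rewrite !integral_set0.
exact: uv.
Qed.

Section approximation.
Variable rho : {measure set T -> \bar R}.
Hypothesis rho_fin : (rho setT < +oo)%E.
Hypothesis gen :
  @measurable _ T `<=` <<s [set A | exists k, saturated k A] >>.

(** Sets that are close to saturated ones form a sigma-algebra, hence contain the
    sigma-algebra generated by the cells. *)
Let symdiff (E A : set T) := (E `\` A) `|` (A `\` E).

Let approximable (E : set T) := measurable E /\
  forall e : R, 0 < e -> exists k A, saturated k A /\ (rho (symdiff E A) < e%:E)%E.

Let msymdiff E A : measurable E -> measurable A -> measurable (symdiff E A).
Proof. by move=> mE mA; apply: measurableU; exact: measurableD. Qed.

Let approximableU E F : approximable E -> approximable F -> approximable (E `|` F).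
Proof.
move=> [mE aE] [mF aF]; split; first exact: measurableU.
move=> e e0; have e20 : 0 < e / 2 by rewrite divr_gt0.
have [k [A [sA EA]]] := aE _ e20; have [l [B [sB FB]]] := aF _ e20.
have sA' := saturated_le (leq_maxl k l) sA.
have sB' := saturated_le (leq_maxr k l) sB.
have mA := saturated_measurable sA; have mB := saturated_measurable sB.
exists (maxn k l), (A `|` B); split; first exact: saturatedU.
apply: (@le_lt_trans _ _ (rho (symdiff E A `|` symdiff F B))).
  apply: le_measure; rewrite ?inE.
  - by apply: msymdiff; exact: measurableU.
  - by apply: measurableU; exact: msymdiff.
  - by move=> x [[[Ex|Fx]]|[[Ax|Bx]]] /not_orP[? ?]; rewrite /symdiff /=; tauto.
apply: (le_lt_trans (measureU2 _ _ _)); [exact: msymdiff..|].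
by rewrite [e]splitr EFinD lteD.
Qed.

Lemma saturated_approximation (E : set T) (e : R) : measurable E -> 0 < e ->
  exists k A, saturated k A /\ (rho ((E `\` A) `|` (A `\` E)) < e%:E)%E.
Proof.
suff H : <<s [set A | exists k, saturated k A] >> `<=` approximable.
  by move=> /gen/H [_]; exact.
move=> {E e}; apply: smallest_sub; last first.
  move=> A [k sA]; split; first exact: saturated_measurable sA.
  move=> e e0; exists k, A; split => //.
  by rewrite /symdiff setDv setU0 measure0 lte_fin.
split.
- split => // e e0; exists 0%N, set0; split; first by move=> x y _ [].
  by rewrite /symdiff setDv setU0 measure0 lte_fin.
- move=> E [mE aE]; rewrite setTD; split; first exact: measurableC.
  move=> e /aE[k [A [sA EA]]]; exists k, (~` A); split; first exact: saturatedC.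
  rewrite (_ : symdiff (~` E) (~` A) = symdiff E A)//.
  by rewrite /symdiff !setDE !setCK setUC (setIC A) (setIC (~` A)).
- move=> F aF.
  pose G n := \big[setU/set0]_(i < n) F i.
  have aG n : approximable (G n).
    rewrite /G; elim: n => [|n IH]; last by rewrite big_ord_recr; exact: approximableU.
    rewrite big_ord0; split => // e e0; exists 0%N, set0; split => //.
    by rewrite /symdiff setDv setU0 measure0 lte_fin.
  have mU : measurable (\bigcup_i F i).
    by apply: bigcup_measurable => i _; have [] := aF i.
  split => // e e0; have e20 : 0 < e / 2 by rewrite divr_gt0.
  pose H n := (\bigcup_i F i) `\` G n.
  have mH n : measurable (H n) by apply: measurableD => //; have [] := aG n.
  have H0 : \bigcap_n H n = set0.
    rewrite -subset0 => x Hx; have [[i _ Fix] _] := Hx 0%N I.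
    have [_] := Hx i.+1 I; apply; rewrite /G -bigcup_mkord.
    by exists i => /=.
  have /(_ _) cvgH := @nonincreasing_cvg_mu _ _ _ rho H.
  have : (rho \o H) x @[x --> \oo] --> rho (\bigcap_n H n).
    apply: cvgH => //; last 1 first.
    - move=> i j ij; apply/subsetPset.
      apply: setDS; rewrite /G -!bigcup_mkord => x [l /= li Fx]; exists l => //=.
      exact: leq_trans ij.
    - apply: le_lt_trans rho_fin; by apply: le_measure; rewrite ?inE//; exact: mH.
    - by rewrite H0.
  rewrite H0 measure0 => /fine_cvgP[] _.
  move=> /cvgrPdist_lt/(_ _ e20)[N _ HN].
  have [_ /(_ _ e20)[k [A [sA GA]]]] := aG N.
  exists k, A; split => //.
  have mA := saturated_measurable sA; have [mG _] := aG N.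
  apply: (@le_lt_trans _ _ (rho (H N `|` symdiff (G N) A))).
    apply: le_measure; rewrite ?inE.
    - exact: msymdiff.
    - by apply: measurableU => //; exact: msymdiff.
    - move=> x [[Fx nAx]|[Ax nFx]].
        have [Gx|nGx] := pselect (G N x); first by right; left.
        by left.
      right; right; split => // Gx; apply: nFx; move: Gx.
      by rewrite /G -bigcup_mkord => -[i /= _ Fi]; exists i.
  apply: (le_lt_trans (measureU2 _ _ _)); [exact: mH|exact: msymdiff|].
  rewrite [e]splitr EFinD lteD//.
  have := HN N (leqnn _); rewrite /= sub0r normrN.
  have HNfin : rho (H N) \is a fin_num.
    rewrite ge0_fin_numE//; apply: le_lt_trans rho_fin.
    by apply: le_measure => //; rewrite ?inE.
  by rewrite ger0_norm ?fine_ge0// -lte_fin fineK.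
Qed.

End approximation.

Section stopping.
Hypothesis gen :
  @measurable _ T `<=` <<s [set A | exists k, saturated k A] >>.
Variables (x0 : T) (h : T -> R) (lam D : R).
Let Q := cell 0%N x0.
Hypothesis Qfin : (mu Q < +oo)%E.
Hypothesis mh : measurable_fun setT h.
Hypothesis h0 : forall x, 0 <= h x.
Hypothesis lam0 : 0 < lam.
Hypothesis doubling : forall k x, (mu (cell k x) <= D%:E * mu (cell k.+1 x))%E.

Let mQ : measurable Q. Proof. exact: mcell. Qed.

Let saturatedQ k : saturated k Q.
Proof. exact: (@saturated_le 0%N k _ (leq0n k) (@saturated_cell 0%N x0)). Qed.

(** The one-sided Lebesgue differentiation theorem for cells: if all cells around
    the points of [G] have averages at most [lam], then [h <= lam] almost
    everywhere on [G].  Otherwise the set [E] where this fails is approximated by a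
    union of cells of one level; the cells that count have averages at most
    [lam], so the integral of [h] over [E] is at most [lam * mu E], although
    [h > lam] on [E]. *)
Lemma ae_le_of_cells (G : set T) : measurable G -> G `<=` Q ->
  (forall k x, G x ->
     \int[mu]_(y in cell k x) (h y)%:E <= lam%:E * mu (cell k x))%E ->
  mu (G `&` [set x | lam < h x]) = 0%E.
Proof.
move=> mG GQ hG.
(* Truncating just above [lam] keeps the strict inequality on the exceptional set
   and makes integrals over small sets small. *)
pose g x := Num.min (h x) (lam + 1).
have mg : measurable_fun setT g.
  by rewrite (_ : g = h \min cst (lam + 1))//; exact: measurable_minr.
have g0 x : 0 <= g x by rewrite le_min h0 addr_ge0// ltW.
have gl x : g x <= lam + 1 by rewrite ge_min lexx orbT.
have mE : measurable (G `&` [set x | lam < h x]).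
  apply: measurableI => //.
  have := mh measurableT (measurable_itv `]lam, +oo[).
  rewrite setTI; congr measurable; apply/funext => x.
  by rewrite /preimage /= in_itv /= andbT.
set E := G `&` _ in mE *.
have EQ : E `<=` Q by move=> x [/GQ].
have EfinN A : A `<=` Q -> measurable A -> mu A \is a fin_num.
  move=> AQ mA; rewrite ge0_fin_numE//; apply: le_lt_trans Qfin.
  by apply: le_measure; rewrite ?inE.
have key (e : R) : 0 < e ->
  (\int[mu]_(x in E) (g x)%:E <= lam%:E * mu E + ((2 * lam + 1) * e)%:E)%E.
  move=> e0.
  have rfin : (mrestr mu mQ setT < +oo)%E by rewrite /mrestr setTI.
  have [k [A [sA EA]]] := @saturated_approximation (mrestr mu mQ) rfin gen E e mE e0.
  have mA := saturated_measurable sA.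
  pose A' := (A `&` Q) `&`
    [set x | (\int[mu]_(y in cell k x) (g y)%:E <= lam%:E * mu (cell k x))%E].
  have sA' : saturated k A'.
    move=> x y xy [[Ax Qx] gx]; split.
      by split; [exact: sA Ax|exact: (saturatedQ (k := k)) Qx].
    by rewrite /= (@cell_eq k x y).
  have mA' := saturated_measurable sA'.
  have mEG : measurable_fun setT (fun x => (g x)%:E) by exact/measurable_EFinP.
  have E1 : (mu (E `\` A) <= e%:E)%E.
    apply/ltW; apply: le_lt_trans EA; rewrite /mrestr; apply: le_measure; rewrite ?inE.
    - exact: measurableD.
    - by apply: measurableI => //; apply: measurableU; exact: measurableD.
    - by move=> x [Ex nAx]; split; [left|exact: EQ].
  have E2 : (mu (A' `\` E) <= e%:E)%E.
    apply/ltW; apply: le_lt_trans EA; rewrite /mrestr; apply: le_measure; rewrite ?inE.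
    - exact: measurableD.
    - by apply: measurableI => //; apply: measurableU; exact: measurableD.
    - by move=> x [[[Ax Qx] _] nEx]; split => //; right.
  have EA' : E `&` A `<=` A'.
    move=> x [Ex Ax]; split; first by split => //; exact: EQ.
    rewrite /=; apply: le_trans (hG k x _); last by case: Ex.
    apply: ge0_le_integral => //.
    - by move=> y _; rewrite lee_fin.
    - exact: measurable_funTS.
    - by apply: measurable_funTS; exact/measurable_EFinP.
    - by move=> y _; rewrite lee_fin ge_min lexx.
  rewrite (ge0_integral_setID mu mE mA mEG); last by move=> x; rewrite lee_fin.
  have I1 : (\int[mu]_(x in E `&` A) (g x)%:E <= lam%:E * (mu E + e%:E))%E.
    apply: (@le_trans _ _ (\int[mu]_(x in A') (g x)%:E)%E).
      apply: ge0_subset_integral => //; first exact: measurableI.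
        exact: measurable_funTS.
      by move=> x _; rewrite lee_fin.
    apply: (@le_trans _ _ (\int[mu]_(x in A') lam%:E)%E).
      apply: (@cellwise_le_integral k) => //.
      - by move=> x; rewrite lee_fin ltW.
      - by move=> x [_ gx]; rewrite integral_cst.
    rewrite integral_cst// lee_pmul2l ?lte_fin//.
    apply: (@le_trans _ _ (mu (E `|` (A' `\` E)))).
      apply: le_measure; rewrite ?inE//.
        by apply: measurableU => //; exact: measurableD.
      by move=> x A'x; have [Ex|nEx] := pselect (E x); [left|right].
    apply: (le_trans (measureU2 _ _ _)) => //; first exact: measurableD.
    by rewrite leeD2l.
  have I2 : (\int[mu]_(x in E `\` A) (g x)%:E <= (lam + 1)%:E * e%:E)%E.
    apply: (@le_trans _ _ (\int[mu]_(x in E `\` A) (lam + 1)%:E)%E).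
      apply: ge0_le_integral => //.
      - exact: measurableD.
      - by move=> y _; rewrite lee_fin.
      - exact: measurable_funTS.
      - by move=> y _; rewrite lee_fin.
    rewrite integral_cst//; last exact: measurableD.
    by rewrite lee_pmul2l// lte_fin addr_gt0.
  apply: (le_trans (leeD I1 I2)).
  have /fineK <- : mu E \is a fin_num by exact: EfinN.
  rewrite -!(EFinD, EFinM) lee_fin; lra.
have Ele : (\int[mu]_(x in E) (g x)%:E <= lam%:E * mu E)%E.
  apply/lee_addgt0Pr => e e0.
  have c0 : 0 < 2 * lam + 1 by rewrite addr_gt0// mulr_gt0.
  by have := key (e / (2 * lam + 1)) (divr_gt0 e0 c0); rewrite mulrC divfK// gt_eqF.
have mEg : measurable_fun E (fun x => (g x)%:E).
  by apply: measurable_funTS; exact/measurable_EFinP.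
have mEgl : measurable_fun E (fun x => (g x - lam)%:E).
  by apply: measurable_funTS; apply/measurable_EFinP; exact: measurable_funB.
have gE x : E x -> lam < g x by move=> [_ /= hx]; rewrite lt_min hx ltrDl ltr01.
have : (\int[mu]_(x in E) (g x - lam)%:E <= 0)%E.
  have : (\int[mu]_(x in E) (g x)%:E =
    \int[mu]_(x in E) (g x - lam)%:E + \int[mu]_(x in E) lam%:E)%E.
    rewrite -ge0_integralD//.
    - by apply: eq_integral => x _; rewrite -EFinD subrK.
    - by move=> x /gE; rewrite lee_fin subr_ge0 => /ltW.
    - by move=> x _; rewrite lee_fin ltW.
  rewrite integral_cst// => eqE; move: Ele; rewrite eqE.
  have Ef := EfinN _ EQ mE.
  by rewrite -[leRHS]add0e leeD2rE// fin_numM.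
move=> le0; have {le0} /ae_eq_integral_abs : (\int[mu]_(x in E) `|(g x - lam)%:E| = 0)%E.
  apply/eqP; rewrite eq_le; apply/andP; split; last exact: integral_ge0.
  apply: le_trans le0; rewrite le_eqVlt; apply/orP; left; apply/eqP.
  apply: eq_integral => x /set_mem/gE xE; rewrite gee0_abs// lee_fin subr_ge0 ltW//.
move=> /(_ mE mEgl) aeE; apply/(negligibleP mu mE); apply: negligibleS aeE.
by move=> x Ex /= /(_ Ex)[] /eqP; rewrite subr_eq0 => /eqP gx; have := gE _ Ex; rewrite gx ltxx.
Qed.

(** [first_heavy k] collects the cells of level [k] that are selected by the
    Calderon-Zygmund stopping rule at height [lam]. *)
Let heavy k x := Q x /\
  (lam%:E * mu (cell k x) < \int[mu]_(y in cell k x) (h y)%:E)%E.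

Let first_heavy k : set T := [set x | heavy k x /\ forall j, (j < k)%N -> ~ heavy j x].

Let saturated_heavy k : saturated k [set x | heavy k x].
Proof.
move=> x y xy [Qx hx]; split; first exact: (@saturatedQ k) Qx.
by rewrite (@cell_eq k x y).
Qed.

Let saturated_first_heavy k : saturated k (first_heavy k).
Proof.
move=> x y xy [hx nx]; split; first exact: saturated_heavy hx.
move=> j jk hj; apply: (nx _ jk).
exact: (saturated_le (ltnW jk) (@saturated_heavy j) (esym xy) hj).
Qed.

Let trivIset_first_heavy : trivIset setT first_heavy.
Proof.
move=> i j _ _ [x [[hi ni] [hj nj]]]; apply/eqP; rewrite eqn_leq.
by apply/andP; split; rewrite leqNgt; apply/negP => /[dup]; [move=> /ni|move=> /nj].
Qed.

(** The Calderon-Zygmund decomposition.  The parent of a selected cell is not heavy,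
    so doubling bounds the average over a selected cell by [lam * D]; level 0 is
    never selected because of the hypothesis on the average over [Q]. *)
Lemma stopping_cells :
  (\int[mu]_(y in Q) (h y)%:E <= lam%:E * mu Q)%E ->
  exists F : nat -> set T, [/\ forall k, saturated k (F k), trivIset setT F,
    \bigcup_k F k `<=` Q,
    (lam%:E * mu (\bigcup_k F k) <= \int[mu]_(y in Q) (h y)%:E)%E &
    (forall k x, F k x ->
      \int[mu]_(y in cell k x) (h y)%:E <= (lam * D)%:E * mu (cell k x))%E /\
    mu ((Q `\` \bigcup_k F k) `&` [set x | lam < h x]) = 0%E].
Proof.
move=> Qle; exists first_heavy.
have mF k : measurable (first_heavy k) by exact: saturated_measurable (@saturated_first_heavy k).
have mU : measurable (\bigcup_k first_heavy k) by exact: bigcup_measurable.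
have UQ : \bigcup_k first_heavy k `<=` Q by move=> x [k _ [[]]].
have mhE : measurable_fun setT (fun x => (h x)%:E) by exact/measurable_EFinP.
split => //.
- rewrite -integral_cst//.
  apply: (@le_trans _ _ (\int[mu]_(y in \bigcup_k first_heavy k) (h y)%:E)%E); last first.
    apply: ge0_subset_integral => //; first exact: measurable_funTS.
    by move=> x _; rewrite lee_fin.
  rewrite !ge0_integral_bigcup//; last 3 first.
  - exact: measurable_funTS.
  - by move=> x _; rewrite lee_fin.
  - by move=> x _; rewrite lee_fin ltW.
  apply: lee_nneseries => [k _ _|k _].
    by apply: integral_ge0 => x _; rewrite lee_fin ltW.
  apply: (@cellwise_le_integral k) => //.
  - by move=> x; rewrite lee_fin ltW.
  - by move=> x [[_ /ltW hx] _]; rewrite integral_cst.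
- split.
    move=> [|k] x [[Qx hx] nx].
      by move: hx; rewrite (_ : cell 0 x = Q) ?ltNge ?Qle//; exact: cell_eq.
    have {}nx : ~ heavy k x by exact: nx.
    have : (\int[mu]_(y in cell k x) (h y)%:E <= lam%:E * mu (cell k x))%E.
      by rewrite leNgt; apply/negP => hk; exact: nx.
    move=> hk; apply: (@le_trans _ _ (lam%:E * mu (cell k x))%E).
      apply: le_trans hk; apply: ge0_subset_integral => //.
      - exact: measurable_funTS.
      - by move=> y _; rewrite lee_fin.
      - by move=> y; exact: nested.
    by rewrite EFinM -muleA lee_pmul2l// lte_fin.
  apply: ae_le_of_cells => //; first exact: measurableD.
  move=> k x [Qx nUx]; rewrite leNgt; apply/negP => hk.
  have [l [hl nl]] : exists l, heavy l x /\ forall j, (j < l)%N -> ~ heavy j x.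
    have ex : exists k, `[< heavy k x >] by exists k; apply/asboolP.
    case: (ex_minnP ex) => l /asboolP hl ml; exists l; split => // j jl hj.
    by have := ml j (asboolT hj); rewrite leqNgt jl.
  by apply: nUx; exists l.
Qed.
End stopping.
End nested_partitions.

(** * Cubes and their dyadic subdivisions *)

Section cubes.
Context {R : realType} {n : nat}.
Local Notation point := ('R[R]^n).
Local Notation mu := (@lebesgue_tuple R n).

(** Half-open cubes, unlike the closed ones, are partitioned by their dyadic
    subcubes. *)
Definition hcube (a : point) (l : R) : set point :=
  [set x | forall i, tnth a i <= tnth x i < tnth a i + l].

Let measurable_box (A : 'I_n -> set R) :
  (forall i, measurable (A i : set (measurableTypeR R))) ->
  measurable [set x : point | forall i, A i (tnth x i)].
Proof.
move=> mA; rewrite (_ : mkset _ = \bigcap_(i in [set: 'I_n])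
  ((fun x : point => tnth x i) @^-1` A i)); last first.
  by apply/seteqP; split => [x H i _|x H i]; [exact: H|exact: (H i I)].
apply: fin_bigcap_measurable => // i _.
by rewrite -[X in measurable X]setTI; exact: measurable_tnth.
Qed.

Let hcubeE a l : hcube a l =
  [set x | forall i, [set` `[tnth a i, tnth a i + l[] (tnth x i)].
Proof. by apply/seteqP; split => x H i; have := H i; rewrite /= in_itv. Qed.

Let cubeE (a : point) l : cube a l =
  [set x | forall i, [set` `[tnth a i, tnth a i + l]] (tnth x i)].
Proof. by apply/seteqP; split => x H i; have := H i; rewrite /= in_itv. Qed.

Lemma measurable_hcube a l : measurable (hcube a l).
Proof. by rewrite hcubeE; apply: (measurable_box (A := fun i => [set` `[tnth a i, tnth a i + l[])) => i; exact: measurable_itv. Qed.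

Lemma measurable_cube (a : point) l : measurable (cube a l).
Proof. by rewrite cubeE; apply: (measurable_box (A := fun i => [set` `[tnth a i, tnth a i + l]])) => i; exact: measurable_itv. Qed.

Let prod_cst (l : R) : (\prod_(i < n) l%:E)%E = (l ^+ n)%:E.
Proof. by rewrite prodEFin big_const_ord iter_mulr_1. Qed.

Lemma lebesgue_hcube a l : 0 < l -> mu (hcube a l) = (l ^+ n)%:E.
Proof.
move=> l0; rewrite hcubeE (@lebesgue_tuple_box _ _ (fun i => [set` `[tnth a i, tnth a i + l[])).
  rewrite -prod_cst; apply: eq_bigr => i _.
  by rewrite lebesgue_measure_itv/= lte_fin ltrDl l0 -EFinD addrAC subrr add0r.
by move=> i; exact: measurable_itv.
Qed.

Lemma lebesgue_cube (a : point) l : 0 < l -> mu (cube a l) = (l ^+ n)%:E.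
Proof.
move=> l0; rewrite cubeE (@lebesgue_tuple_box _ _ (fun i => [set` `[tnth a i, tnth a i + l]])).
  rewrite -prod_cst; apply: eq_bigr => i _.
  by rewrite lebesgue_measure_itv/= lte_fin ltrDl l0 -EFinD addrAC subrr add0r.
by move=> i; exact: measurable_itv.
Qed.

Lemma hcube_sub_cube (a : point) l : hcube a l `<=` cube a l.
Proof. by move=> x H i; have /andP[-> /ltW] := H i. Qed.

(** The faces are null, as the closed and the half-open cube have the same finite
    measure. *)
Lemma integral_cube_hcube (a : point) l (f : point -> \bar R) : 0 < l ->
  measurable_fun setT f -> (forall x, 0 <= f x)%E ->
  (\int[mu]_(x in cube a l) f x = \int[mu]_(x in hcube a l) f x)%E.
Proof.
move=> l0 mf f0.
rewrite (ge0_integral_setID mu (measurable_cube a l) (measurable_hcube a l))//.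
rewrite setIidr; last exact: hcube_sub_cube.
have mD : measurable (cube a l `\` hcube a l).
  by apply: measurableD; [exact: measurable_cube|exact: measurable_hcube].
have D0 : mu (cube a l `\` hcube a l) = 0%E.
  rewrite measureD//=; [|exact: measurable_cube|exact: measurable_hcube|]; last first.
    by rewrite [ltLHS]lebesgue_cube// ltry.
  rewrite setIidr; last exact: hcube_sub_cube.
  by rewrite [X in (X - _)%E]lebesgue_cube// [X in (_ - X)%E]lebesgue_hcube// subee.
rewrite [X in (_ + X)%E](_ : _ = 0%E) ?adde0//.
apply: null_set_integral => //.
exact: measurable_funTS.
Qed.

Section dyadic.
Variables (a : point) (l : R).
Hypothesis l0 : 0 < l.

Definition dyadic_side (k : nat) : R := l / 2 ^+ k.

(** The address of a point is the position of its dyadic cube in the lattice of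
    mesh [l / 2^k] with origin [a]. *)
Definition dyadic_addr (k : nat) (x : point) : n.-tuple int :=
  [tuple Num.floor ((tnth x i - tnth a i) / dyadic_side k) | i < n].

Definition dyadic_corner (k : nat) (x : point) : point :=
  [tuple tnth a i + (tnth (dyadic_addr k x) i)%:~R * dyadic_side k | i < n].

Lemma dyadic_sideS k : dyadic_side k = dyadic_side k.+1 * 2.
Proof. by rewrite /dyadic_side exprSr invfM mulrA divfK. Qed.

Lemma dyadic_side_gt0 k : 0 < dyadic_side k.
Proof. by rewrite divr_gt0// exprn_gt0. Qed.

Lemma dyadic_cell k x :
  cell dyadic_addr k x = hcube (dyadic_corner k x) (dyadic_side k).
Proof.
have s0 := dyadic_side_gt0 k.
have E y i : (tnth (dyadic_corner k x) i <= tnth y i <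
    tnth (dyadic_corner k x) i + dyadic_side k) =
  (tnth (dyadic_addr k y) i == tnth (dyadic_addr k x) i).
  rewrite !tnth_mktuple eq_sym -[RHS]/(_ == _) eq_sym floor_eq.
  rewrite ler_pdivlMr// ltr_pdivrMr// lerBrDl ltrBlDl.
  by rewrite intrD mulr1z [(_ + 1) * _]mulrDl mul1r addrA.
apply/seteqP; split => y.
  by move=> yx i; rewrite E yx.
by move=> yx; apply: eq_from_tnth => i; apply/eqP; rewrite -E; exact: yx.
Qed.

Lemma dyadic_cell0 : cell dyadic_addr 0 a = hcube a l.
Proof.
rewrite dyadic_cell; congr hcube; last by rewrite /dyadic_side expr0 divr1.
by apply: eq_from_tnth => i; rewrite !tnth_mktuple subrr mul0r floor0 mul0r addr0.
Qed.

Lemma measurable_dyadic_cell k x : measurable (cell dyadic_addr k x).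
Proof. by rewrite dyadic_cell; exact: measurable_hcube. Qed.

Let floor_half (u v : R) :
  Num.floor u = Num.floor v -> Num.floor (u / 2) = Num.floor (v / 2).
Proof.
suff H (s t : R) : Num.floor s = Num.floor t -> Num.floor (s / 2) <= Num.floor (t / 2).
  by move=> uv; apply/eqP; rewrite eq_le !H.
move=> st; rewrite floor_ge_int ler_pdivlMr// -[2]/(2%:~R) -intrM.
by rewrite -floor_ge_int -st floor_ge_int intrM -ler_pdivlMr// floor_le.
Qed.

Lemma dyadic_nested k x y :
  dyadic_addr k.+1 y = dyadic_addr k.+1 x -> dyadic_addr k y = dyadic_addr k x.
Proof.
move=> yx; apply: eq_from_tnth => i.
have := congr1 (fun t => tnth t i) yx; rewrite !tnth_mktuple => /floor_half.
have E (t : R) : t / dyadic_side k.+1 / 2 = t / dyadic_side k.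
  by rewrite (dyadic_sideS k) (invfM (dyadic_side k.+1)) mulrA.
by rewrite !E.
Qed.

Lemma dyadic_doubling k x : (mu (cell dyadic_addr k x) <=
  (2 ^+ n : R)%:E * mu (cell dyadic_addr k.+1 x))%E.
Proof.
have s0 := dyadic_side_gt0.
rewrite !dyadic_cell !lebesgue_hcube// -EFinM -exprMn lee_fin.
by rewrite mulrC -dyadic_sideS.
Qed.

(** Each coordinate is the limit of the corresponding coordinate of the dyadic
    corners, which is constant on cells. *)
Lemma dyadic_generated : (@measurable _ point) `<=`
  <<s [set A | exists k, saturated dyadic_addr k A] >>.
Proof.
set S := [set A | _].
apply: smallest_sub; first exact: smallest_sigma_algebra.
apply: (big_ind (fun G => G `<=` <<s S >>)) => [//|G H GS HS A [/GS|/HS]//|i _ A [B mB <-]].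
pose f (k : nat) (x : g_sigma_algebraType S) : R := tnth (dyadic_corner k x) i.
have mf k : measurable_fun setT (f k).
  move=> _ Y mY; apply: sub_sigma_algebra; exists k => x y xy.
  by rewrite /f /dyadic_corner /preimage /= xy.
suff : measurable_fun [set: g_sigma_algebraType S] (fun x => tnth x i : R).
  by move=> /(_ measurableT B mB).
apply: (measurable_fun_cvg mf) => x _.
apply/cvgrPdist_le => e e0.
have : l * (2^-1) ^+ k @[k --> \oo] --> l * 0.
  by apply: cvgMl_tmp; apply: cvg_expr; rewrite ger0_norm// invf_lt1// ltr1n.
rewrite mulr0 => /cvgrPdist_le/(_ e e0); apply: filterS => k.
rewrite sub0r normrN => le_e; apply: le_trans le_e.
have s0 := dyadic_side_gt0 k; have se : l * 2^-1 ^+ k = dyadic_side k.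
  by rewrite /dyadic_side exprVn.
rewrite se (gtr0_norm s0) /f !tnth_mktuple.
set u := (tnth x i - tnth a i) / dyadic_side k.
have -> : tnth x i = tnth a i + u * dyadic_side k.
  by rewrite /u divfK ?gt_eqF// addrC subrK.
rewrite opprD addrACA subrr add0r -mulrBl normrM (gtr0_norm s0).
rewrite ler_piMl ?ltW//; have /andP[f1 f2] := floor_itv u.
by rewrite ger0_norm ?subr_ge0// ltrBlDl; move: f2; rewrite intrD mulr1z.
Qed.

End dyadic.
End cubes.

(** * A weighted John-Nirenberg inequality *)

Lemma dyadic_stopping {R : realType} {n : nat} (a : 'R[R]^n) (l : R)
    (h : 'R[R]^n -> R) (lam : R) : 0 < l -> measurable_fun setT h ->
    (forall x, 0 <= h x) -> 0 < lam ->
    let mu := @lebesgue_tuple R n in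
    (\int[mu]_(x in hcube a l) (h x)%:E <= lam%:E * mu (hcube a l))%E ->
  exists F : nat -> set 'R[R]^n, [/\ forall k, saturated (dyadic_addr a l) k (F k),
    trivIset setT F, \bigcup_k F k `<=` hcube a l,
    (lam%:E * mu (\bigcup_k F k) <= \int[mu]_(x in hcube a l) (h x)%:E)%E &
    (forall k x, F k x -> let C := cell (dyadic_addr a l) k x in
      \int[mu]_(y in C) (h y)%:E <= (lam * 2 ^+ n)%:E * mu C)%E /\
    mu ((hcube a l `\` \bigcup_k F k) `&` [set x | lam < h x]) = 0%E].
Proof.
move=> l0 mh h0 lam0 mu hle; rewrite -(dyadic_cell0 a l0) in hle *.
apply: (@stopping_cells _ _ _ mu _ (dyadic_addr a l) (measurable_dyadic_cell a l0)
  (@dyadic_nested R n a l) (@dyadic_generated R n a l l0) a h lam) => //.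
- by rewrite dyadic_cell0// [ltLHS](lebesgue_hcube a l0) ltry.
- exact: dyadic_doubling.
Qed.

Section weighted_john_nirenberg.
Context {R : realType} {n : nat}.
Local Notation point := ('R[R]^n).
Local Notation mu := (@lebesgue_tuple R n).

(** Bounded mean oscillation with free centers [c], a form that is inherited by
    Lipschitz images of [g]: the image of a center serves as a center. *)
Definition oscillates (g : point -> R) (c : point -> R -> R) (delta : R) : Prop :=
  forall a l, 0 < l ->
    (\int[mu]_(x in cube a l) `|g x - c a l|%:E <= delta%:E * mu (cube a l))%E.

(** The [A_infinity] property in use: for [theta < 1], a set of at most half the
    measure of a cube does not carry all the mass that [W] puts on the cube. *)
Definition halving (W : point -> R) (theta : R) : Prop :=
  forall (a : point) l E, 0 < l -> measurable E -> E `<=` cube a l ->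
    (mu E <= 2^-1%:E * mu (cube a l))%E ->
    (\int[mu]_(x in E) (W x)%:E <= theta%:E * \int[mu]_(x in cube a l) (W x)%:E)%E.

Variables (g : point -> R) (c : point -> R -> R) (delta : R).
Variables (W : point -> R) (theta : R).
Hypothesis mg : measurable_fun setT g.
Hypothesis delta0 : 0 < delta.
Hypothesis osc : oscillates g c delta.
Hypothesis mW : measurable_fun setT W.
Hypothesis W0 : forall x, 0 <= W x.
Hypothesis theta0 : 0 <= theta.
Hypothesis halvingW : halving W theta.
Hypothesis Wfin : forall (a : point) (l : R), 0 < l ->
  (\int[mu]_(x in cube a l) (W x)%:E < +oo)%E.

Let D : R := 2 ^+ n.
(** [(1 + 2 * D) * delta] bounds the distance between the center of a cube and the
    center of a stopping subcube, [2 * delta] being the stopping height. *)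
Let kappa : R := expR ((1 + 2 * D) * delta).

Let mdev (r : R) : measurable_fun setT (fun x => `|g x - r|).
Proof. by apply: measurableT_comp => //; exact: measurable_funB. Qed.

Let mtrunc (r N : R) : measurable_fun setT (fun x => expR (Num.min `|g x - r| N) * W x).
Proof.
apply: measurable_funM => //; apply: measurableT_comp => //.
rewrite (_ : (fun x => _) = (fun x => `|g x - r|) \min cst N)//.
exact: measurable_minr.
Qed.

Let EFinm (f : point -> R) : measurable_fun setT f ->
  measurable_fun setT (fun x => (f x)%:E).
Proof. by move=> mf; exact/measurable_EFinP. Qed.

Let WE := EFinm mW.

Let osc_hcube a l : 0 < l ->
  (\int[mu]_(x in hcube a l) `|g x - c a l|%:E <= delta%:E * mu (hcube a l))%E.
Proof.
move=> l0; rewrite -integral_cube_hcube//; last first.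
  by apply: EFinm; exact: mdev.
by apply: (le_trans (osc a l0)); rewrite lebesgue_cube// lebesgue_hcube.
Qed.

Let center_close a (l r K : R) : 0 < l ->
  (\int[mu]_(x in hcube a l) `|g x - r|%:E <= K%:E * mu (hcube a l))%E ->
  `|r - c a l| <= delta + K.
Proof.
move=> l0 hK.
have mH := @measurable_hcube R n a l.
have : (`|r - c a l|%:E * mu (hcube a l) <= (delta + K)%:E * mu (hcube a l))%E.
  rewrite -integral_cst//.
  apply: (@le_trans _ _ (\int[mu]_(x in hcube a l)
      (`|g x - c a l|%:E + `|g x - r|%:E))%E).
    apply: ge0_le_integral => //.
    - by move=> x _; rewrite lee_fin.
    - apply: measurable_funTS; apply: emeasurable_funD; apply: EFinm; exact: mdev.
    - move=> x _; rewrite -EFinD lee_fin.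
      rewrite -[r - _](subrKA (g x)) (addrC `|_|) -[`|g x - r|]normrN opprB.
      exact: ler_normD.
  rewrite ge0_integralD//; last 2 first.
  - by apply: measurable_funTS; apply: EFinm; exact: mdev.
  - by apply: measurable_funTS; apply: EFinm; exact: mdev.
  rewrite EFinD muleDl ?lebesgue_hcube//; last first.
  by apply: leeD; rewrite -(lebesgue_hcube a)//; exact: osc_hcube.
by rewrite lebesgue_hcube// -!EFinM lee_fin ler_pM2r// exprn_gt0.
Qed.

(** Truncating the oscillation at [N] makes the constant finite from the start
    ([trunc_bound_init]), so that [trunc_bound_step] can be iterated. *)
Let trunc_bound (N M : R) := forall a l, 0 < l ->
  (\int[mu]_(x in hcube a l) (expR (Num.min `|g x - c a l| N) * W x)%:E <=
   M%:E * \int[mu]_(x in hcube a l) (W x)%:E)%E.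

Let trunc_bound_init N : trunc_bound N (expR N).
Proof.
move=> a l l0; rewrite -ge0_integralZl//.
- apply: ge0_le_integral => //.
  + exact: measurable_hcube.
  + by move=> x _; rewrite lee_fin mulr_ge0// expR_ge0.
  + by apply: measurable_funTS; exact: EFinm.
  + by apply: measurable_funTS; apply: EFinm; exact: measurable_funM.
  + by move=> x _; rewrite -EFinM lee_fin ler_wpM2r// ler_expR ge_min lexx orbT.
- exact: measurable_hcube.
- exact: measurable_funTS.
- by move=> x _; rewrite lee_fin.
Qed.

(** Off the stopping cubes the oscillation is at most [2 * delta].  On a stopping
    cube the center moves by a bounded amount and the inductive bound applies; the
    stopping cubes fill at most half of the cube, hence carry at most the
    fraction [theta] of the mass of [W]. *)
Let trunc_bound_step N M : 0 <= M -> trunc_bound N M ->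
  trunc_bound N (expR (2 * delta) + kappa * theta * M).
Proof.
move=> M0 XM a l l0.
set r := c a l; pose h x := `|g x - r|; pose lam := 2 * delta.
have lam0 : 0 < lam by rewrite mulr_gt0.
have mQ := @measurable_hcube R n a l.
pose u x := expR (Num.min (h x) N) * W x.
have u0 x : 0 <= u x by rewrite mulr_ge0// expR_ge0.
have mu_ : measurable_fun setT (fun x => (u x)%:E) by apply: EFinm; exact: mtrunc.
have hQ : (\int[mu]_(x in hcube a l) (h x)%:E <= delta%:E * mu (hcube a l))%E.
  exact: osc_hcube.
have hQ2 : (\int[mu]_(x in hcube a l) (h x)%:E <= lam%:E * mu (hcube a l))%E.
  by apply: (le_trans hQ); rewrite lee_wpmul2r// lee_fin /lam ler_peMl ?ler1n ?ltW.
have [F [sF tF UQ lamU [FD nullE]]] :=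
  dyadic_stopping l0 (mdev r) (fun x => normr_ge0 _) lam0 hQ2.
set U := \bigcup_k F k in UQ lamU nullE *.
have mF k : measurable (F k).
  exact: (@saturated_measurable _ _ _ (dyadic_addr a l) (measurable_dyadic_cell a l0) k _ (sF k)).
have mU : measurable U by exact: bigcup_measurable.
have WU : (\int[mu]_(x in U) (W x)%:E <= theta%:E * \int[mu]_(x in hcube a l) (W x)%:E)%E.
  rewrite -integral_cube_hcube//.
  apply: halvingW => //; first by apply: subset_trans UQ _; exact: hcube_sub_cube.
  rewrite lebesgue_cube// -(lebesgue_hcube a)//.
  rewrite -(@lee_pmul2l _ lam%:E)// ?lte_fin//.
  apply: (le_trans lamU); apply: (le_trans hQ).
  by rewrite muleA -EFinM /lam mulrAC divff// mul1r.
have uU : (\int[mu]_(x in U) (u x)%:E <=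
    (kappa * M)%:E * \int[mu]_(x in U) (W x)%:E)%E.
  have kM0 : 0 <= kappa * M by rewrite mulr_ge0// expR_ge0.
  rewrite -ge0_integralZl//; last 2 first.
  - exact: measurable_funTS.
  - by move=> x _; rewrite lee_fin.
  rewrite !ge0_integral_bigcup//; last 4 first.
  - by apply: measurable_funTS; apply: emeasurable_funM => //; exact: EFinm.
  - by move=> x _; rewrite -EFinM lee_fin mulr_ge0.
  - exact: measurable_funTS.
  - by move=> x _; rewrite lee_fin.
  apply: lee_nneseries => [k _ _|k _].
    by apply: integral_ge0 => x _; rewrite lee_fin.
  apply: (cellwise_le_integral (measurable_dyadic_cell a l0) (sF k)) => //.
  - by apply: emeasurable_funM => //; exact: EFinm.
  - by move=> x; rewrite -EFinM lee_fin mulr_ge0.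
  move=> x Fx; have := FD k x Fx; rewrite dyadic_cell//.
  set a' := dyadic_corner _ _ _ _; set l' := dyadic_side _ _ => hD.
  have l'0 : 0 < l' by exact: dyadic_side_gt0.
  have mC := @measurable_hcube R n a' l'.
  have close := center_close l'0 hD.
  rewrite ge0_integralZl//; last 2 first.
  - exact: measurable_funTS.
  - by move=> y _; rewrite lee_fin.
  rewrite EFinM -muleA.
  apply: (@le_trans _ _ (kappa%:E * \int[mu]_(x in hcube a' l')
      (expR (Num.min `|g x - c a' l'| N) * W x)%:E)%E); last first.
    by rewrite lee_pmul2l ?lte_fin ?expR_gt0//; exact: XM.
  rewrite -ge0_integralZl//; last 3 first.
  - by apply: measurable_funTS; exact: EFinm.
  - by move=> y _; rewrite lee_fin mulr_ge0// expR_ge0.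
  - by rewrite lee_fin expR_ge0.
  apply: ge0_le_integral => //.
  - by move=> y _; rewrite lee_fin.
  - exact: measurable_funTS.
  - by apply: measurable_funTS; apply: emeasurable_funM => //; exact: EFinm.
  - move=> y _; rewrite -EFinM lee_fin /u mulrA ler_wpM2r// -expRD ler_expR /h.
    have tri : `|g y - r| <= `|g y - c a' l'| + `|r - c a' l'|.
      rewrite (distrC r) -[g y - r](subrKA (c a' l')).
      exact: ler_normD.
    have K : `|r - c a' l'| <= (1 + 2 * D) * delta.
      apply: (le_trans close); rewrite le_eqVlt; apply/orP; left; apply/eqP.
      by rewrite /lam /D; ring.
    have d0 : 0 <= (1 + 2 * D) * delta.
      by rewrite mulr_ge0// ?ltW// ltr_wpDr// mulr_ge0// exprn_ge0.
    by case: (lerP `|g y - c a' l'| N) => ?; rewrite ge_min; apply/orP;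
      [left|right]; lra.
have uQU : (\int[mu]_(x in hcube a l `\` U) (u x)%:E <=
    (expR lam)%:E * \int[mu]_(x in hcube a l) (W x)%:E)%E.
  have mB : measurable [set x | lam < h x].
    have := mdev r measurableT (measurable_itv `]lam, +oo[).
    rewrite setTI; congr measurable; apply/funext => x.
    by rewrite /preimage /= in_itv /= andbT.
  have mQU : measurable (hcube a l `\` U) by exact: measurableD.
  rewrite (ge0_integral_setID mu mQU mB mu_); last by move=> x; rewrite lee_fin.
  rewrite [X in (X + _)%E](_ : _ = 0%E) ?add0e; last first.
    apply: null_set_integral; [exact: measurableI|exact: measurable_funTS|exact: nullE].
  rewrite -ge0_integralZl//; last 2 first.
  - exact: measurable_funTS.
  - by move=> y _; rewrite lee_fin.
  apply: (@le_trans _ _ (\int[mu]_(x in (hcube a l `\` U) `\` [set x | (lam < h x)%R])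
      ((expR lam)%:E * (W x)%:E))%E).
    apply: ge0_le_integral => //.
    - exact: measurableD.
    - by move=> y _; rewrite lee_fin.
    - exact: measurable_funTS.
    - by apply: measurable_funTS; apply: emeasurable_funM => //; exact: EFinm.
    - move=> y [_ /negP]; rewrite -leNgt => hy.
      by rewrite -EFinM lee_fin /u ler_wpM2r// ler_expR ge_min hy.
  apply: ge0_subset_integral => //.
  - exact: measurableD.
  - by apply: measurable_funTS; apply: emeasurable_funM => //; exact: EFinm.
  - by move=> y _; rewrite -EFinM lee_fin mulr_ge0// expR_ge0.
  - by move=> y [[]].
rewrite (ge0_integral_setID mu mQ mU mu_); last by move=> x; rewrite lee_fin.
rewrite setIidr// EFinD muleDl//; last first.
  rewrite -integral_cube_hcube//.
  rewrite ge0_fin_numE; last by apply: integral_ge0 => x _; rewrite lee_fin.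
  exact: Wfin.
rewrite addeC; apply: leeD; first exact: uQU.
apply: (le_trans uU).
by rewrite mulrAC (EFinM (kappa * M)) -muleA lee_wpmul2l// lee_fin mulr_ge0// expR_ge0.
Qed.

Let trunc_bound_iter N (j : nat) : kappa * theta < 1 ->
  trunc_bound N (expR (2 * delta) / (1 - kappa * theta) +
                 (kappa * theta) ^+ j * expR N).
Proof.
move=> b1; have k0 : 0 <= kappa * theta by rewrite mulr_ge0// expR_ge0.
have d0 : 0 < 1 - kappa * theta by rewrite subr_gt0.
have A0 : 0 <= expR (2 * delta) / (1 - kappa * theta).
  by rewrite divr_ge0 ?expR_ge0// ltW.
elim: j => [|j IH].
  move=> a l l0; apply: (le_trans (@trunc_bound_init N a l l0)).
  rewrite expr0 mul1r lee_wpmul2r//; last by rewrite lee_fin ler_wpDl.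
  by apply: integral_ge0 => x _; rewrite lee_fin.
have /trunc_bound_step/(_ IH) : 0 <= expR (2 * delta) / (1 - kappa * theta) +
    (kappa * theta) ^+ j * expR N.
  by rewrite addr_ge0// mulr_ge0 ?expR_ge0// exprn_ge0.
congr trunc_bound; rewrite exprS; field.
by rewrite gt_eqF.
Qed.

(** The fixed point [e^(2 delta) / (1 - kappa theta)] of the recursion
    [M -> e^(2 delta) + kappa theta M], followed by monotone convergence as the
    truncation level grows. *)
Lemma weighted_john_nirenberg (a : point) (l : R) : 0 < l ->
  expR ((1 + 2 * 2 ^+ n) * delta) * theta < 1 ->
  (\int[mu]_(x in cube a l) (expR `|g x - c a l| * W x)%:E <=
   (expR (2 * delta) / (1 - expR ((1 + 2 * 2 ^+ n) * delta) * theta))%:E *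
   \int[mu]_(x in cube a l) (W x)%:E)%E.
Proof.
move=> l0 b1.
have k0 : 0 <= kappa * theta by rewrite mulr_ge0// expR_ge0.
have d0 : 0 < 1 - kappa * theta by rewrite subr_gt0.
have A0 : 0 <= expR (2 * delta) / (1 - kappa * theta).
  by rewrite divr_ge0 ?expR_ge0// ltW.
have mfull : measurable_fun setT (fun x => expR `|g x - c a l| * W x).
  by apply: measurable_funM => //; apply: measurableT_comp => //; exact: mdev.
rewrite !integral_cube_hcube//; last 2 first.
- exact: EFinm.
- by move=> x; rewrite lee_fin mulr_ge0// expR_ge0.
have mQ := @measurable_hcube R n a l.
have trunc (N : R) : (\int[mu]_(x in hcube a l) (expR (Num.min `|g x - c a l| N) * W x)%:E <=
   (expR (2 * delta) / (1 - kappa * theta))%:E * \int[mu]_(x in hcube a l) (W x)%:E)%E.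
  have Wf : (\int[mu]_(x in hcube a l) (W x)%:E \is a fin_num)%E.
    rewrite -integral_cube_hcube// ge0_fin_numE; first exact: Wfin.
    by apply: integral_ge0 => x _; rewrite lee_fin.
  apply/lee_addgt0Pr => e e0.
  set w := fine (\int[mu]_(x in hcube a l) (W x)%:E).
  have w0 : 0 <= w by apply: fine_ge0; apply: integral_ge0 => x _; rewrite lee_fin.
  have : (kappa * theta) ^+ j * (expR N * w) @[j --> \oo] --> 0 * (expR N * w).
    by apply: cvgMr_tmp; apply: cvg_expr; rewrite ger0_norm.
  rewrite mul0r => /cvgrPdist_le/(_ e e0)[j _ /(_ j (leqnn j))/=].
  rewrite sub0r normrN ger0_norm; last by rewrite !mulr_ge0// ?exprn_ge0// expR_ge0.
  move=> je; apply: (le_trans (@trunc_bound_iter N j b1 a l l0)).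
  rewrite -(fineK Wf) -/w -!EFinM -EFinD lee_fin mulrDl lerD2l.
  by rewrite -mulrA.
pose f (N : nat) x := (expR (Num.min `|g x - c a l| N%:R) * W x)%:E.
have -> : (\int[mu]_(x in hcube a l) (expR `|g x - c a l| * W x)%:E =
    \int[mu]_(x in hcube a l) limn (f ^~ x))%E.
  apply: eq_integral => x _; apply/esym/lim_near_cst => //.
  have [N _ HN] := nbhs_infty_ger `|g x - c a l|.
  exists N => // j Nj; rewrite /f min_l//; exact: HN.
rewrite monotone_convergence//; first last.
- move=> x _ i j ij; rewrite lee_fin ler_wpM2r// ler_expR le_min !ge_min lexx/=.
  by rewrite ler_nat ij orbT.
- by move=> N x _; rewrite lee_fin mulr_ge0// expR_ge0.
- by move=> N; apply: measurable_funTS; exact: EFinm.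
apply: lime_le.
- apply: ereal_nondecreasing_is_cvgn => i j ij; apply: ge0_le_integral => //.
  + by move=> x _; rewrite lee_fin mulr_ge0// expR_ge0.
  + by apply: measurable_funTS; exact: EFinm.
  + by apply: measurable_funTS; exact: EFinm.
  + move=> x _; rewrite lee_fin ler_wpM2r// ler_expR le_min !ge_min lexx/=.
    by rewrite ler_nat ij orbT.
- by apply: nearW => N; exact: trunc.
Qed.

End weighted_john_nirenberg.

(** * Families with bounded mixed averages *)

(** The exponential lies above its tangent at the weighted mean of the [ln (x i)]. *)
Lemma weighted_am_gm {R : realType} (I : finType) (tau x : I -> R) :
  (forall i, 0 <= tau i) -> \sum_i tau i = 1 -> (forall i, 0 < x i) ->
  \prod_i x i `^ tau i <= \sum_i tau i * x i.
Proof.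
move=> tau0 tau1 x0.
pose y := \sum_i tau i * ln (x i).
have -> : \prod_i x i `^ tau i = expR y.
  by rewrite expR_sum; apply: eq_bigr => i _; rewrite /powR gt_eqF.
have -> : expR y = \sum_i tau i * (expR y * (1 + (ln (x i) - y))).
  under eq_bigr do rewrite mulrCA.
  rewrite -mulr_sumr; under eq_bigr do rewrite mulrDr mulr1 mulrBr.
  by rewrite big_split sumrB/= -mulr_suml tau1 mul1r subrr addr0 mulr1.
apply: ler_sum => i _; rewrite ler_wpM2l//.
apply: (@le_trans _ _ (expR y * expR (ln (x i) - y))).
  by rewrite ler_pM2l ?expR_gt0// expR_ge1Dx.
by rewrite -expRD addrC subrK lnK ?posrE.
Qed.

Lemma powR_prod {R : realType} (I : finType) (x : I -> R) (t : R) :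
  (forall i, 0 <= x i) -> (\prod_i x i) `^ t = \prod_i x i `^ t.
Proof.
move=> x0; have H (r : seq I) :
    0 <= \prod_(i <- r) x i /\ (\prod_(i <- r) x i) `^ t = \prod_(i <- r) x i `^ t.
  elim: r => [|i r [IH0 IH]]; first by rewrite !big_nil powR1.
  by rewrite !big_cons powRM// IH mulr_ge0.
by have [] := H (index_enum I).
Qed.

Lemma integral_gt0 d (T : measurableType d) (R : realType)
    (mu : {measure set T -> \bar R}) (E : set T) (f : T -> R) :
  measurable E -> measurable_fun setT f -> (forall x, 0 < f x) ->
  (0 < mu E)%E -> (0 < \int[mu]_(x in E) (f x)%:E)%E.
Proof.
move=> mE mf f0 muE; rewrite lt0e; apply/andP; split; last first.
  by apply: integral_ge0 => x _; rewrite lee_fin ltW.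
apply/eqP => int0.
have mfE : measurable_fun E (fun x => (f x)%:E).
  by apply: measurable_funTS; exact/measurable_EFinP.
have intabs0 : (\int[mu]_(x in E) `|(f x)%:E| = 0)%E.
  rewrite -[RHS]int0; apply: eq_integral => x _.
  by rewrite gee0_abs// lee_fin ltW.
have ae0 := (ae_eq_integral_abs mu mE mfE).1 intabs0.
have : mu.-negligible E.
  apply: negligibleS ae0 => x Ex /= /(_ Ex)[] fx.
  by have := f0 x; rewrite fx ltxx.
by move=> /(negligibleP mu mE) muE0; rewrite muE0 ltxx in muE.
Qed.

Lemma prode_gt0 {R : realType} (I : finType) (P : pred I) (x : I -> \bar R) :
  (forall i, 0 < x i)%E -> (0 < \prod_(i | P i) x i)%E.
Proof. by move=> x0; elim/big_ind: _ => // a b; exact: mule_gt0. Qed.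

Lemma prode_lty {R : realType} (I : finType) (x : I -> \bar R) :
  (forall i, 0 < x i)%E -> (\prod_i x i < +oo)%E -> forall i, (x i < +oo)%E.
Proof.
move=> x0 + i; rewrite (bigD1 i)//= ltey => /eqP H.
rewrite ltey; apply/eqP => xi; apply: H; rewrite xi gt0_mulye//.
exact: prode_gt0.
Qed.

Lemma lee_prod {R : realType} (I : finType) (x y : I -> \bar R) :
  (forall i, 0 <= x i <= y i)%E -> (\prod_i x i <= \prod_i y i)%E.
Proof.
move=> xy; apply: (@proj2 (0 <= \prod_i x i)%E).
apply: (big_ind2 (fun a b => 0 <= a /\ a <= b)%E).
- by rewrite lexx lee01.
- move=> a b c d [a0 ab] [c0 cd]; split; first exact: mule_ge0.
  exact: lee_pmul.
- by move=> i _; have /andP[] := xy i.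
Qed.

Section mixed_averages.
Context {R : realType} {n : nat} (I : finType).
Local Notation point := ('R[R]^n).
Local Notation mu := (@lebesgue_tuple R n).
Implicit Types (e : I -> R) (W : I -> point -> R).

(** The quantity whose supremum over cubes is the [A_p] characteristic, for a family
    that lists the weight [nu_w] together with the dual weights. *)
Definition Aprod e W (Q : set point) : \bar R :=
  (\prod_i avg Q (W i) `^ (e i)^-1)%E.

Lemma avg_cubeE (a : point) (l : R) (f : point -> R) : 0 < l ->
  avg (cube a l) f = ((l ^+ n)^-1%:E * \int[mu]_(x in cube a l) (f x)%:E)%E.
Proof.
by move=> l0; rewrite /avg lebesgue_cube// inver gt_eqF// exprn_gt0.
Qed.

(** All factors of the finite product are positive, so each of them is finite. *)
Lemma Aprod_integral_lty e W (a : point) (l : R) : 0 < l ->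
  (forall i, 0 < e i) ->
  (forall i, measurable_fun setT (W i)) -> (forall i x, 0 < W i x) ->
  (Aprod e W (cube a l) < +oo)%E ->
  forall i, (\int[mu]_(x in cube a l) (W i x)%:E < +oo)%E.
Proof.
move=> l0 e0 mW W0 Afin i.
have avg0 j : (0 < avg (cube a l) (W j))%E.
  rewrite avg_cubeE// mule_gt0// ?lte_fin ?invr_gt0 ?exprn_gt0//.
  apply: integral_gt0 => //; first exact: measurable_cube.
  by rewrite [ltRHS](lebesgue_cube a l0) lte_fin exprn_gt0.
have /(_ i) := prode_lty (fun j => poweR_gt0 _ (avg0 j)) Afin.
move=> /lty_poweRy; rewrite invr_neq0 ?gt_eqF// => /(_ isT).
rewrite avg_cubeE// => H; rewrite ltey; apply/eqP => Ioo; move: H.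
by rewrite Ioo gt0_muley ?ltxx// lte_fin invr_gt0 exprn_gt0.
Qed.

(** Let [F] be the complement of [E] in the cube [Q], of measure at least half of
    that of [Q].  Integrating over [F] the inequality of arithmetic and geometric
    means for the [W i / S i] bounds [mu F / mu Q] by [prod_i S i ^ tau i], which
    contains a positive power of the mass of [W i0] on [F]. *)
Lemma Aprod_halving e W (A s q : R) :
  (forall i, 1 <= e i <= q) -> 0 < s -> \sum_i (e i)^-1 = s ->
  (forall i, measurable_fun setT (W i)) -> (forall i x, 0 < W i x) ->
  (forall x, \prod_i W i x `^ (e i)^-1 = 1) -> 1 <= A ->
  (forall Q, cubes Q -> (Aprod e W Q <= A%:E)%E) ->
  forall i, halving (W i) (1 - (2^-1 `^ s / A) `^ q).
Proof.
move=> eq s0 es mW W0 W1 A1 ApA i0 a l E l0 mE EQ Ehalf.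
have e0 i : 0 < e i by have /andP[+ _] := eq i; exact: lt_le_trans.
set v := l ^+ n; have v0 : 0 < v by rewrite exprn_gt0.
have mQ := @measurable_cube R n a l.
have ApQ : (Aprod e W (cube a l) <= A%:E)%E by apply: ApA; exists a, l.
have Wlty := Aprod_integral_lty l0 e0 mW W0 (le_lt_trans ApQ (ltry A)).
pose y i := fine (\int[mu]_(x in cube a l) (W i x)%:E).
have int0 i G : measurable G -> (0 <= \int[mu]_(x in G) (W i x)%:E)%E.
  by move=> _; apply: integral_ge0 => x _; rewrite lee_fin ltW.
have yE i : (\int[mu]_(x in cube a l) (W i x)%:E = (y i)%:E)%E.
  by rewrite /y fineK// ge0_fin_numE// int0.
have y0 i : 0 < y i.
  rewrite -lte_fin -yE; apply: integral_gt0 => //.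
  by rewrite [ltRHS](lebesgue_cube a l0) lte_fin.
set F := cube a l `\` E; have mF : measurable F by exact: measurableD.
have mWE i : measurable_fun setT (fun x => (W i x)%:E) by exact/measurable_EFinP.
have WF i : (\int[mu]_(x in F) (W i x)%:E <= (y i)%:E)%E.
  rewrite -yE; apply: ge0_subset_integral => //.
  - exact: measurable_funTS.
  - by move=> x _; rewrite lee_fin ltW.
  - by move=> x [].
have muF : ((v / 2)%:E <= mu F)%E.
  have muEfin : (mu E \is a fin_num)%E.
    rewrite ge0_fin_numE//; apply: (le_lt_trans Ehalf).
    by rewrite lebesgue_cube// -EFinM ltry.
  have -> : mu F = (v%:E - mu E)%E.
    rewrite /F measureD//=; last by rewrite [ltLHS](lebesgue_cube a l0) ltry.
    by rewrite setIidr// [X in (X - _)%E](lebesgue_cube a l0).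
  move: Ehalf; rewrite (lebesgue_cube a l0) -/v -(fineK muEfin) -EFinB -EFinM !lee_fin.
  by lra.
pose z := fine (\int[mu]_(x in F) (W i0 x)%:E).
have zE : (\int[mu]_(x in F) (W i0 x)%:E = z%:E)%E.
  by rewrite /z fineK// ge0_fin_numE ?int0// (le_lt_trans (WF i0))// ltry.
have z0 : 0 < z.
  rewrite -lte_fin -zE; apply: integral_gt0 => //.
  by apply: lt_le_trans muF; rewrite lte_fin divr_gt0.
(* These normalizations make each term of the arithmetic mean at most [tau i * v]. *)
pose S i := (if i == i0 then z else y i) / v.
have S0 i : 0 < S i by rewrite divr_gt0//; case: ifP.
have WFS i : (\int[mu]_(x in F) (W i x)%:E <= (v * S i)%:E)%E.
  rewrite /S mulrC divfK ?gt_eqF//; case: eqP => [->|_]; last exact: WF.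
  by rewrite zE.
(* The exponents [1 / e i] add up to [s] and are rescaled to weights of total 1. *)
pose tau i := (s * e i)^-1.
have tau0 i : 0 <= tau i by rewrite invr_ge0 mulr_ge0// ltW.
have tau1 : \sum_i tau i = 1.
  by under eq_bigr do rewrite /tau invfM; rewrite -mulr_sumr es mulVf// gt_eqF.
pose P := \prod_i S i `^ tau i.
have P0 : 0 <= P by apply: prodr_ge0 => i _; exact: powR_ge0.
have pt x : 1 <= \sum_i (P * tau i / S i) * W i x.
  have : 1 = P * \prod_i (W i x / S i) `^ tau i.
    have W1s : (\prod_i W i x `^ (e i)^-1) `^ s^-1 = 1 by rewrite W1 powR1.
    rewrite /P -big_split/= -[LHS]W1s.
    rewrite powR_prod//; last by move=> i; exact: powR_ge0.
    apply: eq_bigr => i _.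
    have WS0 : 0 <= W i x / S i by rewrite divr_ge0// ltW.
    rewrite -powRM//; last exact: ltW.
    by rewrite mulrC divfK ?gt_eqF// -powRrM /tau invfM mulrC.
  move=> {1}->.
  have -> : \sum_i P * tau i / S i * W i x = P * \sum_i tau i * (W i x / S i).
    by rewrite mulr_sumr; apply: eq_bigr => i _; rewrite -!mulrA (mulrC (S i)^-1).
  rewrite ler_wpM2l//.
  by apply: weighted_am_gm => // i; rewrite divr_gt0.
have PF : v / 2 <= P * v.
  rewrite -lee_fin; apply: (le_trans muF).
  rewrite -[leLHS]mul1e -integral_cst//.
  apply: (@le_trans _ _ (\int[mu]_(x in F) (\sum_i (P * tau i / S i)%:E * (W i x)%:E))%E).
    apply: ge0_le_integral => //.
    - apply: measurable_funTS; apply: emeasurable_sum => i.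
      by apply: emeasurable_funM.
    - move=> x _; under eq_bigr do rewrite -EFinM.
      by rewrite sumEFin lee_fin; exact: pt.
  have c0 i : 0 <= P * tau i / S i.
    by apply: divr_ge0; [exact: mulr_ge0|exact: ltW].
  rewrite ge0_integral_sum//; last 2 first.
  - by move=> i; apply: measurable_funTS; apply: emeasurable_funM.
  - by move=> i x _; rewrite -EFinM lee_fin mulr_ge0// ltW.
  apply: (@le_trans _ _ (\sum_i (P * tau i / S i)%:E * (v * S i)%:E)%E).
    apply: lee_sum => i _; rewrite ge0_integralZl//.
    - by rewrite lee_wpmul2l// lee_fin.
    - exact: measurable_funTS.
    - by move=> x _; rewrite lee_fin ltW.
    - by rewrite lee_fin.
  under eq_bigr do rewrite -EFinM.
  rewrite sumEFin lee_fin.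
  rewrite (_ : \sum_i _ = \sum_i (P * v) * tau i); last first.
    by apply: eq_bigr => i _; field; rewrite gt_eqF.
  by rewrite -mulr_sumr tau1 mulr1.
have Phalf : 2^-1 <= P by rewrite -(ler_pM2r v0) mulrC.
have prodA : \prod_i (y i / v) `^ (e i)^-1 <= A.
  rewrite -lee_fin; apply: le_trans ApQ; rewrite /Aprod -prodEFin.
  rewrite le_eqVlt; apply/orP; left; apply/eqP/eq_bigr => i _.
  by rewrite avg_cubeE// yE -EFinM poweR_EFin mulrC.
set eta := 2^-1 `^ s / A.
have A0 : 0 < A by exact: lt_le_trans A1.
have eta0 : 0 < eta by rewrite divr_gt0// powR_gt0.
have eta1 : eta <= 1.
  rewrite ler_pdivrMr// mul1r; apply: le_trans A1.
  apply: (@le_trans _ _ (1 `^ s)); last by rewrite powR1.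
  by apply: (ge0_ler_powR (ltW s0)); rewrite ?nnegrE ?invr_ge0// invf_le1// ler1n.
have ratio : eta <= (z / y i0) `^ (e i0)^-1.
  rewrite ler_pdivrMr//.
  apply: (@le_trans _ _ (P `^ s)); first by rewrite ge0_ler_powR// ?nnegrE// ltW.
  have -> : P `^ s = (z / y i0) `^ (e i0)^-1 * \prod_i (y i / v) `^ (e i)^-1.
    rewrite /P powR_prod; last by move=> i; exact: powR_ge0.
    have -> : \prod_i (S i `^ tau i) `^ s = \prod_i S i `^ (e i)^-1.
      by apply: eq_bigr => i _; rewrite -powRrM /tau invfM mulrAC mulVf ?mul1r ?gt_eqF.
    rewrite (bigD1 i0)//= [in RHS](bigD1 i0)//= mulrA; congr (_ * _).
      by rewrite -powRM ?divr_ge0// ?ltW// /S eqxx mulrA divfK ?gt_eqF.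
    by apply: eq_bigr => i /negbTE ii0; rewrite /S ii0.
  by rewrite ler_wpM2l// powR_ge0.
have zy : eta `^ q * y i0 <= z.
  rewrite -ler_pdivlMr//; have /andP[e1 eq0] := eq i0.
  apply: (@le_trans _ _ (eta `^ e i0)); first by rewrite ger_powR// eta0.
  have := @ge0_ler_powR R (e i0) (ltW (e0 i0)) eta _ _ _ ratio.
  rewrite -powRrM mulVf ?gt_eqF// powRr1 ?divr_ge0 ?(ltW z0) ?(ltW (y0 _))//.
  by apply; rewrite nnegrE ?powR_ge0// ltW.
have : ((y i0)%:E = \int[mu]_(x in E) (W i0 x)%:E + z%:E)%E.
  rewrite -yE -zE (ge0_integral_setID mu mQ mE (mWE i0)) ?setIidr//.
  by move=> x; rewrite lee_fin ltW.
rewrite yE; have := int0 i0 E mE; case: (\int[mu]_(x in E) _)%E => [t _| |]//.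
by rewrite -EFinD -EFinM lee_fin => -[]; lra.
Qed.

(** Multiplying [W i] by [e^(t i * e i * g)] multiplies its average over a cube by at
    most [M * e^(t i * e i * c)], by the weighted John-Nirenberg inequality.  In the
    product of the powers [1 / e i] the centers disappear, since the [t i] add up
    to 0, and [M] is raised to the power [s]. *)
Lemma Aprod_perturb (A s q : R) : 1 <= A -> 0 < s -> 1 <= q ->
  exists delta Gam : R, 0 < delta /\
  forall e W (t : I -> R) (g : point -> R) (c : point -> R -> R),
    (forall i, 1 <= e i <= q) -> \sum_i (e i)^-1 = s ->
    (forall i, `|t i| <= 1) -> \sum_i t i = 0 ->
    (forall i, measurable_fun setT (W i)) -> (forall i x, 0 < W i x) ->
    (forall x, \prod_i W i x `^ (e i)^-1 = 1) ->
    measurable_fun setT g -> oscillates g c delta ->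
    (forall Q, cubes Q -> (Aprod e W Q <= A%:E)%E) ->
  forall Q, cubes Q ->
    (Aprod e (fun i x => W i x * expR (t i * e i * g x))%R Q <= Gam%:E)%E.
Proof.
move=> A1 s0 q1.
have A0 : 0 < A by exact: lt_le_trans A1.
have q0 : 0 < q by exact: lt_le_trans q1.
pose eta : R := 2^-1 `^ s / A.
have eta0 : 0 < eta by rewrite divr_gt0// powR_gt0.
have eta1 : eta < 1.
  rewrite ltr_pdivrMr// mul1r; apply: lt_le_trans A1.
  apply: (@lt_le_trans _ _ (1 `^ s)); last by rewrite powR1.
  by apply: (gt0_ltr_powR s0); rewrite ?nnegrE ?invr_ge0// invf_lt1// ltr1n.
pose theta := 1 - eta `^ q.
have theta0 : 0 < theta.
  rewrite subr_gt0; apply: (@lt_le_trans _ _ (1 `^ q)); last by rewrite powR1.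
  by apply: (gt0_ltr_powR q0); rewrite ?nnegrE ?ltW.
have theta1 : theta < 1 by rewrite ltrBlDr ltrDl powR_gt0.
have lnth : ln theta < 0 by rewrite ln_lt0// theta0.
pose D : R := 1 + 2 * 2 ^+ n.
have D0 : 0 < D by rewrite ltr_wpDr// mulr_ge0// exprn_ge0.
(* This choice makes the ratio of the John-Nirenberg recursion, for oscillations
   [q * delta], equal to the square root of [theta]. *)
pose delta := - ln theta / (2 * D * q).
have delta0 : 0 < delta by rewrite divr_gt0 ?oppr_gt0// !mulr_gt0.
have kth : expR (D * (q * delta)) * theta < 1.
  have -> : D * (q * delta) = - ln theta / 2.
    by rewrite /delta; field; rewrite !gt_eqF.
  rewrite -[X in _ * X](lnK (_ : theta \in Num.pos)) ?posrE// -expRD expR_lt1.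
  by lra.
pose M := expR (2 * (q * delta)) / (1 - expR (D * (q * delta)) * theta).
have M0 : 0 < M by rewrite divr_gt0 ?expR_gt0// subr_gt0.
exists delta, (M `^ s * A); split => // e W t g c eq es t1 ts mW W0 W1 mg osc ApA _ [a [l [l0 ->]]].
have e0 i : 0 < e i by have /andP[+ _] := eq i; exact: lt_le_trans.
have mQ := @measurable_cube R n a l.
have ApQ : (Aprod e W (cube a l) <= A%:E)%E by apply: ApA; exists a, l.
have te i : `|t i * e i| <= q.
  rewrite normrM (gtr0_norm (e0 i)); have /andP[_ eq1] := eq i.
  by apply: le_trans eq1; rewrite ler_piMl// ltW.
have mWE i : measurable_fun setT (fun x => (W i x)%:E) by exact/measurable_EFinP.
have mexp i (r : R) : measurable_fun setT (fun x => expR `|t i * e i * g x - r|).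
  apply: measurableT_comp => //; apply: measurableT_comp => //.
  by apply: measurable_funB => //; exact: measurable_funM.
have avgW' i : (avg (cube a l) (fun x => (W i x * expR (t i * e i * g x))%R) <=
    (expR (t i * e i * c a l) * M)%:E * avg (cube a l) (W i))%E.
  rewrite !avg_cubeE// muleCA lee_pmul2l ?lte_fin ?invr_gt0 ?exprn_gt0//.
  rewrite EFinM -muleA.
  pose g' x := t i * e i * g x; pose c' a l := t i * e i * c a l.
  have JN : (\int[mu]_(x in cube a l) (expR `|g' x - c' a l| * W i x)%:E <=
      M%:E * \int[mu]_(x in cube a l) (W i x)%:E)%E.
    apply: (weighted_john_nirenberg (g := g') (c := c') (delta := q * delta)) => //.
    - exact: measurable_funM.
    - exact: mulr_gt0.
    - move=> a' l' l'0; rewrite /g' /c'.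
      under eq_integral do rewrite -mulrBr normrM EFinM.
      rewrite ge0_integralZl//.
      + rewrite EFinM -muleA lee_pmul//.
        * by apply: integral_ge0 => x _; rewrite lee_fin.
        * by rewrite lee_fin.
        * exact: osc.
      + exact: measurable_cube.
      + apply: measurable_funTS; apply/measurable_EFinP.
        by apply: measurableT_comp => //; exact: measurable_funB.
    - by move=> x; exact: ltW.
    - exact: ltW.
    - exact: (Aprod_halving eq s0 es mW W0 W1 A1 ApA).
    - move=> a' l' l'0; apply: (Aprod_integral_lty l'0 e0 mW W0).
      by apply: le_lt_trans (ltry A); apply: ApA; exists a', l'.
  apply: (@le_trans _ _ ((expR (t i * e i * c a l))%:E *
     \int[mu]_(x in cube a l) (expR `|g' x - c' a l| * W i x)%:E)%E); last first.
    by rewrite lee_pmul2l// lte_fin expR_gt0.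
  rewrite -ge0_integralZl//.
  - apply: ge0_le_integral => //.
    + by move=> x _; rewrite lee_fin mulr_ge0 ?expR_ge0// ltW.
    + apply: measurable_funTS; apply/measurable_EFinP; apply: measurable_funM => //.
      by apply: measurableT_comp => //; exact: measurable_funM.
    + apply: measurable_funTS; apply/measurable_EFinP; apply: measurable_funM => //.
      by apply: measurable_funM => //; exact: mexp.
    + move=> x _; rewrite -EFinM lee_fin mulrC mulrA ler_pM2r//.
      rewrite -expRD ler_expR -lerBlDl /g' /c'.
      exact: ler_norm.
  - apply: measurable_funTS; apply/measurable_EFinP; apply: measurable_funM => //.
    exact: mexp.
  - by move=> x _; rewrite lee_fin mulr_ge0 ?expR_ge0// ltW.
have avg0 (f : point -> R) : (forall x, 0 <= f x) -> (0 <= avg (cube a l) f)%E.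
  move=> f0; rewrite avg_cubeE//; apply: mule_ge0.
    by rewrite lee_fin invr_ge0 exprn_ge0// ltW.
  by apply: integral_ge0 => x _; rewrite lee_fin.
apply: (@le_trans _ _ (\prod_i ((expR (t i * c a l) * M `^ (e i)^-1)%:E *
    avg (cube a l) (W i) `^ (e i)^-1))%E).
  apply: lee_prod => i; rewrite poweR_ge0/=.
  have -> : ((expR (t i * c a l) * M `^ (e i)^-1)%:E =
      (expR (t i * e i * c a l) * M)%:E `^ (e i)^-1)%E.
    rewrite poweR_EFin powRM ?expR_ge0// ?(ltW M0)//; congr (_ * _)%:E.
    by rewrite -expRM; congr expR; field; rewrite gt_eqF.
  have a0 : (0 <= avg (cube a l) (W i))%E by apply: avg0 => x; exact: ltW.
  rewrite -poweRM//; last by rewrite lee_fin mulr_ge0 ?expR_ge0// ltW.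
  apply: gt0_ler_poweR; rewrite ?in_itv/= ?leey ?andbT//.
  - by rewrite invr_ge0 ltW.
  - by apply: avg0 => x; rewrite mulr_ge0 ?expR_ge0// ltW.
  - by rewrite mule_ge0// lee_fin mulr_ge0 ?expR_ge0// ltW.
rewrite big_split/= prodEFin EFinM.
have -> : \prod_i (expR (t i * c a l) * M `^ (e i)^-1) = M `^ s.
  rewrite big_split/= -expR_sum -mulr_suml ts mul0r expR0 mul1r -es.
  by rewrite /powR gt_eqF// mulr_suml expR_sum.
by rewrite lee_wpmul2l// lee_fin powR_ge0.
Qed.

End mixed_averages.

(** * Stability of multiple weights under small exponential perturbations *)

Section multiple_weights.
Context {R : realType} {n m : nat}.
Local Notation point := ('R[R]^n).
Variables (p : R) (ps : 'I_m -> R).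
Hypothesis ps1 : forall j, 1 < ps j.
Hypothesis psum : p^-1 = \sum_(j < m) (ps j)^-1.
Hypothesis p1 : 1 <= p.
Implicit Types w : 'I_m -> point -> R.

(** Index [ord0] stands for the weight [nu_w] and its exponent [p], index
    [lift ord0 j] for the [j]-th dual weight and its exponent [p_j']. *)
Definition exp_family (i : 'I_m.+1) : R :=
  oapp (fun j => conj_exp (ps j)) p (unlift ord0 i).

Definition weight_family w (i : 'I_m.+1) : point -> R :=
  oapp (fun j x => w j x `^ (1 - conj_exp (ps j))) (nu_weight p ps w) (unlift ord0 i).

(** The boolean exponent keeps the formula uniform: slots other than [beta] are
    multiplied by [e^0]. *)
Definition perturb (beta : 'I_m) (g : point -> R) w : 'I_m -> point -> R :=
  fun j x => w j x * expR ((j == beta)%:R * ps j * g x).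

Let p0 : 0 < p. Proof. exact: lt_le_trans p1. Qed.
Let ps0 j : 0 < ps j. Proof. exact: lt_trans (ps1 j). Qed.

Lemma conj_exp_gt1 j : 1 < conj_exp (ps j).
Proof.
have d0 : 0 < ps j - 1 by rewrite subr_gt0.
by rewrite /conj_exp ltr_pdivlMr// mul1r ltrBlDr ltrDl.
Qed.

Let cj0 j : 0 < conj_exp (ps j). Proof. exact: lt_trans (conj_exp_gt1 j). Qed.

Lemma conj_expV j : (conj_exp (ps j))^-1 = 1 - (ps j)^-1.
Proof. by rewrite /conj_exp invf_div mulrBl divff ?mul1r// gt_eqF. Qed.

Lemma conj_exp_dual j : (1 - conj_exp (ps j)) * ps j = - conj_exp (ps j).
Proof.
rewrite /conj_exp; field.
by rewrite subr_eq0 gt_eqF.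
Qed.

Lemma Ap_dim_gt0 : (0 < m)%N.
Proof.
case: m ps ps1 psum => // ps' _; rewrite big_ord0 => pV.
by have := invr_gt0 p; rewrite pV p0 ltxx.
Qed.

Lemma ApE w Q :
  Aprod exp_family (weight_family w) Q =
  (avg Q (nu_weight p ps w) `^ p^-1 *
    \prod_(j < m) avg Q (fun x => w j x `^ (1 - conj_exp (ps j)))%R
                    `^ (conj_exp (ps j))^-1)%E.
Proof.
rewrite /Aprod big_ord_recl /exp_family /weight_family unlift_none/=.
by congr (_ * _)%E; apply: eq_bigr => j _; rewrite liftK.
Qed.

Lemma exp_family_bounds i : 1 <= exp_family i <= p + \sum_j conj_exp (ps j).
Proof.
rewrite /exp_family; case: unliftP => [j _|_] /=.
  rewrite (ltW (conj_exp_gt1 j))/= (bigD1 j)//= addrCA lerDl addr_ge0//.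
    exact: ltW.
  by apply: sumr_ge0 => l _; exact: ltW.
by rewrite p1/= lerDl; apply: sumr_ge0 => l _; exact: ltW.
Qed.

(** [1/p + sum_j 1/p_j' = sum_j 1/p_j + sum_j (1 - 1/p_j)]. *)
Lemma exp_family_sum : \sum_i (exp_family i)^-1 = m%:R.
Proof.
rewrite big_ord_recl /exp_family unlift_none/=.
under eq_bigr do rewrite liftK /= conj_expV.
by rewrite sumrB -psum sumr_const card_ord addrC subrK.
Qed.

Lemma nu_weight_gt0 w x : (forall j, 0 < w j x) -> 0 < nu_weight p ps w x.
Proof. by move=> w0; apply: prodr_gt0 => j _; exact: powR_gt0. Qed.

Lemma measurable_nu_weight w : (forall j, measurable_fun setT (w j)) ->
  measurable_fun setT (nu_weight p ps w).
Proof.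
move=> mw; apply: measurable_prod => j _.
exact: (measurableT_comp (measurable_powR _) (mw j)).
Qed.

Lemma weight_family_gt0 w x i : (forall j, 0 < w j x) -> 0 < weight_family w i x.
Proof.
move=> w0; rewrite /weight_family; case: unliftP => [j _|_] /=.
  exact: powR_gt0.
exact: nu_weight_gt0.
Qed.

Lemma measurable_weight_family w i : (forall j, measurable_fun setT (w j)) ->
  measurable_fun setT (weight_family w i).
Proof.
move=> mw; rewrite /weight_family; case: unliftP => [j _|_] /=.
  exact: (measurableT_comp (measurable_powR _) (mw j)).
exact: measurable_nu_weight.
Qed.

(** In each slot the exponents [1/p_j] and [(1 - p_j') / p_j'] are opposite. *)
Lemma weight_family_prod w x : (forall j, 0 < w j x) ->
  \prod_i weight_family w i x `^ (exp_family i)^-1 = 1.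
Proof.
move=> w0; rewrite big_ord_recl /exp_family /weight_family unlift_none/=.
rewrite /nu_weight powR_prod; last by move=> j; exact: powR_ge0.
rewrite -big_split/=; apply: big1 => j _; rewrite liftK/= -!powRrM.
rewrite -powRD; last by apply/implyP => _; rewrite gt_eqF.
rewrite conj_expV mulrBr mulr1 (_ : _ + _ = 0) ?powRr0//.
rewrite /conj_exp; field.
by rewrite subr_eq0 !gt_eqF.
Qed.

Lemma perturb_gt0 beta g w j x : 0 < w j x -> 0 < perturb beta g w j x.
Proof. by move=> w0; rewrite mulr_gt0// expR_gt0. Qed.

Lemma nu_weight_perturb beta g w x : (forall j, 0 < w j x) ->
  nu_weight p ps (perturb beta g w) x = nu_weight p ps w x * expR (p * g x).
Proof.
move=> w0; rewrite /nu_weight /perturb.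
under eq_bigr do rewrite powRM ?expR_ge0 ?(ltW (w0 _))//.
rewrite big_split/=; congr (_ * _).
rewrite (bigD1 beta)//= big1 ?mulr1 => [|j /negbTE jb].
  by rewrite eqxx mul1r -expRM; congr expR; field; rewrite gt_eqF.
by rewrite jb !mul0r expR0 powR1.
Qed.

(** Exponents by which the perturbation acts on the family: [nu_w] gains
    [e^(p g)] and the dual weight of slot [beta] gains [e^(- p_beta' g)]. *)
Definition tilt (beta : 'I_m) (i : 'I_m.+1) : R :=
  oapp (fun j => - (j == beta)%:R) 1 (unlift ord0 i).

Lemma weight_family_perturb beta g w i x : (forall j, 0 < w j x) ->
  weight_family (perturb beta g w) i x =
  weight_family w i x * expR (tilt beta i * exp_family i * g x).
Proof.
move=> w0; rewrite /weight_family /tilt /exp_family; case: unliftP => [j _|_] /=.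
  rewrite /perturb powRM ?expR_ge0 ?(ltW (w0 _))//; congr (_ * _).
  rewrite -expRM; congr expR.
  rewrite [LHS](_ : _ = (j == beta)%:R * g x * ((1 - conj_exp (ps j)) * ps j)); last by ring.
  by rewrite conj_exp_dual; ring.
by rewrite nu_weight_perturb// mul1r.
Qed.

Lemma tilt_norm beta i : `|tilt beta i| <= 1.
Proof.
rewrite /tilt; case: unliftP => [j _|_] /=; last by rewrite normr1.
by rewrite normrN normr_nat; case: (j == beta); rewrite ?ler01.
Qed.

Lemma tilt_sum beta : \sum_i tilt beta i = 0.
Proof.
rewrite big_ord_recl /tilt unlift_none/=.
under eq_bigr do rewrite liftK /=.
rewrite sumrN (bigD1 beta)//= eqxx big1 ?addr0 ?subrr// => j /negbTE ->.
by [].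
Qed.

(** The form in which the weight theory is used: the admissible oscillation and the
    new characteristic depend on the old characteristic alone, besides the
    dimensions and the exponents. *)
Lemma Ap_perturb (A : R) : exists delta Gam : R, 0 < delta /\
  forall w beta (g : point -> R) (c : point -> R -> R),
    Ap p ps w -> (Ap_sup p ps w <= A%:E)%E ->
    measurable_fun setT g -> oscillates g c delta ->
    Ap p ps (perturb beta g w) /\ (Ap_sup p ps (perturb beta g w) <= Gam%:E)%E.
Proof.
have m0 : 0 < m%:R :> R by rewrite ltr0n Ap_dim_gt0.
have A1 : 1 <= Num.max A 1 by rewrite le_max lexx orbT.
have q1 : 1 <= p + \sum_j conj_exp (ps j).
  by have /andP[a b] := exp_family_bounds ord0; exact: le_trans a b.
have [delta [Gam [d0 H]]] := @Aprod_perturb R n 'I_m.+1 _ _ _ A1 m0 q1.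
exists delta, Gam; split=> [|w beta g c [ww _] wA mg og]; first exact: d0.
have w0 x j : 0 < w j x by have [_] := ww j; exact.
have mw j : measurable_fun setT (w j) by have [] := ww j.
have supG : (Ap_sup p ps (perturb beta g w) <= Gam%:E)%E.
  apply: ge_ereal_sup => _ [Q cQ <-]; rewrite -ApE.
  have -> : weight_family (perturb beta g w) =
      fun i x => weight_family w i x * expR (tilt beta i * exp_family i * g x).
    by apply/funext => i; apply/funext => x; exact: weight_family_perturb.
  apply: (H exp_family (weight_family w) (tilt beta) g c) => //.
  - exact: exp_family_bounds.
  - exact: exp_family_sum.
  - exact: tilt_norm.
  - exact: tilt_sum.
  - by move=> i; exact: measurable_weight_family.
  - by move=> i x; exact: weight_family_gt0.
  - by move=> x; exact: weight_family_prod.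
  - move=> Q' cQ'; rewrite ApE; apply: (@le_trans _ _ A%:E).
      by apply: le_trans wA; apply: ereal_sup_ubound; exists Q'.
    by rewrite lee_fin le_max lexx.
split => //; split; last exact: le_lt_trans supG (ltry _).
move=> j; split; last by move=> x; exact: perturb_gt0.
apply: measurable_funM => //; apply: measurableT_comp => //.
exact: measurable_funM.
Qed.

End multiple_weights.

(** * Complex exponentials, Taylor polynomials and roots of unity *)

Section exponential_polynomial.
Context {F : numFieldType}.
Implicit Types (a b : F) (L k : nat).

(** The Taylor polynomial of [exp (a X)], with [a] kept apart from the variable: the
    variable will run through roots of unity. *)
Definition exp_poly L a : {poly F} := \poly_(k < L.+1) (a ^+ k / k`!%:R).

Lemma exp_polyE L a x : (exp_poly L a).[x] = \sum_(k < L.+1) (a * x) ^+ k / k`!%:R.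
Proof.
rewrite /exp_poly horner_poly; apply: eq_bigr => k _.
by rewrite exprMn mulrAC.
Qed.

(** Up to degree [L] the product is not affected by truncation, and the binomial
    formula applies. *)
Lemma coef_exp_polyM L a b k : (k <= L)%N ->
  (exp_poly L a * exp_poly L b)`_k = (a + b) ^+ k / k`!%:R.
Proof.
move=> kL; rewrite coefM exprDn mulr_suml (reindex_inj rev_ord_inj)/=.
apply: eq_bigr => i _; have ik : (i <= k)%N by rewrite -ltnS.
rewrite !coef_poly subSS subKn// !ltnS (leq_trans ik kL) (leq_trans (leq_subr _ _) kL).
have f0 j : j`!%:R != 0 :> F by rewrite pnatr_eq0 -lt0n fact_gt0.
rewrite -(bin_fact ik) !natrM -mulr_natr.
have c0 : 'C(k, i)%:R != 0 :> F by rewrite pnatr_eq0 -lt0n bin_gt0.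
by field; rewrite !f0 c0.
Qed.

Lemma horner1_wide (p : {poly F}) N : (size p <= N)%N -> p.[1] = \sum_(k < N) p`_k.
Proof.
move=> pN; rewrite (horner_coef_wide 1 pN); apply: eq_bigr => k _.
by rewrite expr1n mulr1.
Qed.

(** The failure of the functional equation of the exponential for Taylor polynomials
    consists of the coefficients of degree above [L]. *)
Lemma exp_polyM_defect L a b :
  (exp_poly L a).[1] * (exp_poly L b).[1] - (exp_poly L (a + b)).[1] =
  \sum_(k < L) (exp_poly L a * exp_poly L b)`_(L.+1 + k).
Proof.
rewrite -hornerM (@horner1_wide (exp_poly L a * exp_poly L b) (L.+1 + L)); last first.
  have sa : (size (exp_poly L a) <= L.+1)%N by exact: size_poly.
  have sb : (size (exp_poly L b) <= L.+1)%N by exact: size_poly.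
  apply: (leq_trans (size_polyMleq (exp_poly L a) (exp_poly L b))).
  by move: sa sb; move: (size _) (size _) => u v; lia.
rewrite big_split_ord/= addrAC [X in X - _ + _](_ : _ = (exp_poly L (a + b)).[1]).
  by rewrite subrr add0r.
rewrite exp_polyE; apply: eq_bigr => k _; rewrite mulr1 coef_exp_polyM//.
by rewrite -ltnS.
Qed.

End exponential_polynomial.

Section complex_exponential.
Context {R : realType}.
Local Notation C := R[i].
Local Notation normc := (@Normc.normc R).
Implicit Types (z w : C).

Definition cexp z : C :=
  Complex (expR (complex.Re z) * cos (complex.Im z)) (expR (complex.Re z) * sin (complex.Im z)).

Lemma normc_ge0 z : 0 <= normc z. Proof. by case: z => a b; exact: sqrtr_ge0. Qed.

Lemma normc_cexp z : normc (cexp z) = expR (complex.Re z).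
Proof.
by rewrite /cexp /= !exprMn -mulrDr cos2Dsin2 mulr1 sqrtr_sqr ger0_norm// expR_ge0.
Qed.

Lemma normc_sum (I : Type) (r : seq I) (P : pred I) (f : I -> C) :
  normc (\sum_(i <- r | P i) f i) <= \sum_(i <- r | P i) normc (f i).
Proof.
elim/big_ind2: _ => [|a b c d ab cd|//]; first by rewrite Normc.normc0.
by apply: (le_trans (le_normcD _ _)); exact: lerD.
Qed.

Lemma normcX z k : normc (z ^+ k) = normc z ^+ k.
Proof. by elim: k => [|k IH]; rewrite ?expr0 ?Normc.normc1// !exprS Normc.normcM IH. Qed.

Lemma normcR (x : R) : normc (x%:C)%C = `|x|.
Proof. by rewrite /= expr0n/= addr0 sqrtr_sqr. Qed.

Lemma normc_nat k : normc k%:R = k%:R.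
Proof. by rewrite -(rmorph_nat (real_complex R)) normcR normr_nat. Qed.

Lemma normc_le_Re_Im z : normc z <= `|complex.Re z| + `|complex.Im z|.
Proof.
case: z => a b /=; rewrite -(@ler_pXn2r _ 2)// ?nnegrE ?sqrtr_ge0 ?addr_ge0//.
rewrite sqr_sqrtr ?addr_ge0 ?sqr_ge0// -(real_normK (num_real a)) -(real_normK (num_real b)) sqrrD.
by rewrite lerD2r lerDl mulrn_wge0// mulr_ge0.
Qed.

Lemma Re_le_normc z : `|complex.Re z| <= normc z.
Proof.
by case: z => a b /=; rewrite -(sqrtr_sqr a); apply: ler_wsqrtr; rewrite lerDl sqr_ge0.
Qed.

Lemma exp_poly_cvg (x : R) : (exp_poly L x).[1] @[L --> \oo] --> expR x.
Proof.
rewrite (_ : (fun L => _) = (fun L => series (exp_coeff x) L.+1)).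
  by rewrite (cvg_shiftS (series (exp_coeff x))); exact: is_cvg_series_exp_coeff.
apply/funext => L; rewrite exp_polyE /series /= big_mkord.
by apply: eq_bigr => k _; rewrite mulr1.
Qed.

Lemma exp_poly_le_expR (x : R) L : 0 <= x -> (exp_poly L x).[1] <= expR x.
Proof.
move=> x0; rewrite -(cvg_lim _ (@exp_poly_cvg x))//.
apply: nondecreasing_cvgn_le; last by apply/cvg_ex; exists (expR x); exact: exp_poly_cvg.
apply/nondecreasing_seqP => k; rewrite !exp_polyE [leRHS]big_ord_recr/= lerDl.
by rewrite divr_ge0// exprn_ge0// mulr1.
Qed.

Lemma normc_coef_exp_polyM L z w k :
  normc (exp_poly L z * exp_poly L w)`_k <=
  (exp_poly L (normc z) * exp_poly L (normc w))`_k.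
Proof.
have E j (t : C) : normc (exp_poly L t)`_j = (exp_poly L (normc t))`_j.
  rewrite !coef_poly; case: ifP => _; last by rewrite Normc.normc0.
  by rewrite Normc.normcM Normc.normcV normcX normc_nat.
rewrite !coefM; apply: (le_trans (normc_sum _ _ _)); apply: ler_sum => j _.
by rewrite Normc.normcM !E.
Qed.

(** Termwise domination by the real series, where the defect tends to 0 because of the
    functional equation of the real exponential. *)
Lemma normc_exp_polyM_defect L z w :
  normc ((exp_poly L z).[1] * (exp_poly L w).[1] - (exp_poly L (z + w)).[1]) <=
  (exp_poly L (normc z)).[1] * (exp_poly L (normc w)).[1] -
  (exp_poly L (normc z + normc w)).[1].
Proof.
rewrite !exp_polyM_defect; apply: (le_trans (normc_sum _ _ _)).
by apply: ler_sum => k _; exact: normc_coef_exp_polyM.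
Qed.

(** Sorting the powers of the imaginary unit by parity gives the defining series of
    the cosine and of the sine. *)
Lemma exp_poly_imaginary L (y : R) :
  (exp_poly L (Complex 0 y)).[1] =
  Complex (series (cos_coeff y) L.+1) (series (sin_coeff y) L.+1).
Proof.
rewrite exp_polyE /series /= !big_mkord.
elim/big_ind3: _ => [//|_ a1 b1 _ a2 b2 -> ->//|k' _].
move: (nat_of_ord k') => k {k'}.
have -> : (Complex 0 y * 1) ^+ k =
    Complex ((~~ odd k)%:R * (-1) ^+ k./2 * y ^+ k)
            ((odd k)%:R * (-1) ^+ k.-1./2 * y ^+ k).
  have sq : Complex 0 y ^+ 2 = ((- y ^+ 2)%:C)%C.
    by apply/eqP; rewrite expr2 eq_complex/=; apply/andP; split; apply/eqP; ring.
  have kE : k = (odd k + 2 * k./2)%N by rewrite mul2n odd_double_half.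
  rewrite mulr1 {1}kE exprD exprM sq -rmorphXn/=.
  have yk : y ^+ k = y ^+ odd k * (y ^+ 2) ^+ k./2 by rewrite -exprM -exprD -kE.
  have oddk : odd k -> k.-1./2 = k./2.
    by move=> ok; rewrite kE ok add1n/= mul2n doubleK uphalf_double.
  rewrite yk (exprNn (y ^+ 2)); case: (odd k) oddk => /= ok.
    by apply/eqP; rewrite eq_complex/= ok// !expr1; apply/andP; split; apply/eqP; ring.
  by apply/eqP; rewrite eq_complex/= !expr0; apply/andP; split; apply/eqP; ring.
have -> : (k`!%:R : C)^-1 = (((k`!%:R)^-1 : R)%:C)%C by rewrite rmorphV ?rmorph_nat// unitfE pnatr_eq0 -lt0n fact_gt0.
apply/eqP; rewrite eq_complex/= /cos_coeff /sin_coeff /=.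
by rewrite !mulr0 subr0 add0r !eqxx.
Qed.

Lemma exp_poly_real L (x : R) :
  (exp_poly L (x%:C)%C).[1] = (((exp_poly L x).[1])%:C)%C.
Proof.
rewrite !exp_polyE rmorph_sum; apply: eq_bigr => k _.
by rewrite !mulr1 rmorphM rmorphXn/= fmorphV rmorph_nat.
Qed.

(** For [z = x + iy] the Taylor polynomial is close to the product of those of [x] and
    [iy], whose limits are known. *)
Lemma exp_poly_cvg_cexp z :
  normc (cexp z - (exp_poly L z).[1]) @[L --> \oo] --> (0 : R).
Proof.
case: z => x y; set u := fun L => (exp_poly L x).[1].
set c := fun L => series (cos_coeff y) L.+1; set s := fun L => series (sin_coeff y) L.+1.
have cu : u @ \oo --> expR x by exact: exp_poly_cvg.
have cc : c @ \oo --> cos y.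
  rewrite (cvg_shiftS (series (cos_coeff y))) unlock.
  exact: is_cvg_series_cos_coeff.
have cs : s @ \oo --> sin y.
  rewrite (cvg_shiftS (series (sin_coeff y))) unlock.
  exact: is_cvg_series_sin_coeff.
pose bound L := `|expR x * cos y - u L * c L| + `|expR x * sin y - u L * s L| +
  ((exp_poly L `|x|).[1] * (exp_poly L `|y|).[1] - (exp_poly L (`|x| + `|y|)).[1]).
have cb : bound @ \oo --> (0 : R).
  have -> : (0 : R) = `|expR x * cos y - expR x * cos y| + `|expR x * sin y - expR x * sin y| +
      (expR `|x| * expR `|y| - expR (`|x| + `|y|)).
    by rewrite expRD !subrr normr0 !addr0.
  apply: cvgD.
    by apply: cvgD; apply: cvg_norm; apply: cvgB; [exact: cvg_cst|exact: cvgM|exact: cvg_cst|exact: cvgM].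
  by apply: cvgB; [apply: cvgM; exact: exp_poly_cvg|exact: exp_poly_cvg].
apply: (squeeze_cvgr _ (cvg_cst 0) cb).
apply: nearW => L; rewrite normc_ge0/=.
have zE : Complex x y = (x%:C)%C + Complex 0 y.
  by apply/eqP; rewrite eq_complex/= addr0 add0r !eqxx.
have -> : cexp (Complex x y) - (exp_poly L (Complex x y)).[1] =
  (cexp (Complex x y) - (exp_poly L (x%:C)%C).[1] * (exp_poly L (Complex 0 y)).[1]) +
  ((exp_poly L (x%:C)%C).[1] * (exp_poly L (Complex 0 y)).[1] - (exp_poly L (Complex x y)).[1]).
  by rewrite subrKA.
apply: (le_trans (le_normcD _ _)); apply: lerD.
  have -> : (exp_poly L (x%:C)%C).[1] * (exp_poly L (Complex 0 y)).[1] =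
      Complex (u L * c L) (u L * s L).
    apply: (etrans (congr2 *%R (exp_poly_real L x) (exp_poly_imaginary L y))).
    by apply/eqP; rewrite eq_complex/= !mul0r subr0 addr0 !eqxx.
  exact: normc_le_Re_Im.
have nx : normc (x%:C)%C = `|x| := normcR x.
have ny : normc (Complex 0 y) = `|y| by rewrite /= expr0n/= add0r sqrtr_sqr.
by rewrite -nx -ny zE; exact: normc_exp_polyM_defect.
Qed.

(** A geometric remainder estimate: the term of degree [k] is [2^-k] times that of
    [2 z]. *)
Lemma normc_cexp_sub_exp_poly L z :
  normc (cexp z - (exp_poly L z).[1]) <= 2 ^- L * expR (2 * normc z).
Proof.
have tail M : (L <= M)%N ->
    normc ((exp_poly M z).[1] - (exp_poly L z).[1]) <= 2 ^- L * expR (2 * normc z).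
  move=> LM; rewrite !exp_polyE -!(big_mkord xpredT (fun k => (z * 1) ^+ k / k`!%:R)).
  rewrite (big_cat_nat _ (n := L.+1))//= addrAC subrr add0r.
  apply: (le_trans (normc_sum _ _ _)).
  have t0 : 0 <= 2 * normc z by rewrite mulr_ge0// normc_ge0.
  apply: (@le_trans _ _ (2 ^- L * (exp_poly M (2 * normc z)).[1])); last first.
    by rewrite ler_wpM2l ?invr_ge0 ?exprn_ge0// exp_poly_le_expR.
  rewrite exp_polyE -(big_mkord xpredT (fun k => (2 * normc z * 1) ^+ k / k`!%:R)).
  rewrite [in leRHS](big_cat_nat _ (n := L.+1))//= mulrDr mulr_sumr mulr_sumr.
  apply: ler_wpDl.
    by apply: sumr_ge0 => k _; rewrite mulr_ge0 ?invr_ge0 ?exprn_ge0 ?divr_ge0 ?exprn_ge0 ?mulr1.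
  apply: ler_sum_nat => k /andP[Lk _].
  rewrite Normc.normcM Normc.normcV normc_nat normcX !mulr1 mulrA.
  rewrite ler_wpM2r ?invr_ge0// exprMn mulrA ler_peMl ?exprn_ge0 ?normc_ge0//.
  rewrite mulrC ler_pdivlMr ?exprn_gt0// mul1r ler_eXn2l ?ltr1n//.
  exact: ltnW.
apply/ler_addgt0Pr => e e0.
have /cvgrPdist_le/(_ e e0)[M _ HM] := exp_poly_cvg_cexp z.
have := HM (maxn L M) (leq_maxr _ _); rewrite /= sub0r normrN ger0_norm ?normc_ge0// => He.
rewrite [leRHS]addrC -[cexp z - _](subrKA (exp_poly (maxn L M) z).[1]).
apply: (le_trans (le_normcD _ _)); apply: lerD => //.
by apply: tail; exact: leq_maxl.
Qed.

(** ['X^N - 1] splits and is separable. *)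
Lemma primitive_root_exists N : (0 < N)%N -> exists zeta : C, N.-primitive_root zeta.
Proof.
move=> N0; have [r] := closed_field_poly_normal ('X^N - 1 : {poly C}).
rewrite (monicP _) ?monicXnsubC// scale1r => rE.
have root_r : all N.-unity_root r by apply/allP => z; rewrite -root_prod_XsubC -rE.
have size_r : (N <= size r)%N.
  by rewrite -ltnS -(size_prod_XsubC r id) -rE size_XnsubC.
have uniq_r : uniq r.
  by rewrite -separable_prod_XsubC -rE separable_Xn_sub_1// pnatr_eq0 -lt0n.
by have /hasP[z _] := has_prim_root N0 root_r uniq_r size_r; exists z.
Qed.

Lemma normc_unity_root N (z : C) : (0 < N)%N -> z ^+ N = 1 -> normc z = 1.
Proof.
move=> N0 zN; apply/eqP; rewrite -(@pexpr_eq1 _ _ N)// ?normc_ge0//.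
by rewrite -normcX zN Normc.normc1.
Qed.

(** The discrete form of Cauchy's formula for the first coefficient. *)
Lemma first_coef_filter N (zeta : C) (F : {poly C}) :
  N.-primitive_root zeta -> (1 < N)%N -> (size F <= N)%N ->
  \sum_(j < N) (zeta ^+ j)^-1 * F.[zeta ^+ j] = N%:R * F`_1.
Proof.
move=> zN N1 FN; have N0 : (0 < N)%N by exact: ltnW.
have z1 : zeta ^+ N = 1 := prim_expr_order zN.
have z0 : zeta != 0.
  by apply/eqP => z0; move: z1; rewrite z0 expr0n gtn_eqF// => /esym/eqP; rewrite oner_eq0.
have H (k : nat) : (k < N)%N -> \sum_(j < N) (zeta ^+ j)^-1 * (zeta ^+ j) ^+ k =
    if k == 1%N then N%:R else 0.
  move=> kN; pose q := zeta^-1 * zeta ^+ k.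
  have -> : \sum_(j < N) (zeta ^+ j)^-1 * (zeta ^+ j) ^+ k = \sum_(j < N) q ^+ j.
    by apply: eq_bigr => j _; rewrite /q exprMn exprVn -exprM mulnC exprM.
  have [k1|k1] := eqVneq k 1%N.
    rewrite /q k1 expr1 mulVf//; under eq_bigr do rewrite expr1n.
    by rewrite sumr_const card_ord.
  have q1 : q != 1.
    apply/eqP => /(congr1 (fun t => zeta * t)); rewrite mulVKf// mulr1 => /eqP.
    rewrite -{2}[zeta]expr1 (eq_prim_root_expr zN) !modn_small//.
    exact/negP.
  have /eqP : (q - 1) * \sum_(j < N) q ^+ j = 0.
    rewrite -subrX1 /q exprMn exprVn -exprM mulnC exprM z1 expr1n invr1 mulr1.
    by rewrite subrr.
  by rewrite mulf_eq0 subr_eq0 (negbTE q1) => /eqP.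
under eq_bigr => j _.
  rewrite (horner_coef_wide _ FN) mulr_sumr.
  under eq_bigr do rewrite mulrCA.
  over.
rewrite exchange_big/= (bigD1 (Ordinal N1))//= -mulr_sumr H// eqxx big1 ?addr0 1?mulrC//.
move=> k k1; rewrite -mulr_sumr H// ifF ?mulr0//.
by apply/negbTE; apply: contra k1 => /eqP k1; apply/eqP/val_inj.
Qed.

End complex_exponential.

(** * Weighted norms of complex functions *)

Section weighted_norms.
Context {R : realType} {n : nat}.
Local Notation point := ('R[R]^n).
Local Notation mu := (@lebesgue_tuple R n).
Local Notation normc := (@Normc.normc R).
Implicit Types (f g : point -> R[i]) (v : point -> R).

Lemma ReD (z w : R[i]) : complex.Re (z + w) = complex.Re z + complex.Re w.
Proof. by case: z w => [a b] [c d]. Qed.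
Lemma ImD (z w : R[i]) : complex.Im (z + w) = complex.Im z + complex.Im w.
Proof. by case: z w => [a b] [c d]. Qed.
Lemma ReM (z w : R[i]) :
  complex.Re (z * w) = complex.Re z * complex.Re w - complex.Im z * complex.Im w.
Proof. by case: z w => [a b] [c d]. Qed.
Lemma ImM (z w : R[i]) :
  complex.Im (z * w) = complex.Re z * complex.Im w + complex.Im z * complex.Re w.
Proof. by case: z w => [a b] [c d]. Qed.

Lemma cmeasurable_cst (c : R[i]) : cmeasurable (fun _ : point => c).
Proof. by split; exact: measurable_cst. Qed.

Lemma cmeasurableD f g : cmeasurable f -> cmeasurable g ->
  cmeasurable (fun x => f x + g x).
Proof.
move=> [f1 f2] [g1 g2]; split.
  by under eq_fun do rewrite ReD; exact: measurable_funD.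
by under eq_fun do rewrite ImD; exact: measurable_funD.
Qed.

Lemma cmeasurableM f g : cmeasurable f -> cmeasurable g ->
  cmeasurable (fun x => f x * g x).
Proof.
move=> [f1 f2] [g1 g2]; split.
  by under eq_fun do rewrite ReM; apply: measurable_funB; exact: measurable_funM.
by under eq_fun do rewrite ImM; apply: measurable_funD; exact: measurable_funM.
Qed.

Lemma cmeasurableN f : cmeasurable f -> cmeasurable (fun x => - f x).
Proof.
move=> mf; under eq_fun do rewrite -mulN1r.
by apply: cmeasurableM => //; exact: cmeasurable_cst.
Qed.

Lemma cmeasurableB f g : cmeasurable f -> cmeasurable g ->
  cmeasurable (fun x => f x - g x).
Proof. by move=> mf mg; apply: cmeasurableD => //; exact: cmeasurableN. Qed.

Lemma cmeasurableX f k : cmeasurable f -> cmeasurable (fun x => f x ^+ k).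
Proof.
move=> mf; elim: k => [|k IH]; first exact: cmeasurable_cst.
by under eq_fun do rewrite exprS; exact: cmeasurableM.
Qed.

Lemma cmeasurable_sum (I : Type) (r : seq I) (h : I -> point -> R[i]) :
  (forall i, cmeasurable (h i)) -> cmeasurable (fun x => \sum_(i <- r) h i x).
Proof.
move=> mh; elim: r => [|i r IH].
  by under eq_fun do rewrite big_nil; exact: cmeasurable_cst.
by under eq_fun do rewrite big_cons; exact: cmeasurableD.
Qed.

Lemma measurable_normc f : cmeasurable f -> measurable_fun setT (fun x => normc (f x)).
Proof.
move=> [f1 f2].
have -> : (fun x => normc (f x)) =
    (fun x => (complex.Re (f x) ^+ 2 + complex.Im (f x) ^+ 2) `^ 2^-1).
  apply/funext => x; rewrite powR12_sqrt ?addr_ge0 ?sqr_ge0//.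
  by case: (f x).
have m2 : measurable_fun setT (fun x => complex.Re (f x) ^+ 2 + complex.Im (f x) ^+ 2).
  by apply: measurable_funD; exact: measurable_funX.
exact: (measurableT_comp (measurable_powR _) m2).
Qed.

Lemma cmeasurable_cexp f : cmeasurable f -> cmeasurable (fun x => cexp (f x)).
Proof.
move=> [f1 f2]; split => /=; apply: measurable_funM.
- exact: measurableT_comp.
- by apply: measurableT_comp => //; apply: continuous_measurable_fun; exact: continuous_cos.
- exact: measurableT_comp.
- by apply: measurableT_comp => //; apply: continuous_measurable_fun; exact: continuous_sin.
Qed.

Lemma cmeasurable_indic (E : set point) f : measurable E -> cmeasurable f ->
  cmeasurable (fun x => ((\1_E x : R)%:C)%C * f x).
Proof.
move=> mE mf; apply: cmeasurableM => //; split => /=; last exact: measurable_cst.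
exact: measurable_indic.
Qed.

Section fixed_exponent.
Variable p : R.
Hypothesis p1 : 1 <= p.
Let p0 : 0 < p. Proof. exact: lt_le_trans p1. Qed.

Lemma measurable_wintegrand v f : measurable_fun setT v -> cmeasurable f ->
  measurable_fun setT (fun x => (normc (f x) `^ p * v x)%:E).
Proof.
move=> mv mf; apply/measurable_EFinP; apply: measurable_funM => //.
exact: (measurableT_comp (measurable_powR _) (measurable_normc mf)).
Qed.

Lemma wnorm_ge0 v f : (0 <= wnorm p v f)%E.
Proof. exact: poweR_ge0. Qed.

(** One comparison principle covers monotonicity, homogeneity and changes of
    weight. *)
Lemma wnorm_le v v' f g (K : R) : 0 <= K ->
  measurable_fun setT v -> measurable_fun setT v' ->
  (forall x, 0 <= v x) -> (forall x, 0 <= v' x) ->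
  cmeasurable f -> cmeasurable g ->
  (forall x, normc (f x) `^ p * v x <= K `^ p * (normc (g x) `^ p * v' x)) ->
  (wnorm p v f <= K%:E * wnorm p v' g)%E.
Proof.
move=> K0 mv mv' v0 v'0 mf mg fg; rewrite /wnorm.
have i0 v0' f0' : (forall x, 0 <= v0' x) ->
    (0 <= \int[mu]_x (normc (f0' x) `^ p * v0' x)%:E)%E.
  by move=> ?; apply: integral_ge0 => x _; rewrite lee_fin mulr_ge0 ?powR_ge0.
have -> : K%:E = ((K `^ p)%:E `^ p^-1)%E.
  by rewrite poweR_EFin -powRrM divff ?gt_eqF// powRr1.
rewrite -poweRM ?lee_fin ?powR_ge0//; last exact: i0.
apply: gt0_ler_poweR; rewrite ?in_itv/= ?leey ?andbT ?invr_ge0 ?(ltW p0)//.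
- exact: i0.
- by rewrite mule_ge0// ?lee_fin ?powR_ge0//; exact: i0.
rewrite -ge0_integralZl//.
- apply: ge0_le_integral => //.
  + by move=> x _; rewrite lee_fin mulr_ge0 ?powR_ge0.
  + exact: measurable_wintegrand.
  + by apply: emeasurable_funM => //; exact: measurable_wintegrand.
  + by move=> x _; rewrite -EFinM lee_fin.
- exact: measurable_wintegrand.
- by move=> x _; rewrite lee_fin mulr_ge0 ?powR_ge0.
- by rewrite lee_fin powR_ge0.
Qed.

Lemma wnorm_ae v f g : measurable_fun setT v -> (forall x, 0 <= v x) ->
  cmeasurable f -> cmeasurable g -> {ae mu, forall x, f x = g x} ->
  wnorm p v f = wnorm p v g.
Proof.
move=> mv v0 mf mg fg; rewrite /wnorm; apply: (congr1 (fun t => t `^ p^-1)%E).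
apply: ge0_ae_eq_integral => //.
- exact: measurable_wintegrand.
- exact: measurable_wintegrand.
- by move=> x _; rewrite lee_fin mulr_ge0 ?powR_ge0.
- by move=> x _; rewrite lee_fin mulr_ge0 ?powR_ge0.
- by apply: filterS fg => x -> _.
Qed.

(** Minkowski's inequality for Lebesgue measure, applied to [|f| v^(1/p)]. *)
Lemma wnormD v f g : measurable_fun setT v -> (forall x, 0 <= v x) ->
  cmeasurable f -> cmeasurable g ->
  (wnorm p v (fun x => f x + g x)%R <= wnorm p v f + wnorm p v g)%E.
Proof.
move=> mv v0 mf mg.
pose root f0 x := normc (f0 x) * v x `^ p^-1.
have mroot f0 : cmeasurable f0 -> measurable_fun setT (root f0).
  move=> m0; apply: measurable_funM; first exact: measurable_normc.
  exact: (measurableT_comp (measurable_powR _) mv).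
have root0 f0 x : 0 <= root f0 x by rewrite mulr_ge0 ?powR_ge0 ?normc_ge0.
have rootE f0 x : root f0 x `^ p = normc (f0 x) `^ p * v x.
  by rewrite powRM ?powR_ge0 ?normc_ge0// -powRrM mulVf ?gt_eqF// powRr1.
have wE f0 : wnorm p v f0 = Lnorm mu p%:E (EFin \o root f0).
  rewrite unlock /Lnorm /wnorm; congr (_ `^ _)%E; apply: eq_integral => x _ /=.
  by rewrite ger0_norm// rootE.
have := minkowski_EFin mu (mroot _ mf) (mroot _ mg) p1; rewrite -!wE.
apply: le_trans; rewrite unlock /Lnorm /wnorm.
apply: gt0_ler_poweR; rewrite ?in_itv/= ?leey ?andbT ?invr_ge0 ?(ltW p0)//.
- by apply: integral_ge0 => x _; rewrite lee_fin mulr_ge0 ?powR_ge0.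
- by apply: integral_ge0 => x _; rewrite lee_fin powR_ge0.
apply: ge0_le_integral => //.
- by move=> x _; rewrite lee_fin mulr_ge0 ?powR_ge0.
- by apply: measurable_wintegrand => //; exact: cmeasurableD.
- have mD : measurable_fun setT (fun x => `|root f x + root g x|).
    by apply: measurableT_comp => //; apply: measurable_funD; exact: mroot.
  by apply/measurable_EFinP; exact: (measurableT_comp (measurable_powR p) mD).
- move=> x _; rewrite /= lee_fin -(rootE (fun x => f x + g x)).
  apply: ge0_ler_powR; rewrite ?nnegrE ?(ltW p0)//.
  by rewrite ger0_norm ?addr_ge0// /root -mulrDl ler_wpM2r ?powR_ge0// le_normcD.
Qed.

Lemma wnorm_sum v (I : Type) (r : seq I) (h : I -> point -> R[i]) :
  measurable_fun setT v -> (forall x, 0 <= v x) -> (forall i, cmeasurable (h i)) ->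
  (wnorm p v (fun x => \sum_(i <- r) h i x)%R <= \sum_(i <- r) wnorm p v (h i))%E.
Proof.
move=> mv v0 mh; elim: r => [|i r IH].
  under eq_fun do rewrite big_nil.
  rewrite big_nil /wnorm integral0_eq ?poweR0r ?invr_eq0 ?gt_eqF// => x _.
  by rewrite Normc.normc0 powR0 ?mul0r// gt_eqF.
under eq_fun do rewrite big_cons.
rewrite big_cons; apply: (le_trans (wnormD mv v0 _ _)) => //.
  exact: cmeasurable_sum.
by rewrite leeD2l.
Qed.

End fixed_exponent.
End weighted_norms.

(** * Cauchy's formula for the first coefficient *)

Section contour_extraction.
Context {R : realType} {n : nat}.
Local Notation point := ('R[R]^n).
Local Notation mu := (@lebesgue_tuple R n).
Local Notation normc := (@Normc.normc R).
Variables (p : R) (v : point -> R) (b : point -> R[i]).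
Hypothesis p1 : 1 <= p.
Hypothesis mv : measurable_fun setT v.
Hypothesis v0 : forall x, 0 <= v x.
Hypothesis mb : cmeasurable b.
Let p0 : 0 < p. Proof. exact: lt_le_trans p1. Qed.

Definition sublevel (M : nat) : set point := [set x | normc (b x) <= M%:R].

Let measurable_sublevel M : measurable (sublevel M).
Proof.
have := measurable_normc mb measurableT (measurable_itv `]-oo, M%:R]).
by rewrite setTI; congr measurable; apply/funext => x.
Qed.

Let trunc M (F : point -> R[i]) x : R[i] := ((\1_(sublevel M) x : R)%:C)%C * F x.

Let mtrunc M F : cmeasurable F -> cmeasurable (trunc M F).
Proof. by move=> mF; exact: cmeasurable_indic. Qed.

Let normc_trunc M F x : normc (trunc M F x) = \1_(sublevel M) x * normc (F x).
Proof. by rewrite Normc.normcM normcR ger0_norm// indicE. Qed.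

(** Monotone convergence along the sublevel sets of [|b|]. *)
Lemma wnorm_truncation F (K : R) : 0 <= K -> cmeasurable F ->
  (forall M, (wnorm p v (trunc M F) <= K%:E)%E) -> (wnorm p v F <= K%:E)%E.
Proof.
move=> K0 mF HM.
pose phi M x := (normc (trunc M F x) `^ p * v x)%:E.
have phi0 M x : (0 <= phi M x)%E by rewrite lee_fin mulr_ge0 ?powR_ge0.
have mphi M : measurable_fun setT (phi M).
  by apply: measurable_wintegrand => //; exact: mtrunc.
have phiK M : (\int[mu]_x phi M x <= (K `^ p)%:E)%E.
  have I0 : (0 <= \int[mu]_x phi M x)%E by exact: integral_ge0.
  have -> : (\int[mu]_x phi M x = (wnorm p v (trunc M F)) `^ p)%E.
    by rewrite /wnorm -poweRrM mulVf ?gt_eqF// poweRe1.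
  rewrite -poweR_EFin; apply: gt0_ler_poweR; rewrite ?in_itv/= ?leey ?andbT ?(ltW p0)//.
  exact: poweR_ge0.
have -> : K%:E = ((K `^ p)%:E `^ p^-1)%E.
  by rewrite poweR_EFin -powRrM divff ?gt_eqF// powRr1.
rewrite /wnorm; apply: gt0_ler_poweR; rewrite ?in_itv/= ?leey ?andbT ?invr_ge0 ?(ltW p0)//.
- by apply: integral_ge0 => x _; rewrite lee_fin mulr_ge0 ?powR_ge0.
- by rewrite lee_fin powR_ge0.
have ind M x : normc (b x) <= M%:R -> phi M x = (normc (F x) `^ p * v x)%:E.
  by move=> bM; rewrite /phi normc_trunc indicE mem_set// mul1r.
have -> : (\int[mu]_x (normc (F x) `^ p * v x)%:E = \int[mu]_x limn (phi ^~ x))%E.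
  apply: eq_integral => x _; apply/esym/lim_near_cst => //.
  have [N _ HN] := nbhs_infty_ger (normc (b x)).
  by exists N => // j Nj; rewrite ind//; exact: HN.
rewrite monotone_convergence//; last first.
  move=> x _ i j ij; have [bi|bi] := leP (normc (b x)) i%:R.
    by rewrite !ind//; apply: le_trans bi _; rewrite ler_nat.
  rewrite [leLHS](_ : _ = 0%E)//.
  rewrite /phi normc_trunc indicE memNset ?mul0r ?powR0 ?mul0r ?gt_eqF//.
  by rewrite /sublevel /= leNgt bi.
apply: lime_le; last by apply: nearW => M; exact: phiK.
apply: ereal_nondecreasing_is_cvgn => i j ij; apply: ge0_le_integral => // x _.
have [bi|bi] := leP (normc (b x)) i%:R.
  by rewrite !ind//; apply: le_trans bi _; rewrite ler_nat.
rewrite [leLHS](_ : _ = 0%E)//.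
rewrite /phi normc_trunc indicE memNset ?mul0r ?powR0 ?mul0r ?gt_eqF//.
by rewrite /sublevel /= leNgt bi.
Qed.

(** In the application [s l] is [S(.., b^l f_beta, ..)] and [U z] is
    [S(.., e^(-zb) f_beta, ..)]. *)
Variables (rho Kn : R) (s : nat -> point -> R[i]) (U : R[i] -> point -> R[i]).
Hypothesis rho0 : 0 < rho.
Hypothesis Kn0 : 0 <= Kn.
(** The weight [v e^(c p rho |b|)]: the functions [s l] are controlled for [c = -1],
    and the remainders, which carry another factor [e^(zb)], for [c = -2]. *)
Let damp (c : R) x : R := v x * expR (p * (c * (rho * normc (b x)))).
Hypothesis ms : forall l, cmeasurable (s l).
Hypothesis s_le : forall l,
  (wnorm p (damp (-1)) (s l) <= (Kn * l`!%:R / rho ^+ l)%:E)%E.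
Hypothesis mU : forall z, normc z = rho / 2 -> cmeasurable (U z).
Hypothesis U_le : forall z, normc z = rho / 2 ->
  (wnorm p (fun x => v x * expR (p * complex.Re (z * b x)))%R (U z) <= Kn%:E)%E.
Hypothesis U_taylor : forall z L, normc z = rho / 2 ->
  (wnorm p (damp (-1))
    (fun x => U z x - \sum_(l < L.+1) (- z) ^+ l / l`!%:R * s l x)%R
   <= (Kn * 2 ^- L)%:E)%E.

Let r : R := rho / 2.
Let rC : R[i] := (r%:C)%C.
Let r0 : 0 < r. Proof. by rewrite divr_gt0. Qed.
Let normc_rC : normc rC = r. Proof. by rewrite normcR gtr0_norm. Qed.

Let damp0 c x : 0 <= damp c x. Proof. by rewrite mulr_ge0// expR_ge0. Qed.
Let mdamp c : measurable_fun setT (damp c).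
Proof.
apply: measurable_funM => //; apply: measurableT_comp => //.
apply: measurable_funM => //; apply: measurable_funM => //; apply: measurable_funM => //.
exact: measurable_normc.
Qed.

Let expR_powR (a : R) : expR (p * a) = expR a `^ p.
Proof. by rewrite -expRM mulrC. Qed.

Let F x := rC * (b x * s 0 x - s 1 x).
Let mF : cmeasurable F.
Proof.
apply: cmeasurableM; first exact: cmeasurable_cst.
by apply: cmeasurableB => //; exact: cmeasurableM.
Qed.

Let Q L z x : R[i] := \sum_(l < L.+1) (- z) ^+ l / l`!%:R * s l x.
Let mQ L z : cmeasurable (Q L z).
Proof.
apply: cmeasurable_sum => l; apply: cmeasurableM => //; exact: cmeasurable_cst.
Qed.

Let Q_le L z : normc z = r -> (wnorm p (damp (-1)) (Q L z) <= (2 * Kn)%:E)%E.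
Proof.
move=> zr; apply: (le_trans (wnorm_sum p1 _ (mdamp _) (damp0 _) _)).
  by move=> l; apply: cmeasurableM => //; exact: cmeasurable_cst.
apply: (@le_trans _ _ (\sum_(l < L.+1) (Kn * 2 ^- l)%:E)%E).
  apply: lee_sum => l _.
  apply: (@le_trans _ _ ((r ^+ l / l`!%:R)%:E * wnorm p (damp (-1)) (s l))%E).
    apply: wnorm_le => //.
    - by rewrite divr_ge0// exprn_ge0// ltW.
    - by apply: cmeasurableM => //; exact: cmeasurable_cst.
    - move=> x; rewrite mulrA ler_wpM2r// !Normc.normcM normcX normcN zr.
      have c0 : 0 <= r ^+ l / l`!%:R by rewrite divr_ge0// exprn_ge0// ltW.
      by rewrite Normc.normcV normc_nat (powRM _ c0 (normc_ge0 _)).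
  apply: (@le_trans _ _ ((r ^+ l / l`!%:R)%:E * (Kn * l`!%:R / rho ^+ l)%:E)%E).
    by rewrite lee_wpmul2l// lee_fin divr_ge0// exprn_ge0// ltW.
  rewrite -EFinM lee_fin le_eqVlt; apply/orP; left; apply/eqP.
  rewrite /r expr_div_n; field.
  by rewrite !expf_neq0 ?gt_eqF// pnatr_eq0 -lt0n fact_gt0.
rewrite sumEFin lee_fin -mulr_sumr mulrC ler_wpM2r//.
have -> : \sum_(l < L.+1) 2 ^- l = 2 - 2 ^- L :> R.
  elim: L => [|L IH]; first by rewrite big_ord1 expr0 invr1; ring.
  rewrite big_ord_recr/= IH exprS invfM; field.
  by rewrite expf_neq0.
by rewrite gerBl invr_ge0 exprn_ge0.
Qed.

(** For fixed [x], the product of the two Taylor polynomials in the variable [y], where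
    [z = r y], has degree at most [2L] and first coefficient
    [r (b(x) s_0(x) - s_1(x))], so that the average over the [(2L+1)]-th roots
    of unity gives this value without error. *)
Lemma first_coef_exact L (zeta : R[i]) x : (0 < L)%N ->
  (L.*2.+1).-primitive_root zeta ->
  F x = (L.*2.+1)%:R^-1 * \sum_(j < L.*2.+1) (zeta ^+ j)^-1 *
     ((exp_poly L (rC * zeta ^+ j * b x)).[1] * Q L (rC * zeta ^+ j) x).
Proof.
move=> L0 zN.
pose P := exp_poly L (rC * b x).
pose S : {poly R[i]} := \poly_(l < L.+1) ((- rC) ^+ l / l`!%:R * s l x).
have PE y : P.[y] = (exp_poly L (rC * y * b x)).[1].
  by rewrite !exp_polyE; apply: eq_bigr => l _; rewrite mulr1 mulrAC.
have SE y : S.[y] = Q L (rC * y) x.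
  rewrite /S horner_poly /Q; apply: eq_bigr => l _.
  by rewrite -mulNr exprMn; ring.
have sizePS : (size (P * S)%R <= L.*2.+1)%N.
  apply: (leq_trans (size_polyMleq P S)).
  have : (size P <= L.+1)%N by exact: size_poly.
  have : (size S <= L.+1)%N by exact: size_poly.
  by move: (size P) (size S) => u w; lia.
have NL : (1 < L.*2.+1)%N by rewrite ltnS double_gt0.
have := first_coef_filter zN NL sizePS.
under eq_bigr do rewrite hornerM PE SE.
move=> ->; rewrite mulKf ?pnatr_eq0//.
rewrite coefM 2!big_ord_recl big_ord0 /= !coef_poly/= !ltnS L0/= /bump/=.
by rewrite /F !expr1 !expr0 !fact0 !invr1; ring.
Qed.

(** The same average with the exponential and [U] in place of their Taylor
    polynomials. *)
Let average L (zeta : R[i]) x : R[i] := \sum_(j < L.*2.+1)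
  (L.*2.+1)%:R^-1 * (zeta ^+ j)^-1 *
    (cexp (rC * zeta ^+ j * b x) * U (rC * zeta ^+ j) x).

Section roots.
Variables (L : nat) (zeta : R[i]).
Hypothesis L0 : (0 < L)%N.
Hypothesis zN : (L.*2.+1).-primitive_root zeta.

Let z (j : nat) : R[i] := rC * zeta ^+ j.

Let normc_zeta j : normc (zeta ^+ j) = 1.
Proof.
by rewrite normcX (normc_unity_root _ (prim_expr_order zN))// expr1n.
Qed.

Let normc_z j : normc (z j) = r.
Proof. by rewrite Normc.normcM normc_zeta mulr1. Qed.

Let normc_w j : normc ((L.*2.+1)%:R^-1 * (zeta ^+ j)^-1) = (L.*2.+1)%:R^-1.
Proof. by rewrite Normc.normcM !Normc.normcV normc_zeta invr1 mulr1 normc_nat. Qed.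

Let mzb j : cmeasurable (fun x => z j * b x).
Proof. by apply: cmeasurableM => //; exact: cmeasurable_cst. Qed.

Let mterm j : cmeasurable (fun x => (L.*2.+1)%:R^-1 * (zeta ^+ j)^-1 *
    (cexp (z j * b x) * U (z j) x)).
Proof.
apply: cmeasurableM; first exact: cmeasurable_cst.
by apply: cmeasurableM; [exact: cmeasurable_cexp|exact: mU (normc_z j)].
Qed.

Let maverage : cmeasurable (average L zeta).
Proof. by apply: cmeasurable_sum => j; exact: mterm. Qed.

Let sum_avg (c : R) : (\sum_(j < L.*2.+1) ((L.*2.+1)%:R^-1 * c)%:E = c%:E)%E.
Proof.
by rewrite sumEFin sumr_const card_ord -[_ *+ _]mulr_natl mulVKf// pnatr_eq0.
Qed.

Let average_le : (wnorm p v (average L zeta) <= Kn%:E)%E.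
Proof.
apply: (le_trans (wnorm_sum p1 _ mv v0 _)); first by move=> j; exact: mterm.
rewrite -[leRHS]sum_avg; apply: lee_sum => j _.
apply: (@le_trans _ _ ((L.*2.+1)%:R^-1%:E *
   wnorm p (fun x => v x * expR (p * complex.Re (z j * b x)))%R (U (z j)))%E).
  apply: wnorm_le => //.
  - apply: measurable_funM => //; apply: measurableT_comp => //.
    by apply: measurable_funM => //; have [] := mzb j.
  - by move=> x; rewrite mulr_ge0// expR_ge0.
  - exact: mU (normc_z j).
  - move=> x; rewrite Normc.normcM normc_w Normc.normcM normc_cexp expR_powR.
    rewrite !powRM ?normc_ge0 ?mulr_ge0 ?expR_ge0 ?normc_ge0// ?invr_ge0//.
    by rewrite le_eqVlt; apply/orP; left; apply/eqP; ring.
by rewrite EFinM lee_wpmul2l ?lee_fin ?invr_ge0//; exact: U_le (normc_z j).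
Qed.

(** Replacing the two factors one after the other. *)
Let expand_error x : F x - average L zeta x =
  \sum_(j < L.*2.+1) ((L.*2.+1)%:R^-1 * (zeta ^+ j)^-1 *
    (((exp_poly L (z j * b x)).[1] - cexp (z j * b x)) * Q L (z j) x)) +
  \sum_(j < L.*2.+1) ((L.*2.+1)%:R^-1 * (zeta ^+ j)^-1 *
    (cexp (z j * b x) * (Q L (z j) x - U (z j) x))).
Proof.
rewrite (first_coef_exact x L0 zN) mulr_sumr /average -sumrB -big_split/=.
by apply: eq_bigr => j _; rewrite /z; ring.
Qed.

Let mpoly_exp j : cmeasurable (fun x => (exp_poly L (z j * b x)).[1]).
Proof.
under eq_fun do rewrite exp_polyE.
apply: cmeasurable_sum => k; apply: cmeasurableM; last exact: cmeasurable_cst.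
apply: cmeasurableX; apply: cmeasurableM => //; exact: cmeasurable_cst.
Qed.

Let normc_zb j x : normc (z j * b x) = r * normc (b x).
Proof. by rewrite Normc.normcM normc_z. Qed.

Let error_le : (wnorm p (damp (-2)) (fun x => F x - average L zeta x)%R <=
  (3 * Kn * 2 ^- L)%:E)%E.
Proof.
(* The radius is half of [rho] so that the remainder estimate of the exponential,
   which doubles the argument, produces exactly [e^(rho |b|)]. *)
have two x : 2 * (r * normc (b x)) = rho * normc (b x) by rewrite /r; field.
have N0 : (0 : R) <= (L.*2.+1)%:R^-1 by rewrite invr_ge0.
have L2 : (0 : R) <= 2 ^- L by rewrite invr_ge0 exprn_ge0.
under eq_fun do rewrite expand_error.
have m1 j : cmeasurable (fun x => (L.*2.+1)%:R^-1 * (zeta ^+ j)^-1 *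
    (((exp_poly L (z j * b x)).[1] - cexp (z j * b x)) * Q L (z j) x)).
  apply: cmeasurableM; first exact: cmeasurable_cst.
  by apply: cmeasurableM => //; apply: cmeasurableB => //; exact: cmeasurable_cexp.
have m2 j : cmeasurable (fun x => (L.*2.+1)%:R^-1 * (zeta ^+ j)^-1 *
    (cexp (z j * b x) * (Q L (z j) x - U (z j) x))).
  apply: cmeasurableM; first exact: cmeasurable_cst.
  apply: cmeasurableM; first exact: cmeasurable_cexp.
  by apply: cmeasurableB => //; exact: mU (normc_z j).
have -> : (3 * Kn * 2 ^- L)%:E = (((2 * Kn) * 2 ^- L)%:E + (Kn * 2 ^- L)%:E)%E.
  by rewrite -EFinD; congr EFin; ring.
apply: (le_trans (wnormD p1 (mdamp _) (damp0 _) _ _)).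
- by apply: cmeasurable_sum => j; exact: m1.
- by apply: cmeasurable_sum => j; exact: m2.
have damp2 x : damp (-2) x = damp (-1) x * expR (- (rho * normc (b x))) `^ p.
  by rewrite /damp -expR_powR -mulrA -expRD; congr (_ * expR _); ring.
apply: leeD.
  apply: (le_trans (wnorm_sum p1 _ (mdamp _) (damp0 _) _)); first by move=> j; exact: m1.
  rewrite -[leRHS]sum_avg; apply: lee_sum => j _.
  apply: (@le_trans _ _ (((L.*2.+1)%:R^-1 * 2 ^- L)%:E *
     wnorm p (damp (-1)) (Q L (z j)))%E).
    apply: wnorm_le => //.
    move=> x; rewrite damp2 Normc.normcM normc_w Normc.normcM.
    have E := normc_cexp_sub_exp_poly L (z j * b x).
    rewrite normc_zb two -normcN opprB in E.
    set q := normc (Q L (z j) x); set d := normc (_ - _) in E *.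
    rewrite [leLHS](_ : _ = ((L.*2.+1)%:R^-1 * (d * expR (- (rho * normc (b x)))) * q) `^ p
        * damp (-1) x); last first.
      rewrite mulrCA -powRM ?expR_ge0 ?mulr_ge0 ?normc_ge0//.
      by rewrite mulrC; congr (_ `^ _ * _); ring.
    rewrite mulrA; apply: ler_wpM2r => //.
    rewrite -powRM ?mulr_ge0 ?normc_ge0//.
    apply: (ge0_ler_powR (ltW p0)); rewrite ?nnegrE ?mulr_ge0 ?normc_ge0 ?expR_ge0//.
    rewrite ler_wpM2r ?normc_ge0// ler_wpM2l//.
    rewrite expRN ler_pdivrMr ?expR_gt0//.
  rewrite [X in (_ <= X%:E)%E](_ : _ = (L.*2.+1)%:R^-1 * 2 ^- L * (2 * Kn)); last by ring.
  rewrite [leRHS]EFinM lee_wpmul2l ?lee_fin ?mulr_ge0//; exact: Q_le (normc_z j).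
apply: (le_trans (wnorm_sum p1 _ (mdamp _) (damp0 _) _)); first by move=> j; exact: m2.
rewrite -[leRHS]sum_avg; apply: lee_sum => j _.
apply: (@le_trans _ _ ((L.*2.+1)%:R^-1%:E *
   wnorm p (damp (-1)) (fun x => U (z j) x - Q L (z j) x)%R)%E); last first.
  by rewrite [leRHS]EFinM lee_wpmul2l ?lee_fin//; exact: U_taylor (normc_z j).
apply: wnorm_le => //.
  by apply: cmeasurableB => //; exact: mU (normc_z j).
move=> x; rewrite damp2 Normc.normcM normc_w Normc.normcM normc_cexp.
rewrite -[normc (Q L _ _ - _)]normcN opprB.
set d := normc (_ - _).
rewrite [leLHS](_ : _ = ((L.*2.+1)%:R^-1 *
   (expR (complex.Re (z j * b x)) * expR (- (rho * normc (b x)))) * d) `^ p * damp (-1) x); last first.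
  rewrite mulrCA -powRM ?expR_ge0 ?mulr_ge0 ?normc_ge0 ?expR_ge0//.
  by rewrite mulrC; congr (_ `^ _ * _); ring.
rewrite mulrA; apply: ler_wpM2r => //.
rewrite -powRM ?normc_ge0//.
apply: (ge0_ler_powR (ltW p0)); rewrite ?nnegrE ?mulr_ge0 ?normc_ge0 ?expR_ge0//.
rewrite ler_wpM2r ?normc_ge0// ler_piMr// -expRD expR_le1 subr_le0.
apply: (le_trans (ler_norm _)); apply: (le_trans (Re_le_normc _)).
rewrite normc_zb ler_wpM2r ?normc_ge0// /r ler_pdivrMr// ler_peMr ?(ltW rho0)//.
by rewrite ler1n.
Qed.

(** Where [|b| <= M] the damped weight is comparable with [v], at the price of a factor
    that does not depend on [L]. *)
Lemma truncated_le M : (wnorm p v (trunc M F) <=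
  (Kn + expR (2 * (rho * M%:R)) * (3 * Kn * 2 ^- L))%:E)%E.
Proof.
have mE : cmeasurable (fun x => F x - average L zeta x) by exact: cmeasurableB.
have -> : trunc M F = fun x => trunc M (average L zeta) x +
    trunc M (fun y => F y - average L zeta y) x.
  by apply/funext => x; rewrite /trunc -mulrDr addrC subrK.
apply: (le_trans (wnormD p1 mv v0 (mtrunc M maverage) (mtrunc M mE))).
rewrite EFinD; apply: leeD.
  apply: le_trans average_le; rewrite -[leRHS]mul1e.
  apply: wnorm_le => //; first exact: mtrunc.
  move=> x; rewrite powR1 mul1r ler_wpM2r// normc_trunc.
  apply: (ge0_ler_powR (ltW p0)); rewrite ?nnegrE ?mulr_ge0 ?normc_ge0//.
  by rewrite ler_piMl ?normc_ge0// indicE lern1 leq_b1.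
apply: (@le_trans _ _ ((expR (2 * (rho * M%:R)))%:E *
    wnorm p (damp (-2)) (fun x => F x - average L zeta x)%R)%E); last first.
  by rewrite EFinM lee_wpmul2l ?lee_fin ?expR_ge0//; exact: error_le.
apply: wnorm_le => //; first exact: mtrunc.
move=> x; rewrite normc_trunc indicE.
set d := normc (_ - _).
have [xM|xM] := boolP (x \in sublevel M); last first.
  by rewrite mul0r powR0 ?gt_eqF// mul0r !mulr_ge0 ?powR_ge0.
have bM : normc (b x) <= M%:R by move: xM; rewrite inE.
rewrite mul1r mulrCA ler_wpM2l ?powR_ge0// /damp mulrCA ler_peMr// -expR_powR -expRD.
rewrite -[leLHS]expR0 ler_expR -mulrDr mulr_ge0// ?(ltW p0)// mulNr subr_ge0.
by rewrite ler_pM2l// ler_pM2l.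
Qed.

End roots.

(** First [L] tends to infinity for a fixed truncation level, then the truncation is
    removed. *)
Lemma contour_extraction :
  (wnorm p v (fun x => b x * s 0 x - s 1 x)%R <= (2 / rho * Kn)%:E)%E.
Proof.
have FK : (wnorm p v F <= Kn%:E)%E.
  apply: wnorm_truncation => // M; apply/lee_addgt0Pr => e e0.
  pose A := expR (2 * (rho * M%:R)) * (3 * Kn).
  have : A * 2^-1 ^+ L @[L --> \oo] --> A * 0.
    by apply: cvgMl_tmp; apply: cvg_expr; rewrite ger0_norm// invf_lt1// ltr1n.
  rewrite mulr0 => /cvgrPdist_le/(_ e e0)[L _ HL].
  have [zeta zN] := @primitive_root_exists R (L.+1.*2.+1) (ltn0Sn _).
  apply: (le_trans (truncated_le (ltn0Sn L) zN M)).
  rewrite -EFinD lee_fin lerD2l; have := HL L.+1 (leqnSn _).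
  rewrite /= sub0r normrN exprVn mulrA => /(le_trans _); apply.
  exact: ler_norm.
apply: (@le_trans _ _ ((2 / rho)%:E * wnorm p v F)%E).
  apply: wnorm_le => //.
  - by rewrite divr_ge0// ltW.
  - by apply: cmeasurableB => //; exact: cmeasurableM.
  - move=> x; rewrite mulrA; apply: ler_wpM2r => //.
    rewrite -powRM ?normc_ge0 ?divr_ge0 ?(ltW rho0)//.
    rewrite /F Normc.normcM normc_rC mulrA /r (_ : 2 / rho * (rho / 2) = 1) ?mul1r//.
    by field; rewrite gt_eqF.
by rewrite [leRHS]EFinM lee_wpmul2l// lee_fin divr_ge0// ltW.
Qed.

End contour_extraction.

(** * One commutator *)

Section commutator_step.
Context {R : realType} {n m : nat}.
Local Notation point := ('R[R]^n).
Local Notation mu := (@lebesgue_tuple R n).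
Local Notation normc := (@Normc.normc R).
Variables (p : R) (ps : 'I_m -> R).
Hypothesis ps1 : forall j, 1 < ps j.
Hypothesis psum : p^-1 = \sum_(j < m) (ps j)^-1.
Hypothesis p1 : 1 <= p.
Implicit Types (w lam nu : 'I_m -> point -> R) (f : 'I_m -> point -> R[i])
  (g h : point -> R[i]) (S : operator R n m) (B : R -> R).

Let psge1 j : 1 <= ps j. Proof. exact: ltW. Qed.
Let ps0 j : 0 < ps j. Proof. exact: lt_trans (ps1 j). Qed.
Let p0 : 0 < p. Proof. exact: lt_le_trans p1. Qed.

(** The property that is propagated from an operator to its commutators.  Since
    [A] ranges over all common upper bounds of the two characteristics, the
    two arguments of a bound are merged into one. *)
Definition controlled nu S B : Prop := forall (A : R) w lam,
  Bloom_pair p ps nu w lam ->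
  (Ap_sup p ps w <= A%:E)%E -> (Ap_sup p ps lam <= A%:E)%E ->
  multilinear_on ps w S /\ bound_on p ps w (nu_weight p ps lam) S (B A).

(** Convertible to the update notation in the definition of the commutator. *)
Definition upd f (beta : 'I_m) h : 'I_m -> point -> R[i] :=
  fun j => if j == beta then h else f j.

Lemma upd_same f beta h : upd f beta h beta = h.
Proof. by rewrite /upd eqxx. Qed.

Lemma upd_id f beta : upd f beta (f beta) = f.
Proof. by apply/funext => j; rewrite /upd; case: eqP => [->|]. Qed.

Lemma upd_upd f beta g h : upd (upd f beta g) beta h = upd f beta h.
Proof. by apply/funext => j; rewrite /upd; case: eqP. Qed.

Lemma upd_comm f i j g h : i != j -> upd (upd f i g) j h = upd (upd f j h) i g.
Proof.
move=> ij; apply/funext => l; rewrite /upd.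
by case: (eqVneq l j) => [->|//]; rewrite eq_sym (negbTE ij).
Qed.

Lemma in_Lps_upd w f beta h : in_Lps ps w f -> wLp (ps beta) (w beta) h ->
  in_Lps ps w (upd f beta h).
Proof. by move=> wf wh j; rewrite /upd; case: eqP => [->|_]. Qed.

Lemma wLp_lincomb (q : R) (v : point -> R) (c : R[i]) g h : 1 <= q ->
  measurable_fun setT v -> (forall x, 0 <= v x) ->
  wLp q v g -> wLp q v h -> wLp q v (fun y => c * g y + h y).
Proof.
move=> q1 mv v0 [mg gfin] [mh hfin].
have mcg : cmeasurable (fun y => c * g y).
  by apply: cmeasurableM => //; exact: cmeasurable_cst.
split; first exact: cmeasurableD.
apply: (le_lt_trans (wnormD q1 mv v0 mcg mh)); apply: lte_add_pinfty; last exact: hfin.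
apply: (@le_lt_trans _ _ ((normc c)%:E * wnorm q v g)%E).
  apply: wnorm_le => //; first exact: normc_ge0.
  by move=> x; rewrite Normc.normcM powRM ?normc_ge0// mulrA.
by apply: lte_mul_pinfty; [rewrite lee_fin normc_ge0| |exact: gfin].
Qed.

(** Finite linear combinations in one slot, starting from an arbitrary [h0] so that the
    induction needs no value of the operator at 0. *)
Lemma multilinear_sum w S f beta h0 (c : nat -> R[i]) (h : nat -> point -> R[i]) L :
  multilinear_on ps w S -> (forall j, weight (w j)) -> in_Lps ps w f ->
  wLp (ps beta) (w beta) h0 -> (forall l, wLp (ps beta) (w beta) (h l)) ->
  wLp (ps beta) (w beta) (fun y => h0 y + \sum_(l < L) c l * h l y) /\
  {ae mu, forall x, S (upd f beta (fun y => h0 y + \sum_(l < L) c l * h l y)) x =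
    S (upd f beta h0) x + \sum_(l < L) c l * S (upd f beta (h l)) x}.
Proof.
move=> mlS ww wf wh0 wh; elim: L => [|L [IHw IH]].
  have -> : (fun y => h0 y + \sum_(l < 0) c l * h l y) = h0.
    by apply/funext => y; rewrite big_ord0 addr0.
  by split => //; apply: aeW => x; rewrite big_ord0 addr0.
have -> : (fun y => h0 y + \sum_(l < L.+1) c l * h l y) =
    (fun y => c L * h L y + (h0 y + \sum_(l < L) c l * h l y)).
  by apply/funext => y; rewrite big_ord_recr/= addrA addrC.
split.
  have [mw w0] := ww beta.
  by apply: (wLp_lincomb _ (psge1 beta) mw _ (wh L) IHw) => x; exact: ltW.
have := mlS f beta (c L) _ _ wf (wh L) IHw.
apply: filterS2 IH => x IH ->; rewrite -/(upd _ _ _) IH.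
by rewrite big_ord_recr/= addrCA addrA [RHS]addrA addrAC.
Qed.

Lemma normc_lipschitz (z u : R[i]) : `|normc z - normc u| <= normc (z - u).
Proof.
have H (a b : R[i]) : normc a - normc b <= normc (a - b).
  by rewrite lerBlDr -[X in normc X <= _](subrK b); exact: le_normcD.
by rewrite ler_norml H lerNl opprB andbT -[leRHS]normcN opprB; exact: H.
Qed.

Lemma pow_le_expR (x : R) l : 0 <= x -> x ^+ l / l`!%:R <= expR x.
Proof.
move=> x0; apply: le_trans (exp_poly_le_expR l x0).
rewrite exp_polyE big_ord_recr/= mulr1 lerDr.
by apply: sumr_ge0 => k _; rewrite divr_ge0// exprn_ge0// mulr1.
Qed.

Variables (delta Gam : R -> R).
Hypothesis delta0 : forall A, 0 < delta A.
Hypothesis perturb_stable : forall A w beta (g : point -> R) (c : point -> R -> R),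
  Ap p ps w -> (Ap_sup p ps w <= A%:E)%E ->
  measurable_fun setT g -> oscillates g c (delta A) ->
  Ap p ps (perturb ps beta g w) /\ (Ap_sup p ps (perturb ps beta g w) <= (Gam A)%:E)%E.

Section one_symbol.
Variables (nu : 'I_m -> point -> R) (S : operator R n m) (B : R -> R).
Variables (t : R) (b : point -> R[i]) (cb : point -> R -> R[i]) (beta : 'I_m).
Hypothesis t0 : 0 < t.
Hypothesis mb : cmeasurable b.
Hypothesis osc_b : forall a l, 0 < l ->
  (\int[mu]_(x in cube a l) (normc (b x - cb a l))%:E <= t%:E * mu (cube a l))%E.
Hypothesis controlS : controlled nu S B.

Section one_pair.
Variables (A : R) (w lam : 'I_m -> point -> R).
Hypothesis pair : Bloom_pair p ps nu w lam.
Hypothesis wA : (Ap_sup p ps w <= A%:E)%E.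
Hypothesis lamA : (Ap_sup p ps lam <= A%:E)%E.
Let rho := delta A / t.
Let rho0 : 0 < rho. Proof. by rewrite divr_gt0. Qed.

Let ww j : weight (w j). Proof. by have [[]] := pair. Qed.
Let lamw j : weight (lam j). Proof. by have [_ []] := pair. Qed.
Let mw j : measurable_fun setT (w j). Proof. by have [] := ww j. Qed.
Let w_gt0 j x : 0 < w j x. Proof. by have [_] := ww j; exact. Qed.
Let v := nu_weight p ps lam.
Let mv : measurable_fun setT v.
Proof. by apply: measurable_nu_weight => j; have [] := lamw j. Qed.
Let lam_gt0 j x : 0 < lam j x. Proof. by have [_] := lamw j; exact. Qed.
Let v0 x : 0 <= v x. Proof. by apply/ltW/nu_weight_gt0. Qed.

Section one_tilt.
Variable phi : R[i] -> R.
Hypothesis phi_lip : forall z u, `|phi z - phi u| <= rho * normc (z - u).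
Hypothesis mphi : measurable_fun setT (fun x => phi (b x)).
Let wphi := perturb ps beta (fun x => phi (b x)) w.
Let lamphi := perturb ps beta (fun x => phi (b x)) lam.

Let osc_phi : oscillates (fun x => phi (b x)) (fun a l => phi (cb a l)) (delta A).
Proof.
move=> a l l0; apply: (@le_trans _ _ (\int[mu]_(x in cube a l)
    (rho%:E * (normc (b x - cb a l))%:E))%E).
  apply: ge0_le_integral => //.
  - exact: measurable_cube.
  - apply: measurable_funTS; apply/measurable_EFinP; apply: measurableT_comp => //.
    exact: measurable_funB.
  - apply: measurable_funTS; apply: emeasurable_funM => //; apply/measurable_EFinP.
    by apply: measurable_normc; apply: cmeasurableB => //; exact: cmeasurable_cst.
  - by move=> x _; rewrite -EFinM lee_fin.
rewrite ge0_integralZl//.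
- have -> : (delta A)%:E = (rho%:E * t%:E)%E by rewrite -EFinM /rho divfK// gt_eqF.
  by rewrite -muleA lee_pmul2l ?lte_fin//; exact: osc_b.
- exact: measurable_cube.
- apply: measurable_funTS; apply/measurable_EFinP.
  by apply: measurable_normc; apply: cmeasurableB => //; exact: cmeasurable_cst.
- by move=> x _; rewrite lee_fin normc_ge0.
- by rewrite lee_fin ltW.
Qed.

(** The hypothesis on the operator, transported to the weights multiplied by
    [e^(p_beta phi(b))]: their quotient is unchanged, and the oscillation of
    [phi(b)] is small since [phi] is [rho]-Lipschitz. *)
Lemma tilted_control : (forall j, weight (wphi j)) /\ multilinear_on ps wphi S /\
  bound_on p ps wphi (fun x => v x * expR (p * phi (b x))) S (B (Gam A)).
Proof.
have [Apw Aplam ratio] := pair.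
have [Apw' wG] := perturb_stable beta Apw wA mphi osc_phi.
have [Aplam' lamG] := perturb_stable beta Aplam lamA mphi osc_phi.
have pair' : Bloom_pair p ps nu wphi lamphi.
  split; [exact: Apw'|exact: Aplam'|move=> j x].
  rewrite /wphi /lamphi /perturb -ratio invfM.
  by rewrite mulrACA divff ?mulr1// gt_eqF// expR_gt0.
have [ml bd] := controlS pair' wG lamG.
split; first by have [] := Apw'.
split; first exact: ml.
rewrite (_ : (fun x => _) = nu_weight p ps lamphi); first exact: bd.
by apply/funext => x; rewrite nu_weight_perturb.
Qed.

Lemma wphi_other j : j != beta -> wphi j = w j.
Proof.
by move=> /negbTE jb; apply/funext => x; rewrite /wphi /perturb jb !mul0r expR0 mulr1.
Qed.

Lemma wnorm_tilted (kappa : R) g h : 0 <= kappa -> cmeasurable g -> cmeasurable h ->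
  (forall x, normc (h x) * expR (phi (b x)) <= kappa * normc (g x)) ->
  (wnorm (ps beta) (wphi beta) h <= kappa%:E * wnorm (ps beta) (w beta) g)%E.
Proof.
move=> k0 mg mh hg.
have [ww' _] := tilted_control; have [mwphi wphi0] := ww' beta.
apply: wnorm_le => //; first by move=> x; exact: ltW.
  by move=> x; exact: ltW.
move=> x; rewrite /wphi /perturb eqxx mul1r mulrCA [leRHS]mulrA [leRHS]mulrC.
apply: ler_wpM2l; first exact: ltW.
rewrite [ps beta * _]mulrC expRM -!powRM ?normc_ge0 ?expR_ge0//.
by apply: (ge0_ler_powR (ltW (ps0 beta))); rewrite ?nnegrE ?mulr_ge0 ?normc_ge0 ?expR_ge0.
Qed.

Variable f : 'I_m -> point -> R[i].
Hypothesis wf : in_Lps ps w f.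

(** A function [h] with [|h| e^(phi(b)) <= kappa |f_beta|] may replace [f_beta], at the
    cost of the factor [kappa]. *)
Lemma tilted_bound (kappa : R) h : 0 <= kappa -> cmeasurable h ->
  (forall x, normc (h x) * expR (phi (b x)) <= kappa * normc (f beta x)) ->
  [/\ in_Lps ps wphi (upd f beta h), cmeasurable (S (upd f beta h)) &
  (wnorm p (fun x => v x * expR (p * phi (b x)))%R (S (upd f beta h)) <=
   (B (Gam A) * fine (\prod_(j < m) wnorm (ps j) (w j) (f j)) * kappa)%:E)%E].
Proof.
move=> k0 mh hf.
have [mf ffin] := wf beta.
have hle := wnorm_tilted k0 mf mh hf.
have wfin j : (wnorm (ps j) (w j) (f j) \is a fin_num)%E.
  by rewrite ge0_fin_numE ?wnorm_ge0//; have [] := wf j.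
have hin : in_Lps ps wphi (upd f beta h).
  move=> j; rewrite /upd; case: eqP => [->|/eqP jb].
    split => //; apply: (le_lt_trans hle).
    by rewrite lte_mul_pinfty// lee_fin.
  by rewrite wphi_other//; exact: wf.
have [_ [_ [BG0 /(_ _ hin)[[mSh _] Sle]]]] := tilted_control.
split => //; apply: (le_trans Sle).
rewrite -mulrA EFinM lee_wpmul2l ?lee_fin//.
have Nfin : (\prod_(j < m) wnorm (ps j) (w j) (f j) \is a fin_num)%E.
  by elim/big_ind: _ => // x y; exact: fin_numM.
rewrite mulrC EFinM fineK// (bigD1 beta)//= [in leRHS](bigD1 beta)//=.
rewrite muleA upd_same; apply: lee_pmul => //.
- exact: wnorm_ge0.
- by apply: prode_ge0 => j _; exact: wnorm_ge0.
rewrite le_eqVlt; apply/orP; left; apply/eqP; apply: eq_bigr => j jb.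
by rewrite wphi_other; [rewrite /upd (negbTE jb)|exact: jb].
Qed.

End one_tilt.

(** The damping [e^(-rho |b|)] gives the space that contains all [b^l f_beta]. *)
Let phiV (z : R[i]) : R := -1 * (rho * normc z).
Let phiV_lip z u : `|phiV z - phiV u| <= rho * normc (z - u).
Proof.
rewrite /phiV -mulrBr mulN1r normrN -mulrBr normrM (gtr0_norm rho0).
by rewrite ler_wpM2l ?(ltW rho0)// normc_lipschitz.
Qed.
Let mphiV : measurable_fun setT (fun x => phiV (b x)).
Proof.
by apply: measurable_funM => //; apply: measurable_funM => //; exact: measurable_normc.
Qed.
Let wV := perturb ps beta (fun x => phiV (b x)) w.

Let pow_V l x : normc (b x ^+ l) * expR (phiV (b x)) <= l`!%:R / rho ^+ l.
Proof.
have rb0 : 0 <= rho * normc (b x) by rewrite mulr_ge0 ?(ltW rho0)// normc_ge0.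
rewrite /phiV mulN1r expRN ler_pdivrMr ?expR_gt0// normcX.
have := pow_le_expR l rb0.
rewrite ler_pdivrMr ?ltr0n ?fact_gt0// exprMn => H.
rewrite -(ler_pM2l (exprn_gt0 l rho0)); apply: (le_trans H).
rewrite le_eqVlt; apply/orP; left; apply/eqP; field.
by rewrite expf_neq0// gt_eqF.
Qed.

Let wLpV_pow j l h : wLp (ps j) (w j) h -> j = beta ->
  wLp (ps j) (wV j) (fun y => b y ^+ l * h y).
Proof.
move=> [mh hfin] jb; rewrite jb in hfin *.
have k0 : 0 <= l`!%:R / rho ^+ l by rewrite divr_ge0// exprn_ge0// ltW.
have mbh : cmeasurable (fun y => b y ^+ l * h y).
  by apply: cmeasurableM => //; exact: cmeasurableX.
split => //; apply: (@le_lt_trans _ _ ((l`!%:R / rho ^+ l)%:E * wnorm (ps beta) (w beta) h)%E).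
  apply: (wnorm_tilted phiV_lip mphiV k0 mh mbh) => x.
  by rewrite Normc.normcM mulrAC ler_wpM2r ?normc_ge0.
by rewrite lte_mul_pinfty// ge0_fin_numE ?wnorm_ge0.
Qed.

Let wLpV j h : wLp (ps j) (w j) h -> wLp (ps j) (wV j) h.
Proof.
move=> wh; have [jb|jb] := eqVneq j beta; last by rewrite /wV wphi_other.
have := wLpV_pow 0 wh jb.
by under eq_fun do rewrite expr0 mul1r.
Qed.

(** The functions [b g] leave the space with weight [w], but not the damped one, where
    the operator is multilinear as well. *)
Lemma commutator_multilinear : multilinear_on ps w (commutator b beta S).
Proof.
have [_ [ml _]] := tilted_control phiV_lip mphiV.
move=> f j c g h wf wg wh.
have wfV : in_Lps ps wV f by move=> i; apply: wLpV; exact: wf.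
have ml0 := ml f j c g h wfV (wLpV wg) (wLpV wh).
have bV u : wLp (ps beta) (w beta) u -> wLp (ps beta) (wV beta) (fun y => b y * u y).
  by move=> wu; have := wLpV_pow 1 wu erefl; under eq_fun do rewrite expr1.
have comE u x : commutator b beta S (upd f j u) x = b x * S (upd f j u) x -
    S (upd (upd f j u) beta (fun y => b y * upd f j u beta y)) x by [].
have [jb|jb] := eqVneq j beta.
  rewrite jb in wg wh ml0 comE *.
  have ml1 := ml f beta c _ _ wfV (bV _ wg) (bV _ wh).
  apply: filterS2 ml0 ml1 => x; rewrite -!/(upd _ _ _) => e0 e1.
  rewrite !comE !upd_upd !upd_same e0.
  have -> : (fun y => b y * (c * g y + h y)) = (fun y => c * (b y * g y) + b y * h y).
    by apply/funext => y; ring.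
  by rewrite e1; ring.
have wfb : in_Lps ps wV (upd f beta (fun y => b y * f beta y)).
  by apply: in_Lps_upd => //; apply: bV; exact: wf.
have ml1 := ml _ j c g h wfb (wLpV wg) (wLpV wh).
apply: filterS2 ml0 ml1 => x; rewrite -!/(upd _ _ _) => e0 e1.
have ub u : upd f j u beta = f beta by rewrite /upd eq_sym (negbTE jb).
by rewrite !comE !ub !(upd_comm _ _ _ jb) e0 e1; ring.
Qed.

(** The hypotheses of the extraction principle: the powers [b^l f_beta] and the
    remainders are estimated in the damped space, the functions
    [e^(-zb) f_beta] in the space tilted by [e^(Re zb)], where their norm does
    not exceed that of [f_beta]. *)
Lemma commutator_bound : bound_on p ps w v (commutator b beta S) (2 / rho * B (Gam A)).
Proof.
have [wwV [mlV [BG0 _]]] := tilted_control phiV_lip mphiV.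
split; first by rewrite mulr_ge0// divr_ge0// ltW.
move=> f wf.
set Nf := (\prod_(j < m) wnorm (ps j) (w j) (f j))%E.
have Nfin : Nf \is a fin_num.
  rewrite /Nf; elim/big_ind: _ => // [x y|j _]; first exact: fin_numM.
  by rewrite ge0_fin_numE ?wnorm_ge0//; have [] := wf j.
have N0 : (0 <= Nf)%E by apply: prode_ge0 => j _; exact: wnorm_ge0.
pose Kn := B (Gam A) * fine Nf.
have Kn0 : 0 <= Kn by rewrite mulr_ge0// fine_ge0.
have [mf _] := wf beta.
pose pw l y := b y ^+ l * f beta y.
pose ex z y := cexp (- (z * b y)) * f beta y.
have mpw l : cmeasurable (pw l) by apply: cmeasurableM => //; exact: cmeasurableX.
have mzb z : cmeasurable (fun y => z * b y).
  by apply: cmeasurableM => //; exact: cmeasurable_cst.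
have mex z : cmeasurable (ex z).
  by apply: cmeasurableM => //; apply: cmeasurable_cexp; exact: cmeasurableN.
have k0 l : 0 <= l`!%:R / rho ^+ l by rewrite divr_ge0// exprn_ge0// ltW.
have pw_tilt l x : normc (pw l x) * expR (phiV (b x)) <=
    l`!%:R / rho ^+ l * normc (f beta x).
  by rewrite Normc.normcM mulrAC ler_wpM2r ?normc_ge0.
have spec l := tilted_bound phiV_lip mphiV wf (k0 l) (mpw l) (pw_tilt l).
have phiZ_lip z : normc z = rho / 2 -> forall y u : R[i],
    `|complex.Re (z * y) - complex.Re (z * u)| <= rho * normc (y - u).
  move=> zr y u; have -> : complex.Re (z * y) - complex.Re (z * u) = complex.Re (z * (y - u)).
    by case: z y u {zr} => [? ?] [? ?] [? ?] /=; ring.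
  apply: (le_trans (Re_le_normc _)); rewrite Normc.normcM zr.
  by rewrite ler_wpM2r ?normc_ge0// ler_pdivrMr// ler_peMr ?(ltW rho0)// ler1n.
have mphiZ z : measurable_fun setT (fun x => complex.Re (z * b x)).
  by have [] := mzb z.
have ex_tilt z x : normc (ex z x) * expR (complex.Re (z * b x)) <= 1 * normc (f beta x).
  rewrite Normc.normcM normc_cexp mulrAC -expRD.
  rewrite (_ : complex.Re (- (z * b x)) = - complex.Re (z * b x)); last by case: (z * b x).
  by rewrite addNr expR0.
have specZ z (zr : normc z = rho / 2) :=
  tilted_bound (phiZ_lip z zr) (mphiZ z) wf ler01 (mex z) (ex_tilt z).
have main : (wnorm p v (fun x => (b x * S (upd f beta (pw 0)) x -
    S (upd f beta (pw 1)) x)%R) <= (2 / rho * Kn)%:E)%E.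
  apply: (@contour_extraction R n p v b p1 mv v0 mb rho Kn
    (fun l => S (upd f beta (pw l))) (fun z => S (upd f beta (ex z)))) => //.
  - by move=> l; have [] := spec l.
  - move=> l; have [_ _] := spec l; rewrite -/Nf -/Kn mulrA; exact.
  - by move=> z zr; have [] := specZ z zr.
  - by move=> z zr; have [_ _] := specZ z zr; rewrite mulr1.
  - move=> z L zr.
    pose rem y := (cexp (- (z * b y)) - (exp_poly L (- (z * b y))).[1]) * f beta y.
    have mrem : cmeasurable rem.
      apply: cmeasurableM => //; apply: cmeasurableB.
        by apply: cmeasurable_cexp; exact: cmeasurableN.
      under eq_fun do rewrite exp_polyE.
      apply: cmeasurable_sum => k; apply: cmeasurableM; last exact: cmeasurable_cst.
      apply: cmeasurableX; apply: cmeasurableM; last exact: cmeasurable_cst.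
      exact: cmeasurableN.
    have remE : rem = fun y => ex z y + \sum_(l < L.+1) (- ((- z) ^+ l / l`!%:R)) * pw l y.
      apply/funext => y; rewrite /rem mulrBl; congr (_ + _).
      rewrite exp_polyE -mulNr -sumrN mulr_suml; apply: eq_bigr => l _.
      rewrite mulr1 (_ : - (z * b y) = - z * b y); last by rewrite mulNr.
      by rewrite exprMn /pw; ring.
    have rem_tilt x : normc (rem x) * expR (phiV (b x)) <= 2 ^- L * normc (f beta x).
      rewrite Normc.normcM mulrAC ler_wpM2r ?normc_ge0//.
      have := normc_cexp_sub_exp_poly L (- (z * b x)).
      rewrite normcN Normc.normcM zr mulrA mulrCA divff// mulr1.
      rewrite /phiV mulN1r expRN ler_pdivrMr ?expR_gt0//; exact.
    have L2 : (0 : R) <= 2 ^- L by rewrite invr_ge0 exprn_ge0.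
    have [remV mSrem remle] := tilted_bound phiV_lip mphiV wf L2 mrem rem_tilt.
    have ex_tiltV x : normc (ex z x) * expR (phiV (b x)) <= 1 * normc (f beta x).
      rewrite Normc.normcM normc_cexp mulrAC -expRD ler_wpM2r ?normc_ge0// expR_le1.
      rewrite /phiV mulN1r subr_le0; apply: (le_trans (ler_norm _)).
      apply: (le_trans (Re_le_normc _)); rewrite normcN Normc.normcM zr.
      rewrite mulrAC ler_pdivrMr// ler_peMr ?ler1n// mulr_ge0 ?(ltW rho0)//.
      exact: normc_ge0.
    have [exV mSex _] := tilted_bound phiV_lip mphiV wf ler01 (mex z) ex_tiltV.
    have wex : wLp (ps beta) (wV beta) (ex z) by have := exV beta; rewrite upd_same.
    have wpw l : wLp (ps beta) (wV beta) (pw l).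
      by have [+ _ _] := spec l => /(_ beta); rewrite upd_same.
    have wfV : in_Lps ps wV f by move=> j; apply: wLpV; exact: wf.
    have [_ lin] := multilinear_sum (fun l => - ((- z) ^+ l / l`!%:R)) L.+1
      mlV wwV wfV wex wpw.
    apply: le_trans remle; rewrite le_eqVlt; apply/orP; left; apply/eqP.
    apply: wnorm_ae.
    + apply: measurable_funM; first exact: mv.
      by apply: measurableT_comp => //; apply: measurable_funM.
    + by move=> x; rewrite mulr_ge0// expR_ge0.
    + apply: cmeasurableB; first by have [] := specZ z zr.
      apply: cmeasurable_sum => l; apply: cmeasurableM; first exact: cmeasurable_cst.
      by have [] := spec l.
    + exact: mSrem.
    + apply: filterS lin => x; rewrite -remE => ->.
      by congr (_ + _); rewrite -sumrN; apply: eq_bigr => l _; rewrite mulNr.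
have mF : cmeasurable (commutator b beta S f).
  have [_ m0 _] := spec 0; have [_ m1 _] := spec 1.
  have pw0 : upd f beta (pw 0) = f.
    rewrite -[RHS](upd_id f beta); congr upd; apply/funext => y.
    by rewrite /pw expr0 mul1r.
  rewrite pw0 in m0; apply: cmeasurableB; first exact: cmeasurableM.
  have pw1 : pw 1 = (fun y => b y * f beta y).
    by apply/funext => y; rewrite /pw expr1.
  by rewrite pw1 in m1; exact: m1.
have FE : commutator b beta S f = fun x => b x * S (upd f beta (pw 0)) x -
    S (upd f beta (pw 1)) x.
  apply/funext => x; rewrite /commutator.
  have -> : upd f beta (pw 0) = f.
    rewrite -[RHS](upd_id f beta); congr upd; apply/funext => y.
    by rewrite /pw expr0 mul1r.
  by congr (_ - S _ x); apply/funext => j; rewrite /upd /=; case: eqP => // _;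
    apply/funext => y; rewrite /pw expr1.
have Fle : (wnorm p v (commutator b beta S f) <= (2 / rho * B (Gam A))%:E * Nf)%E.
  rewrite FE; apply: (le_trans main).
  by rewrite -(fineK Nfin) -EFinM /Kn mulrA.
split; last exact: Fle.
split; first exact: mF.
apply: (le_lt_trans Fle); rewrite -(fineK Nfin) -EFinM; exact: ltry.
Qed.

End one_pair.

Lemma commutator_controlled :
  controlled nu (commutator b beta S) (fun A => t * (2 / delta A * B (Gam A))).
Proof.
move=> A w lam pair wA lamA; split; first exact: commutator_multilinear pair wA lamA.
rewrite (_ : t * _ = 2 / (delta A / t) * B (Gam A)).
  exact: commutator_bound pair wA lamA.
by field; rewrite !gt_eqF.
Qed.

End one_symbol.
End commutator_step.

(** * Iterated commutators *)

Section iterated_commutators.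
Context {R : realType} {n m : nat}.
Local Notation point := ('R[R]^n).
Local Notation mu := (@lebesgue_tuple R n).
Local Notation normc := (@Normc.normc R).

Definition bmo_center (b : point -> R[i]) (a : point) (l : R) : R[i] :=
  cavg (cube a l) b.

Lemma bmo_norm_ge0 (b : point -> R[i]) : (0 <= bmo_norm b)%E.
Proof.
pose Q := cube ([tuple 0 | i < n] : point) (1 : R).
apply: (@le_trans _ _ (avg Q (fun x => normc (b x - cavg Q b)))).
  rewrite avg_cubeE// mule_ge0 ?lee_fin ?invr_ge0 ?exprn_ge0//.
  by apply: integral_ge0 => x _; rewrite lee_fin normc_ge0.
apply: ereal_sup_ubound; exists Q => //.
by exists [tuple 0 | i < n], 1.
Qed.

Lemma bmo_oscillation (b : point -> R[i]) (t : R) (a : point) (l : R) :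
  (bmo_norm b <= t%:E)%E -> 0 < l ->
  (\int[mu]_(x in cube a l) (normc (b x - bmo_center b a l))%:E <=
   t%:E * mu (cube a l))%E.
Proof.
move=> bt l0; have ln0 : 0 < l ^+ n by rewrite exprn_gt0.
have : (avg (cube a l) (fun x => normc (b x - bmo_center b a l)%R) <= t%:E)%E.
  by apply: le_trans bt; apply: ereal_sup_ubound; exists (cube a l) => //; exists a, l.
rewrite avg_cubeE// lebesgue_cube// lee_pdivrMl// => /le_trans; apply.
by rewrite muleC.
Qed.

Variables (p : R) (ps : 'I_m -> R).
(** [step] maps the bound of an operator to the bound of its commutator with a symbol
    of norm at most 1. *)
Variables (nu : 'I_m -> point -> R) (step : (R -> R) -> R -> R).
Hypothesis step_linear : forall c B A, step (fun A => c * B A) A = c * step B A.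
Hypothesis step_controlled : forall S B b beta (t : R), 0 < t ->
  BMO b -> (bmo_norm b <= t%:E)%E -> controlled p ps nu S B ->
  controlled p ps nu (commutator b beta S) (fun A => t * step B A).

Lemma slot_controlled (j : 'I_m) (k : nat) (b : 'I_k -> point -> R[i])
    (t : 'I_k -> R) (r : seq 'I_k) S B c :
  (forall i, 0 < t i) -> (forall i, BMO (b i)) ->
  (forall i, bmo_norm (b i) <= (t i)%:E)%E ->
  controlled p ps nu S (fun A => c * B A) ->
  controlled p ps nu (foldl (fun S' i => commutator (b i) j S') S r)
    (fun A => (c * \prod_(i <- r) t i) * iter (size r) step B A).
Proof.
move=> t0 bB bt; elim: r S B c => [|i r IH] S B c ctl /=.
  by rewrite big_nil mulr1.
have ctl' : controlled p ps nu (commutator (b i) j S) (fun A => (c * t i) * step B A).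
  rewrite (_ : (fun A => _) = (fun A => t i * step (fun A => c * B A) A)); last first.
    by apply/funext => A; rewrite step_linear mulrA (mulrC c).
  exact: step_controlled.
have := IH _ _ _ ctl'; rewrite big_cons mulrA.
by rewrite -iterSr.
Qed.

Lemma higher_controlled (k : 'I_m -> nat) (b : forall j, 'I_(k j) -> point -> R[i])
    (t : forall j, 'I_(k j) -> R) S B :
  (forall j i, 0 < t j i) -> (forall j i, BMO (b j i)) ->
  (forall j i, bmo_norm (b j i) <= (t j i)%:E)%E ->
  controlled p ps nu S B ->
  controlled p ps nu (higher_commutator b S)
    (fun A => (\prod_j \prod_i t j i) * iter (\sum_j k j) step B A).
Proof.
move=> t0 bB bt ctl; rewrite /higher_commutator.
have sumE : (\sum_j k j = \sum_(j <- enum 'I_m) k j)%N by rewrite big_enum.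
have prodE : \prod_j \prod_i t j i = 1 * \prod_(j <- enum 'I_m) \prod_i t j i.
  by rewrite mul1r big_enum.
rewrite sumE prodE.
have slots (r : seq 'I_m) S' B' c : controlled p ps nu S' (fun A => c * B' A) ->
    controlled p ps nu (foldl (fun S' j =>
        foldl (fun S'' i => commutator (b j i) j S'') S' (enum 'I_(k j))) S' r)
      (fun A => (c * \prod_(j <- r) \prod_i t j i) *
                iter (\sum_(j <- r) k j) step B' A).
  elim: r S' B' c => [|j r IH] S' B' c ctl' /=.
    by rewrite !big_nil mulr1.
  have := slot_controlled j (enum 'I_(k j)) (t0 j) (bB j) (bt j) ctl'.
  move=> /IH; rewrite !big_cons size_enum_ord big_enum/= mulrA.
  by rewrite addnC iterD.
by apply: slots; under eq_fun do rewrite mul1r.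
Qed.

End iterated_commutators.

Theorem theorem2 (R : realType) (n m : nat) (p : R) (ps : 'I_m -> R)
    (k : 'I_m -> nat) (T : operator R n m) (C : R -> R -> R) :
  (0 < n)%N ->
  (forall j, 1 < ps j) ->
  p^-1 = \sum_(j < m) (ps j)^-1 ->
  1 <= p ->
  increasing2 C ->
  exists C' : R -> R -> R,
  forall nu : 'I_m -> 'R[R]^n -> R,
    (forall j, weight (nu j)) ->
    (forall mu lam : 'I_m -> 'R[R]^n -> R,
       Bloom_pair p ps nu mu lam ->
       multilinear_on ps mu T /\
       (opnorm p ps mu (nu_weight p ps lam) T <=
        (C (fine (Ap_const p ps mu)) (fine (Ap_const p ps lam)))%:E)%E) ->
    forall b : forall j : 'I_m, 'I_(k j) -> 'R[R]^n -> R[i],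
      (forall j i, BMO (b j i)) ->
      forall mu lam : 'I_m -> 'R[R]^n -> R,
        Bloom_pair p ps nu mu lam ->
        (opnorm p ps mu (nu_weight p ps lam) (higher_commutator b T) <=
         (C' (fine (Ap_const p ps mu)) (fine (Ap_const p ps lam)))%:E *
         \prod_(j < m) \prod_(i < k j) bmo_norm (b j i))%E.
Proof.
move=> _ ps1 psum p1 incC.
have p0 : 0 < p by exact: lt_le_trans p1.
have ex (A : R) : exists dG : R * R, 0 < dG.1 /\ forall w beta g c,
    Ap p ps w -> (Ap_sup p ps w <= A%:E)%E -> measurable_fun setT g ->
    oscillates g c dG.1 ->
    Ap p ps (perturb (n := n) ps beta g w) /\
    (Ap_sup p ps (perturb ps beta g w) <= (dG.2)%:E)%E.
  by have [d [G H]] := @Ap_perturb R n m p ps ps1 psum p1 A; exists (d, G).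
have [dG HdG] := choice ex.
pose step (B : R -> R) A := 2 / (dG A).1 * B (dG A).2.
(* The operator norm is an infimum: adding 1 yields a constant that is attained. *)
pose B0 (A : R) := C (A `^ p) (A `^ p) + 1.
pose K A := iter (\sum_j k j)%N step B0 A.
exists (fun x y => K (Num.max (x `^ p^-1) (y `^ p^-1))).
move=> nu _ HT b bB mu lam pair.
have sup_fin (w : 'I_m -> 'R[R]^n -> R) : Ap p ps w -> (Ap_sup p ps w \is a fin_num)%E /\ 0 <= fine (Ap_sup p ps w).
  move=> [_ wfin].
  have sup0 : (0 <= Ap_sup p ps w)%E.
    pose Q := cube ([tuple 0 | i < n] : 'R[R]^n) (1 : R).
    apply: (@le_trans _ _ (avg Q (nu_weight p ps w) `^ p^-1 *
      \prod_(j < m) avg Q (fun x => w j x `^ (1 - conj_exp (ps j)))%R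
        `^ (conj_exp (ps j))^-1)%E).
      apply: mule_ge0; first exact: poweR_ge0.
      by apply: prode_ge0 => j _; exact: poweR_ge0.
    by apply: ereal_sup_ubound; exists Q => //; exists [tuple 0 | i < n], 1.
  by rewrite ge0_fin_numE// wfin fine_ge0.
have constE (w : 'I_m -> 'R[R]^n -> R) : fine (Ap_const p ps w) = fine (Ap_sup p ps w) `^ p.
  by rewrite /Ap_const fine_poweR.
have ctlT : controlled p ps nu T B0.
  move=> A w la pr wA laA; have [ml le] := HT w la pr; split; first exact: ml.
  have [Apw Apla _] := pr.
  have [wf w0] := sup_fin _ Apw; have [lf l0] := sup_fin _ Apla.
  have bnd : (opnorm p ps w (nu_weight p ps la) T < (B0 A)%:E)%E.
    apply: (le_lt_trans le); rewrite lte_fin /B0.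
    apply: (@le_lt_trans _ _ (C (A `^ p) (A `^ p))); last by rewrite ltrDl.
    have mono (a : \bar R) : (a \is a fin_num)%E -> 0 <= fine a -> (a <= A%:E)%E ->
        0 <= fine a `^ p <= A `^ p.
      move=> af a0 aA; rewrite powR_ge0/=.
      have fA : fine a <= A by rewrite -lee_fin fineK.
      by apply: (ge0_ler_powR (ltW p0)); rewrite ?nnegrE// (le_trans a0).
    by apply: incC; rewrite constE; exact: mono.
  have [_ [K1 [K0 HK] <-] K1B] := ereal_inf_lt bnd.
  rewrite lte_fin in K1B; split; first exact: le_trans K0 (ltW K1B).
  move=> f wf'; have [h1 h2] := HK f wf'; split; first exact: h1.
  apply: (le_trans h2).
  apply: lee_wpmul2r; last by rewrite lee_fin ltW.
  by apply: prode_ge0 => j _; exact: poweR_ge0.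
have stepL c B A : step (fun A => c * B A) A = c * step B A.
  by rewrite /step mulrCA.
have stepC S B b' beta (t : R) : 0 < t -> BMO b' -> (bmo_norm b' <= t%:E)%E ->
    controlled p ps nu S B ->
    controlled p ps nu (commutator b' beta S) (fun A => t * step B A).
  move=> t0 [mb' _ _] bt ctl.
  apply: (commutator_controlled ps1 p1 (delta := fun A => (dG A).1)
    (Gam := fun A => (dG A).2) _ _ (cb := bmo_center b') beta t0 mb' _ ctl).
  - by move=> A; have [] := HdG A.
  - by move=> A; have [] := HdG A.
  - by move=> a l; exact: bmo_oscillation.
have [Apm Apl _] := pair.
have [mf m0] := sup_fin _ Apm; have [lf l0] := sup_fin _ Apl.
have rootK a : 0 <= a -> (a `^ p) `^ p^-1 = a.
  by move=> a0; rewrite -powRrM divff ?gt_eqF// powRr1.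
pose A := Num.max (fine (Ap_sup p ps mu)) (fine (Ap_sup p ps lam)).
have AE : Num.max (fine (Ap_const p ps mu) `^ p^-1) (fine (Ap_const p ps lam) `^ p^-1) = A.
  apply: congr2; first exact: etrans (congr1 (fun a => a `^ p^-1) (constE mu)) (rootK _ m0).
  exact: etrans (congr1 (fun a => a `^ p^-1) (constE lam)) (rootK _ l0).
refine (eq_ind_r (fun a => (_ <= (K a)%:E * _)%E) _ AE).
have maxl (a c : R) : a <= Num.max a c by rewrite le_max lexx.
have maxr (a c : R) : c <= Num.max a c by rewrite le_max lexx orbT.
have mA : (Ap_sup p ps mu <= A%:E)%E.
  apply: (@le_trans _ _ (fine (Ap_sup p ps mu))%:E); first by rewrite (fineK mf).
  by rewrite lee_fin; exact: maxl.
have lA : (Ap_sup p ps lam <= A%:E)%E.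
  apply: (@le_trans _ _ (fine (Ap_sup p ps lam))%:E); first by rewrite (fineK lf).
  by rewrite lee_fin; exact: maxr.
pose beta j i := fine (bmo_norm (b j i)).
have betaE j i : bmo_norm (b j i) = (beta j i)%:E.
  by rewrite fineK// ge0_fin_numE ?bmo_norm_ge0//; have [] := bB j i.
have beta0 j i : 0 <= beta j i by rewrite fine_ge0// bmo_norm_ge0.
(* The norms are enlarged by [e] to make them positive, as a symbol of norm 0 admits
   no finite radius proportional to the inverse of its norm. *)
have approx (e : R) : 0 < e ->
    (opnorm p ps mu (nu_weight p ps lam) (higher_commutator b T) <=
     ((\prod_j \prod_i (beta j i + e)) * K A)%:E)%E.
  move=> e0; apply: ereal_inf_lbound.
  exists ((\prod_j \prod_i (beta j i + e)) * K A) => //.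
  have te j i : 0 < beta j i + e by rewrite ltr_wpDl.
  have bt j i : (bmo_norm (b j i) <= (beta j i + e)%:E)%E.
    by rewrite betaE lee_fin lerDl ltW.
  have := higher_controlled stepL stepC te bB bt ctlT pair mA lA.
  by case.
set o := opnorm _ _ _ _ _ in approx *.
have -> : (\prod_(j < m) \prod_(i < k j) bmo_norm (b j i) =
    (\prod_j \prod_i beta j i)%:E)%E.
  rewrite -prodEFin; apply: eq_bigr => j _; rewrite -prodEFin.
  by apply: eq_bigr => i _.
rewrite -EFinM.
have o0 : (0 <= o)%E.
  by apply: le_ereal_inf_tmp => _ [K1 [K0 _] <-]; rewrite lee_fin.
have ofin : o \is a fin_num.
  by rewrite ge0_fin_numE//; apply: (le_lt_trans (approx 1 ltr01)); exact: ltry.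
rewrite -(fineK ofin) lee_fin.
pose P : {poly R} := (\prod_j \prod_i ((beta j i)%:P + 'X)) * (K A)%:P.
have PE e : P.[e] = (\prod_j \prod_i (beta j i + e)) * K A.
  rewrite /P hornerM hornerC horner_prod; congr (_ * _); apply: eq_bigr => j _.
  by rewrite horner_prod; apply: eq_bigr => i _; rewrite hornerD hornerC hornerX.
have P0 : P.[0] = K A * \prod_j \prod_i beta j i.
  rewrite PE mulrC; congr (_ * _); apply: eq_bigr => j _; apply: eq_bigr => i _.
  by rewrite addr0.
rewrite -P0.
have cP : P.[x] @[x --> (0 : R)^'+] --> P.[0].
  by apply: cvg_at_right_filter; exact: continuous_horner.
apply: (cvgr_to_ge cP); near=> e.
rewrite -lee_fin fineK// PE; apply: approx; near: e; exact: nbhs_right_gt.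
Unshelve. all: by end_near. Qed.
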